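(* Let $p\in[2,3)$, $T>0$, $y\in\mathbb{R}^n$, $U\subseteq\mathbb{R}^m$, $u\in L^\infty([0,T],U)$. Let $b:[0,T]\times\mathbb{R}^n\times U\to\mathbb{R}^n$ be such that: $b(\cdot,x,u)$ is measurable for all $(x,u)\in\mathbb{R}^n\times U$; $b(t,\cdot,\cdot)$ is continuous for a.e. $t\in[0,T]$; and there is a constant $C_b\ge0$ with $\|b(t,x,u)\|\le C_b$ and $\|b(t,x,u)-b(t,\tilde x,u)\|\le C_b\|x-\tilde x\|$ for a.e. $t\in[0,T]$, all $x,\tilde x\in\mathbb{R}^n$ and $u\in U$. Let $\sigma\in C^3_b([0,T]\times\mathbb{R}^n,\mathbb{R}^{n\times d})$ and let $\mathbf X=(X,\mathbb X)\in\mathscr C^p([0,T],\mathbb{R}^d)$ be a rough path. Then there exists a unique $(Y,Y')\in\mathscr D^p_X([0,T],\mathbb{R}^n)$ with $Y'=\sigma(\cdot,Y)$ such that $$Y_t=y+\int_0^tb(s,Y_s,u_s)\,ds+\int_0^t\sigma(s,Y_s)\,d\mathbf X_s,\qquad t\in[0,T],$$ where the last term is the rough integral of $(\sigma(\cdot,Y),\sigma(\cdot,Y)')=(\sigma(\cdot,Y),\nabla_x\sigma(\cdot,Y)Y')\in\mathscr D^p_X$ against $\mathbf X$.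
   Context: $L^\infty([0,T],U)$: measurable essentially bounded maps $[0,T]\to U$. $C^k_b$: bounded $k$-times continuously differentiable functions with bounded derivatives up to order $k$. For $X:[0,T]\to E$, $X_{s,t}:=X_t-X_s$, and $\|X\|_{q,[s,t]}:=\big(\sup_\pi\sum_{[u,v]\in\pi}\|X_{u,v}\|^q\big)^{1/q}$ (sup over partitions $\pi$ of $[s,t]$); the same formula defines $\|R\|_{q,[s,t]}$ for two-parameter maps $R:[0,T]^2\to E$. $\mathcal C^p$: continuous paths with finite $p$-variation on $[0,T]$. A rough path $\mathbf X=(X,\mathbb X)\in\mathscr C^p([0,T],\mathbb{R}^d)$ consists of $X\in\mathcal C^p([0,T],\mathbb{R}^d)$ and a continuous $\mathbb X:[0,T]^2\to\mathbb{R}^{d\times d}$ of finite $\frac p2$-variation with $\mathbb X^{ij}_{s,t}=\mathbb X^{ij}_{s,r}+\mathbb X^{ij}_{r,t}+X^i_{s,r}X^j_{r,t}$ for all $i,j$, $s,r,t$. A controlled path $(Y,Y')\in\mathscr D^p_X([0,T],\mathbb{R}^k)$ is a pair $Y\in\mathcal C^p([0,T],\mathbb{R}^k)$, $Y'\in\mathcal C^p([0,T],\mathbb{R}^{k\times d})$ such that $R^Y_{s,t}:=Y_{s,t}-Y'_sX_{s,t}$ has finite $\frac p2$-variation. For $(Y,Y')\in\mathscr D^p_X([0,T],\mathbb{R}^{k\times d})$, the rough integral is $\int_s^tY_r\,d\mathbf X_r:=\lim_{|\pi|\to0}\sum_{[u,v]\in\pi}(Y_uX_{u,v}+Y'_u\mathbb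 X_{u,v})$ over partitions $\pi$ of $[s,t]$ with vanishing mesh. *)

(* Defs.v *)
From HB Require Import structures.
From mathcomp Require Import all_boot all_order all_algebra.
From mathcomp Require Import all_classical all_reals all_analysis.

Set Implicit Arguments.
Unset Strict Implicit.
Unset Printing Implicit Defensive.

Import Order.TTheory GRing.Theory Num.Theory.
Import numFieldNormedType.Exports.

Local Open Scope classical_set_scope.
Local Open Scope ring_scope.

(* R^k is 'cV[R]_k and R^(k x l) is 'M[R]_(k, l), both with the library's sup
   norm. All notions below (continuity, finite q-variation, boundedness up to a
   constant, derivatives) are unchanged under passing to an equivalent norm.
   Paths on [0, T] are total functions on R of which only the values on [0, T]
   are ever constrained. *)

Section LebesgueMeasurability.
Context {R : realType}.

(* R with the sigma-algebra of Lebesgue (not only Borel) measurable sets. *)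
Definition lebesgueType : measurableType _ :=
  caratheodory_type ((wlength (@idfun R))^*)%mu.

Definition lebesgue : {measure set lebesgueType -> \bar R} :=
  @completed_lebesgue_measure R.

Definition lebesgue_measurable_mx k l (D : set R) (f : R -> 'M[R]_(k, l)) :=
  forall i j, measurable_fun (D : set lebesgueType)
    ((fun t => f t i j) : lebesgueType -> R).

Definition integral_mx k l (D : set R) (f : R -> 'M[R]_(k, l)) : 'M[R]_(k, l) :=
  \matrix_(i, j) Rintegral lebesgue (D : set lebesgueType) (fun t => f t i j).

Definition Linfty k (D : set R) (U : set 'cV[R]_k) (u : R -> 'cV[R]_k) :=
  [/\ lebesgue_measurable_mx D u,
      exists M : R, \forall t \ae lebesgue, D t -> `|u t| <= M
    & forall t, D t -> U (u t)].

End LebesgueMeasurability.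
Arguments lebesgueType : clear implicits.

(* C^k_b on a set D that is the closure of its interior: the iterated
   directional derivatives up to order k exist in the interior of D and extend to
   bounded continuous functions on D. *)
Fixpoint Ckb (R : realType) (V W : normedModType R) (D : set V) (k : nat)
    (f : V -> W) : Prop :=
  [/\ {within D, continuous f},
      exists M : R, forall z, D z -> `|f z| <= M
    & if k is k'.+1 then
        forall v : V, exists g : V -> W,
          (forall z, D° z -> is_derive z v f (g z)) /\ Ckb D k' g
      else True].

Section Variation.
Context {R : realType} {E : normedModType R}.
Implicit Types (X : R -> E) (A : R -> R -> E).

Definition increment X (s t : R) : E := X t - X s.

(* The partition s = x_0 < x_1 < ... < x_N = t is given by [:: x_1; ...; x_N]. *)
Definition partition_sum (F : zmodType) (A : R -> R -> F) (s t : R)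
    (pi : seq R) : F :=
  \sum_(0 <= i < size pi) A (nth t (s :: pi) i) (nth t (s :: pi) i.+1).

Definition variation_norm (q : R) A (s t : R) : \bar R :=
  (ereal_sup [set (partition_sum (fun u v => `|A u v| `^ q) s t pi)%:E
             | pi in itv_partition s t] `^ q^-1)%E.

Definition Cvar (p T : R) X :=
  {within `[0, T], continuous X} /\
  (variation_norm p (increment X) 0 T < +oo)%E.

End Variation.

Section RoughPaths.
Context {R : realType}.
Variables (p T : R).

Definition rough_path d (X : R -> 'cV[R]_d) (XX : R -> R -> 'M[R]_d) :=
  [/\ Cvar p T X,
      {within `[0, T] `*` `[0, T], continuous (fun z : R * R => XX z.1 z.2)},
      (variation_norm (p / 2) XX 0 T < +oo)%E
    & forall i j s r t, s \in `[0, T] -> r \in `[0, T] -> t \in `[0, T] ->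
        XX s t i j = XX s r i j + XX r t i j
                     + increment X s r i 0 * increment X r t j 0].

Definition remainder d k (X : R -> 'cV[R]_d) (Y : R -> 'cV[R]_k)
    (Y' : R -> 'M[R]_(k, d)) (s t : R) : 'cV[R]_k :=
  increment Y s t - Y' s *m increment X s t.

Definition controlled d k (X : R -> 'cV[R]_d) (Y : R -> 'cV[R]_k)
    (Y' : R -> 'M[R]_(k, d)) :=
  [/\ Cvar p T Y, Cvar p T Y'
    & (variation_norm (p / 2) (remainder X Y Y') 0 T < +oo)%E].

(* Controlled paths in R^(k x d), read column by column: Z' t j : 'M_(k, d) is
   the Gubinelli derivative of the j-th column of Z, so that the third-order
   tensor Z' has entries Z'^{ij,l} = Z' t j i l, where l is contracted with the
   increment of X. *)
Definition controlled_mx d k (X : R -> 'cV[R]_d) (Z : R -> 'M[R]_(k, d))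
    (Z' : R -> 'I_d -> 'M[R]_(k, d)) :=
  forall j, controlled X (fun t => col j (Z t)) (fun t => Z' t j).

(* (Z'_u XX_{u,v})^i = \sum_(j, l) Z'^{ij,l}_u XX^{lj}_{u,v}; the index order
   follows Chen's relation above, in which XX^{lj} stands for the integral of
   X^l against X^j. *)
Definition compensated_sum d k (X : R -> 'cV[R]_d) (XX : R -> R -> 'M[R]_d)
    (Z : R -> 'M[R]_(k, d)) (Z' : R -> 'I_d -> 'M[R]_(k, d))
    (s t : R) : seq R -> 'cV[R]_k :=
  partition_sum (fun u v =>
    Z u *m increment X u v + \sum_j Z' u j *m col j (XX u v)) s t.

Definition mesh_to_0 (s t : R) : set_system (seq R) :=
  filter_from [set e : R | 0 < e] (fun e => [set pi |
    itv_partition s t pi /\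
    forall i, (i < size pi)%N ->
      nth t (s :: pi) i.+1 - nth t (s :: pi) i < e]).

Definition rough_integrable d k (X : R -> 'cV[R]_d) (XX : R -> R -> 'M[R]_d)
    (Z : R -> 'M[R]_(k, d)) (Z' : R -> 'I_d -> 'M[R]_(k, d)) (s t : R) :=
  cvg (compensated_sum X XX Z Z' s t @ mesh_to_0 s t).

Definition rough_integral d k (X : R -> 'cV[R]_d) (XX : R -> R -> 'M[R]_d)
    (Z : R -> 'M[R]_(k, d)) (Z' : R -> 'I_d -> 'M[R]_(k, d)) (s t : R) :
    'cV[R]_k :=
  lim (compensated_sum X XX Z Z' s t @ mesh_to_0 s t).

(* The Jacobian matrix of the j-th column of sigma(t, .) at x. *)
Definition nabla_x n d (sigma : R -> 'cV[R]_n -> 'M[R]_(n, d)) (t : R)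
    (x : 'cV[R]_n) (j : 'I_d) : 'M[R]_n :=
  \matrix_(i, l) ('D_(delta_mx l 0) (sigma t) x) i j.

Definition sigma_along n d (sigma : R -> 'cV[R]_n -> 'M[R]_(n, d))
    (Y : R -> 'cV[R]_n) : R -> 'M[R]_(n, d) :=
  fun t => sigma t (Y t).

Definition sigma_along' n d (sigma : R -> 'cV[R]_n -> 'M[R]_(n, d))
    (Y : R -> 'cV[R]_n) (Y' : R -> 'M[R]_(n, d)) :
    R -> 'I_d -> 'M[R]_(n, d) :=
  fun t j => nabla_x sigma t (Y t) j *m Y' t.

Definition rde_solution n m d (y : 'cV[R]_n)
    (b : R -> 'cV[R]_n -> 'cV[R]_m -> 'cV[R]_n) (u : R -> 'cV[R]_m)
    (sigma : R -> 'cV[R]_n -> 'M[R]_(n, d))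
    (X : R -> 'cV[R]_d) (XX : R -> R -> 'M[R]_d)
    (Y : R -> 'cV[R]_n) (Y' : R -> 'M[R]_(n, d)) :=
  [/\ controlled X Y Y',
      forall t, t \in `[0, T] -> Y' t = sigma t (Y t)
    & forall t, t \in `[0, T] ->
        Y t = y + integral_mx `[0, t] (fun s => b s (Y s) (u s))
              + rough_integral X XX (sigma_along sigma Y)
                  (sigma_along' sigma Y Y') 0 t].

End RoughPaths.

(* Main.v *)
From HB Require Import structures.
Require Import Defs.
From mathcomp Require Import all_boot all_order all_algebra.
From mathcomp Require Import all_classical all_reals all_analysis.
From mathcomp Require Import measurable_realfun ring lra zify.
Set Implicit Arguments.
Unset Strict Implicit.
Unset Printing Implicit Defensive.
Import Order.TTheory GRing.Theory Num.Theory.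
Import numFieldNormedType.Exports.
Local Open Scope classical_set_scope.
Local Open Scope ring_scope.

(** The theorem is a statement about one-step schemes. Over a short interval
    [s, t] a solution that is at [y] at time [s] moves by approximately
    [mu s t y + B s t y], where [mu] is the second order step
    [sigma s y X_{s,t} + sum_j (nabla sigma_j sigma) (s, y) XX^j_{s,t}] and [B] is
    the integral of the drift with the state frozen at [y]. By Chen's relation
    the step over [s, t] differs from the composition of the steps over [s, r]
    and [r, t] by a defect of order [3 * al > 1] in a superadditive control [om],
    which is moreover Lipschitz in [y] with a constant of the same order
    ([rough_defectE], [rough_step_flow]).

    A sewing lemma with feedback ([discrete_sewing]) turns this into estimates
    that are uniform over all grids: a scheme stays close to a single step
    ([scheme_apriori]) and depends in a Lipschitz way on its initial value and on
    the sum of its perturbations ([scheme_stability]). Comparing partitions with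
    their common refinements, the Euler schemes converge as the mesh vanishes
    ([euler_cvg]); the limit path has one-step errors of order [1 + ga], where
    [ga = 3 * al - 1] ([euler_limit_step]), and every path with one-step errors of
    that order is the limit ([euler_cvg_to]).

    This single convergence theorem is used three times. The compensated sums of
    a rough integral along a controlled path are the Euler schemes of a flow that
    does not depend on the state, so the integral exists and has a local
    expansion ([rough_integral_step]). The increments of a solution agree with
    the step up to order [1 + ga], so it is the limit of the schemes, whence
    uniqueness ([solution_is_euler_limit]). Conversely the limit [Y] of the schemes
    is controlled by [X], by its local expansion, and [Y - y - drift] has small
    one-step errors for the flow of the rough integral, so that it is the rough
    integral: this is existence ([euler_limit_is_solution]).

    Controls. The arguments need [om] to be small near the diagonal. For paths of
    finite [p]-variation that are continuous this is easy at any exponent larger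
    than [p] ([finite_variation_small_control]); since [p < 3] such an exponent can
    be chosen below three, and [al] is its inverse.

    Coefficients. The derivatives of [sigma] are given in the interior of the
    strip and extended by continuity. At the end times they are recovered by the
    mean value theorem ([is_derive_slice]), and moving along one axis at a time
    the partial derivatives yield the Lipschitz, second difference and Taylor
    estimates used for the defect ([taylor1_lipschitz],
    [Ckb_regular_coefficient]). The drift is only measurable in time: its
    composition with measurable paths is a limit of compositions with paths of
    countably many values ([caratheodory_measurable]). *)

(** * Identities in abelian groups *)

Section AbelianIdentities.
Variable V : zmodType.

Inductive zmod_expr :=
  | ZVar of nat | ZZero | ZAdd of zmod_expr & zmod_expr | ZOpp of zmod_expr.

Fixpoint zmod_eval (env : seq V) e : V :=
  match e with
  | ZVar n => nth 0 env n
  | ZZero => 0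
  | ZAdd a b => zmod_eval env a + zmod_eval env b
  | ZOpp a => - zmod_eval env a
  end.

Fixpoint signed_atoms (pos : bool) e : seq nat :=
  match e with
  | ZVar n => if pos then [:: n] else [::]
  | ZZero => [::]
  | ZAdd a b => signed_atoms pos a ++ signed_atoms pos b
  | ZOpp a => signed_atoms (~~ pos) a
  end.

Lemma zmod_evalE env e : zmod_eval env e =
  \sum_(i <- signed_atoms true e) nth 0 env i
  - \sum_(i <- signed_atoms false e) nth 0 env i.
Proof.
elim: e => [n||a IHa b IHb|a IHa] /=.
- by rewrite big_seq1 big_nil subr0.
- by rewrite !big_nil subr0.
- by rewrite !big_cat/= IHa IHb opprD addrACA.
- by rewrite IHa opprB.
Qed.

Lemma zmod_eval_eq env e1 e2 :
  perm_eq (signed_atoms true e1 ++ signed_atoms false e2)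
          (signed_atoms true e2 ++ signed_atoms false e1) ->
  zmod_eval env e1 = zmod_eval env e2.
Proof.
move=> e12; have := perm_big (op := +%R) (x := 0) (P := xpredT) (F := nth 0 env) _ e12.
rewrite !big_cat/= => h.
by apply/eqP; rewrite !zmod_evalE subr_eq addrAC eq_sym subr_eq h.
Qed.

End AbelianIdentities.

(* Atoms are compared up to conversion: the same subterm may carry different
   but convertible structure instances. *)
Ltac zmod_index x env :=
  match env with
  | ?y :: _ => let _ := match tt with _ => unify x y end in constr:(0%N)
  | _ :: ?env' => let n := zmod_index x env' in constr:(S n)
  end.

Ltac zmod_atoms t env :=
  match t with
  | @GRing.add _ ?a ?b => let env' := zmod_atoms a env in zmod_atoms b env'
  | @GRing.opp _ ?a => zmod_atoms a env
  | @GRing.zero _ => env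
  | _ => match constr:(tt) with
         | _ => let _ := zmod_index t env in env
         | _ => constr:(t :: env)
         end
  end.

Ltac zmod_reify t env :=
  match t with
  | @GRing.add _ ?a ?b =>
    let a' := zmod_reify a env in let b' := zmod_reify b env in
    constr:(ZAdd a' b')
  | @GRing.opp _ ?a => let a' := zmod_reify a env in constr:(ZOpp a')
  | @GRing.zero _ => constr:(ZZero)
  | _ => let n := zmod_index t env in constr:(ZVar n)
  end.

(** Decides equalities that hold in the free abelian group on the maximal
    subterms that are not sums, opposites or zero, by comparing the multisets of
    atoms that occur with either sign. *)
Ltac zmod :=
  lazymatch goal with |- @eq ?V ?x ?y =>
    let env0 := zmod_atoms x (@nil V) in
    let env := zmod_atoms y env0 in
    let e1 := zmod_reify x env in
    let e2 := zmod_reify y env in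
    exact: (@zmod_eval_eq _ env e1 e2 isT)
  end.

(** * Discrete sewing *)

Section DiscreteSewing.
Context {R : realType}.
Implicit Types (w N : nat -> nat -> R).

Definition superadditive w :=
  (forall i j, (i <= j)%N -> 0 <= w i j) /\
  (forall i j k, (i <= j)%N -> (j <= k)%N -> w i j + w j k <= w i k).

Lemma superadditive_diag w i : superadditive w -> w i i = 0.
Proof.
move=> [w0 wA]; apply/eqP; rewrite eq_le w0// andbT.
by have := wA i i i (leqnn _) (leqnn _); rewrite gerDl.
Qed.

Lemma superadditive_mono w i i' j' j : superadditive w ->
  (i <= i')%N -> (i' <= j')%N -> (j' <= j)%N -> w i' j' <= w i j.
Proof.
move=> [w0 wA] ii ij jj.
have h1 := wA i i' j' ii ij; have h2 := wA i j' j (leq_trans ii ij) jj.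
have h3 := w0 i i' ii; have h4 := w0 j' j jj; lra.
Qed.

Lemma superadditive_sum w i j : superadditive w -> (i <= j)%N ->
  \sum_(i <= k < j) w k k.+1 <= w i j.
Proof.
move=> wS; elim: j => [|j IH]; first by rewrite leqn0 => /eqP ->; rewrite big_geq ?(superadditive_diag _ wS).
rewrite leq_eqVlt => /predU1P[->|]; first by rewrite big_geq ?(superadditive_diag _ wS).
rewrite ltnS => ij; rewrite big_nat_recr//=.
apply: le_trans (wS.2 i j j.+1 ij (leqnSn _)); exact: lerD (IH ij) _.
Qed.

Lemma superadditive_lin w N a b : 0 <= a -> 0 <= b ->
  superadditive w -> superadditive N -> superadditive (fun i j => a * w i j + b * N i j).
Proof.
move=> a0 b0 [w0 wA] [N0 NA]; split=> [i j ij|i j k ij jk].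
  by rewrite addr_ge0 ?mulr_ge0 ?w0 ?N0.
have h1 := ler_wpM2l a0 (wA i j k ij jk); have h2 := ler_wpM2l b0 (NA i j k ij jk).
lra.
Qed.

Lemma superadditive_partial_sum (e : nat -> R) : (forall k, 0 <= e k) ->
  superadditive (fun i j => \sum_(i <= k < j) e k).
Proof.
move=> e0; split=> [i j ij|i j k ij jk]; first by apply: sumr_ge0.
by rewrite -big_cat_nat.
Qed.

(** The last [j] with [w i j <= w i k / 2]: one index further, superadditivity
    leaves at most half of the weight for the rest. *)
Lemma exists_half_index w i k : superadditive w -> (i < k)%N ->
  exists j, [/\ (i <= j < k)%N, w i j <= w i k / 2 & w j.+1 k <= w i k / 2].
Proof.
move=> wS ik.
have wik0 : 0 <= w i k by apply: wS.1; exact: ltnW.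
pose Q j := (i <= j < k)%N && (w i j <= w i k / 2).
have exQ : exists j, Q j.
  by exists i; rewrite /Q leqnn ik/= (superadditive_diag _ wS) divr_ge0.
have Qk j : Q j -> (j <= k)%N by move=> /andP[/andP[_ /ltnW]].
have [j /andP[/andP[ij jk] wij] jmax] := ex_maxnP exQ Qk.
exists j; split=> //; first by rewrite ij.
have [->|nejk] := eqVneq j.+1 k; first by rewrite (superadditive_diag _ wS) divr_ge0.
have jk1 : (j.+1 < k)%N by rewrite ltn_neqAle nejk.
have : ~~ Q j.+1 by apply/negP => /jmax; rewrite ltnn.
rewrite /Q jk1 (leqW ij)/= -ltNge => wij1.
have := wS.2 i j.+1 k (leqW ij) (ltnW jk1).
by rewrite {1}(splitr (w i k)); lra.
Qed.

Lemma powR_le (x y r : R) : 0 <= r -> 0 <= x -> x <= y -> x `^ r <= y `^ r.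
Proof.
move=> r0 x0 xy; apply: ge0_ler_powR; rewrite ?nnegrE//.
exact: le_trans x0 xy.
Qed.

(** The solution [K] of [K * (1 - 2 `^ - ga) = 4]: in the induction below the two
    defects cost one unit each and the feedback term costs two more. *)
Definition sewing_const (ga : R) : R := 4 / (1 - 2^-1 `^ ga).

Lemma half_powR_lt1 (ga : R) : 0 < ga -> 2^-1 `^ ga < 1.
Proof.
move=> ga0; have := @gt0_ltr_powR R ga ga0 2^-1 1.
by rewrite powR1; apply; rewrite ?nnegrE//; lra.
Qed.

Lemma sewing_const_ge0 ga : 0 < ga -> 0 <= sewing_const ga.
Proof. by move=> /half_powR_lt1 h; rewrite divr_ge0// subr_ge0 ltW. Qed.

(** Sewing with feedback. Split [i, k] around one elementary step so that either
    side carries at most half of the weight. The step contributes nothing, the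
    two sides contribute by induction a factor [2 `^ - ga], and [N] adds up. The
    defect may involve [G] itself: a multiple [a * `|G i j|] of the quantity being
    estimated is absorbed as long as [a] is small compared with the gain
    [1 - 2 `^ - ga]. The hereditary relation [P] is there to use the lemma only on
    intervals on which the control, hence [a], is small. *)
Lemma discrete_sewing (V : normedModType R) (P : nat -> nat -> Prop)
    (G : nat -> nat -> V) N w (ga a : R) :
  0 < ga -> superadditive w -> superadditive N ->
  (forall i i' k' k, P i k -> (i <= i')%N -> (i' <= k')%N -> (k' <= k)%N -> P i' k') ->
  (forall i, G i i = 0) -> (forall i, G i i.+1 = 0) ->
  0 <= a -> a <= (1 - 2^-1 `^ ga) / 2 ->
  (forall i j k, (i <= j)%N -> (j <= k)%N -> P i k ->
     `|G i k - G i j - G j k| <= N i k * w i k `^ ga + a * `|G i j|) ->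
  forall i k, (i <= k)%N -> P i k ->
    `|G i k| <= sewing_const ga * N i k * w i k `^ ga.
Proof.
move=> ga0 wS NS Pher G0 G1 a0 a1 dG i k.
have [c cE] : exists c, c = 2^-1 `^ ga by exists (2^-1 `^ ga).
rewrite -cE in a1.
have c1 : c < 1 by rewrite cE; exact: half_powR_lt1.
have c0 : 0 <= c by rewrite cE; exact: powR_ge0.
set K := sewing_const ga.
have K0 : 0 <= K by exact: sewing_const_ge0.
have KE : K * (1 - c) = 4.
  by rewrite /K /sewing_const -cE divfK// subr_eq0 eq_sym lt_eqF.
have [w0 N0] := (wS.1, NS.1); clearbody K.
move: {2}(k - i)%N (leqnn (k - i)) => n.
elim: n i k => [|n IH] i k.
  rewrite leqn0 subn_eq0 => ki ik _.
  have -> : i = k by apply/eqP; rewrite eqn_leq ik ki.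
  by rewrite G0 normr0 !mulr_ge0 ?NS.1 ?powR_ge0 ?N0.
move=> kin ik Pik.
move: ik; rewrite leq_eqVlt => /predU1P[->|ik].
  by rewrite G0 normr0 !mulr_ge0 ?NS.1 ?powR_ge0 ?N0.
have [j [/andP[ij jk] wij wjk]] := exists_half_index wS ik.
have Pij : P i j by apply: Pher Pik _ _ _ => //; exact: ltnW.
have Pjk : P j k by apply: Pher Pik _ _ _ => //; exact: ltnW.
have Pjk1 : P j.+1 k by apply: Pher Pik _ _ _ => //; exact: leqW.
have wik0 : 0 <= w i k by apply: wS.1; exact: ltnW.
have half x : 0 <= x -> x <= w i k / 2 -> x `^ ga <= c * w i k `^ ga.
  move=> x0 xw; rewrite cE -powRM// ?invr_ge0//.
  by apply: ge0_ler_powR; rewrite ?nnegrE ?mulr_ge0 ?invr_ge0// ?(ltW ga0)// mulrC.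
have Gij : `|G i j| <= K * N i j * (c * w i k `^ ga).
  have jin : (j - i <= n)%N by lia.
  apply: le_trans (IH _ _ jin ij Pij) _.
  by apply: ler_wpM2l; [by rewrite mulr_ge0 ?NS.1|by rewrite half ?wS.1].
have Gjk : `|G j.+1 k| <= K * N j.+1 k * (c * w i k `^ ga).
  have kjn : (k - j.+1 <= n)%N by lia.
  apply: le_trans (IH _ _ kjn jk Pjk1) _.
  by apply: ler_wpM2l; [by rewrite mulr_ge0 ?NS.1|by rewrite half ?wS.1].
have d1 := dG i j k ij (ltnW jk) Pik.
have d2 : `|G j k - G j j.+1 - G j.+1 k| <= N i k * w i k `^ ga.
  apply: le_trans (dG j j.+1 k (leqnSn _) jk Pjk) _.
  have ij' := ltnW jk; rewrite G1 normr0 mulr0 addr0.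
  apply: ler_pM; [exact: N0|exact: powR_ge0| |].
    exact: superadditive_mono NS ij ij' (leqnn _).
  apply: powR_le; [exact: ltW|exact: w0|].
  exact: superadditive_mono wS ij ij' (leqnn _).
have -> : G i k = (G i k - G i j - G j k) + (G j k - G j j.+1 - G j.+1 k)
                  + (G i j + G j.+1 k).
  by rewrite G1; zmod.
set W := w i k `^ ga in Gij Gjk d1 d2 *.
have W0 : 0 <= W by exact: powR_ge0.
have NA : N i j + N j.+1 k <= N i k.
  apply: le_trans (NS.2 i j.+1 k (leqW ij) jk); rewrite lerD2r.
  exact: superadditive_mono NS (leqnn _) ij (leqnSn _).
apply: le_trans (ler_normD _ _) _.
apply: le_trans (lerD (ler_normD _ _) (ler_normD _ _)) _.
have Nij : 0 <= N i j by apply: NS.1.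
have Njk : 0 <= N j.+1 k by apply: NS.1.
have h1 : K * N i j * (c * W) + K * N j.+1 k * (c * W) <= K * N i k * (c * W).
  have -> : K * N i j * (c * W) + K * N j.+1 k * (c * W) = (K * (c * W)) * (N i j + N j.+1 k) by ring.
  have -> : K * N i k * (c * W) = (K * (c * W)) * N i k by ring.
  by rewrite ler_wpM2l// !mulr_ge0.
have h2 : a * `|G i j| <= (1 - c) / 2 * (K * N i k * W).
  apply: ler_pM => //; apply: le_trans Gij _.
  apply: ler_pM; rewrite ?mulr_ge0//.
    by rewrite ler_wpM2l// (le_trans _ NA)// lerDl.
  by rewrite ler_piMl// ltW.
have h3 : (1 - c) / 2 * (K * N i k * W) = 2 * (N i k * W).
  have -> : (1 - c) / 2 * (K * N i k * W) = (K * (1 - c)) / 2 * (N i k * W) by ring.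
  by rewrite KE; congr (_ * _); lra.
have h4 : K * N i k * W = K * N i k * (c * W) + 4 * (N i k * W).
  by rewrite -KE; ring.
lra.
Qed.

End DiscreteSewing.

(** * One-step schemes: a priori bound and stability on a grid *)

Section Schemes.
Context {R : realType} {V : normedModType R}.
Implicit Types (om : R -> R -> R) (mu B : R -> R -> V -> V) (tau : nat -> R).

(** No continuity is asked of a control: being small uniformly near the diagonal
    is enough to make small both the cells of fine partitions and the constants
    that have to be absorbed. *)
Record control (T : R) om : Prop := Control {
  control_ge0 : forall s t, 0 <= s -> s <= t -> t <= T -> 0 <= om s t;
  control_super : forall s r t, 0 <= s -> s <= r -> r <= t -> t <= T ->
    om s r + om r t <= om s t;
  control_small : forall e, 0 < e -> exists2 h, 0 < h &
    forall s t, 0 <= s -> s <= t -> t <= T -> t - s <= h -> om s t <= e }.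

Definition defect mu s r t y := mu s t y - mu s r y - mu r t (y + mu s r y).

(** The four point bound contains the Lipschitz bound in the state (take
    [h' = 0] and [x' = x]) and a second difference bound (take [h' = h]), which is
    what makes the difference of two schemes satisfy the same kind of estimates
    as one scheme. *)
Record almost_flow (T C al ga : R) om mu : Prop := AlmostFlow {
  flow_bounded : forall s t y, 0 <= s -> s <= t -> t <= T ->
    `|mu s t y| <= C * om s t `^ al;
  flow_4points : forall s t x h x' h', 0 <= s -> s <= t -> t <= T ->
    `|mu s t (x + h) - mu s t x - (mu s t (x' + h') - mu s t x')|
      <= C * om s t `^ al * (`|h - h'| + `|x - x'| * `|h|);
  flow_defect : forall s r t y, 0 <= s -> s <= r -> r <= t -> t <= T ->
    `|defect mu s r t y| <= C * (om s t * om s t `^ ga);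
  flow_defect_lip : forall s r t x y, 0 <= s -> s <= r -> r <= t -> t <= T ->
    `|defect mu s r t x - defect mu s r t y|
      <= C * (om s t * om s t `^ ga) * `|x - y| }.

(** Additivity makes a drift exact under refinement, so that only its dependence
    on the state, of first order in the control, has to be kept track of. *)
Record drift (T L : R) om B : Prop := Drift {
  drift_add : forall s r t y, 0 <= s -> s <= r -> r <= t -> t <= T ->
    B s t y = B s r y + B r t y;
  drift_bounded : forall s t y, 0 <= s -> s <= t -> t <= T ->
    `|B s t y| <= L * om s t;
  drift_lip : forall s t x y, 0 <= s -> s <= t -> t <= T ->
    `|B s t x - B s t y| <= L * om s t * `|x - y| }.

Definition grid (T : R) tau :=
  (forall i j, (i <= j)%N -> tau i <= tau j) /\ (forall i, 0 <= tau i <= T).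

Definition scheme mu tau (y d : nat -> V) :=
  forall k, y k.+1 = y k + mu (tau k) (tau k.+1) (y k) + d k.

Definition local_error mu tau (y d : nat -> V) i j :=
  y j - y i - mu (tau i) (tau j) (y i) - \sum_(i <= k < j) d k.

Lemma exists_small_powR (C a al : R) : 0 < al -> 0 <= C -> 0 < a ->
  exists2 e, 0 < e <= 1 & forall x, 0 <= x -> x <= e -> C * x `^ al <= a.
Proof.
move=> al0 C0 a0; pose b := a / (C + 1).
have b0 : 0 < b by rewrite divr_gt0// ltr_pwDr.
exists (Num.min 1 (b `^ al^-1)).
  by rewrite ge_min lexx lt_min ltr01 powR_gt0.
move=> x x0; rewrite le_min => /andP[_ xb].
have : x `^ al <= b.
  apply: le_trans (powR_le (ltW al0) x0 xb) _.
  by rewrite -powRrM mulVf ?gt_eqF// powRr1// ltW.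
move=> xb'; apply: le_trans (ler_wpM2l C0 xb') _.
have C1 : C / (C + 1) <= 1 by rewrite ler_pdivrMr; lra.
by rewrite /b mulrCA; apply: ler_piMr => //; exact: ltW.
Qed.

Section OnGrid.
Variables (T C L al ga : R) (om : R -> R -> R) (mu : R -> R -> V -> V).
Hypotheses (C0 : 0 <= C) (L0 : 0 <= L) (ga0 : 0 < ga) (gaal : ga <= al).
Hypotheses (omC : control T om) (muF : almost_flow T C al ga om mu).

Let al0 : 0 < al. Proof. exact: lt_le_trans gaal. Qed.

Lemma control_diag s : 0 <= s -> s <= T -> om s s = 0.
Proof.
move=> s0 sT; apply/eqP; rewrite eq_le (control_ge0 omC)// andbT.
by have := control_super omC s0 (lexx s) (lexx s) sT; rewrite gerDl.
Qed.

Lemma control_mono s s' t' t : 0 <= s -> s <= s' -> s' <= t' -> t' <= t -> t <= T ->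
  om s' t' <= om s t.
Proof.
move=> s0 ss st tt tT.
have h1 := control_super omC s0 ss (le_trans st tt) tT.
have h2 := control_super omC (le_trans s0 ss) st tt tT.
have h3 := control_ge0 omC s0 ss (le_trans (le_trans st tt) tT).
have h4 := control_ge0 omC (le_trans s0 (le_trans ss st)) tt tT.
lra.
Qed.

Lemma grid_control tau : grid T tau ->
  superadditive (fun i j => om (tau i) (tau j)).
Proof.
move=> [tm tT]; have ti i : 0 <= tau i /\ tau i <= T by apply/andP; exact: tT.
split=> [i j ij|i j k ij jk].
  by apply: (control_ge0 omC); [exact: (ti i).1|exact: tm|exact: (ti j).2].
by apply: (control_super omC); [exact: (ti i).1|exact: tm|exact: tm|exact: (ti k).2].
Qed.

Lemma flow_lip s t x y : 0 <= s -> s <= t -> t <= T ->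
  `|mu s t x - mu s t y| <= C * om s t `^ al * `|x - y|.
Proof.
move=> s0 st tT; have := flow_4points muF y (x - y) y 0 s0 st tT.
have -> : y + (x - y) = x by zmod.
by rewrite !addr0 !subrr !subr0 normr0 mul0r addr0.
Qed.

Lemma powR_al_ga x : 0 <= x -> x <= 1 -> x `^ al <= x `^ ga.
Proof.
move=> x0 x1; move: x0; rewrite le_eqVlt => /predU1P[<-|x0].
  by rewrite !powR0 ?gt_eqF.
by apply: ger_powR => //; rewrite x0.
Qed.

Lemma powR_le1 x : 0 <= x -> x <= 1 -> x `^ al <= 1.
Proof.
move=> x0 x1; apply: le_trans (powR_le (ltW al0) x0 x1) _.
by rewrite powR1.
Qed.

Lemma flow_diag s y : 0 <= s -> s <= T -> mu s s y = 0.
Proof.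
move=> s0 sT; apply/eqP; rewrite -normr_eq0 eq_le normr_ge0 andbT.
by have := flow_bounded muF y s0 (lexx s) sT; rewrite control_diag// powR0 ?gt_eqF// mulr0.
Qed.

Lemma local_error_diag tau y d i : grid T tau -> local_error mu tau y d i i = 0.
Proof.
move=> [_ tT]; have /andP[ti0 tiT] := tT i.
by rewrite /local_error flow_diag// big_geq// !subr0 subrr.
Qed.

Lemma local_error_step tau y d i : scheme mu tau y d ->
  local_error mu tau y d i i.+1 = 0.
Proof. by move=> sc; rewrite /local_error big_nat1 sc; zmod. Qed.

(** The source of the feedback: beyond the defect of the flow, the error made
    before [j] shifts by [h] the point at which the next step is taken. *)
Lemma local_error_delta tau y d i j k : (i <= j)%N -> (j <= k)%N ->
  let G := local_error mu tau y d in
  let x := y i + mu (tau i) (tau j) (y i) in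
  let h := G i j + \sum_(i <= l < j) d l in
  G i k - G i j - G j k = - defect mu (tau i) (tau j) (tau k) (y i)
    + (mu (tau j) (tau k) (x + h) - mu (tau j) (tau k) x).
Proof.
move=> ij jk G x h.
have -> : x + h = y j by rewrite /x /h /G /local_error; zmod.
have sumE : \sum_(i <= l < k) d l = \sum_(i <= l < j) d l + \sum_(j <= l < k) d l.
  exact: big_cat_nat.
rewrite /G /local_error /defect -/x sumE; zmod.
Qed.

Lemma norm_sum_le_control tau (d : nat -> V) i j : grid T tau ->
  (forall k, `|d k| <= L * om (tau k) (tau k.+1)) -> (i <= j)%N ->
  `|\sum_(i <= k < j) d k| <= L * om (tau i) (tau j).
Proof.
move=> tG dL ij; apply: le_trans (ler_norm_sum _ _ _) _.
apply: le_trans (ler_sum _ (fun k _ => dL k)) _.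
rewrite -mulr_sumr ler_wpM2l//.
exact: (superadditive_sum (grid_control tG)).
Qed.

(** By the previous lemma the local error satisfies the hypotheses of the sewing
    lemma, the feedback coefficient being [C * om `^ al]; this is why the control
    has to be below a threshold. The bound is uniform over all grids. *)
Lemma scheme_apriori : exists2 eps, 0 < eps <= 1 & exists2 K, 0 <= K &
  forall tau y d, grid T tau -> scheme mu tau y d ->
  (forall k, `|d k| <= L * om (tau k) (tau k.+1)) ->
  forall i j, (i <= j)%N -> om (tau i) (tau j) <= eps ->
  `|local_error mu tau y d i j| <=
     K * (om (tau i) (tau j) * om (tau i) (tau j) `^ ga).
Proof.
have h2 := half_powR_lt1 ga0.
have a0 : 0 < (1 - 2^-1 `^ ga) / 2 by rewrite divr_gt0// subr_gt0.
have [eps /andP[eps0 eps1] epsP] := exists_small_powR al0 C0 a0.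
exists eps; first by rewrite eps0.
exists (sewing_const ga * (C + C * L)).
  by rewrite mulr_ge0 ?sewing_const_ge0// addr_ge0// mulr_ge0.
move=> tau y d tG sc dL i k ik wik.
pose w i j := om (tau i) (tau j).
have wS : superadditive w by exact: grid_control.
have [tm tT] := tG.
have NS : superadditive (fun i j => (C + C * L) * w i j + 0 * w i j).
  by apply: superadditive_lin => //; rewrite addr_ge0// mulr_ge0.
have := @discrete_sewing _ _ (fun i j => (i <= j)%N /\ w i j <= eps)
  (local_error mu tau y d) _ w ga (C * eps `^ al) ga0 wS NS.
have -> : sewing_const ga * (C + C * L) * (om (tau i) (tau k) * om (tau i) (tau k) `^ ga)
   = sewing_const ga * ((C + C * L) * w i k + 0 * w i k) * w i k `^ ga.
  by rewrite /w; ring.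
apply => //.
- move=> a i' k' b [_ we] ii ik' kk; split => //.
  exact: le_trans (superadditive_mono wS ii ik' kk) we.
- by move=> l; exact: local_error_diag.
- by move=> l; exact: local_error_step.
- by rewrite mulr_ge0 ?powR_ge0.
- by apply: epsP; rewrite ?lexx ?ltW.
clear i k ik wik => i j k ij jk [ik we].
have /andP[ti0 tiT] := tT i; have /andP[tj0 tjT] := tT j; have /andP[tk0 tkT] := tT k.
rewrite local_error_delta//.
apply: le_trans (ler_normD _ _) _; rewrite normrN.
apply: le_trans (lerD (flow_defect muF (y i) ti0 (tm _ _ ij) (tm _ _ jk) tkT)
  (flow_lip _ _ tj0 (tm _ _ jk) tkT)) _.
rewrite addrAC subrr add0r -/(w i k) -/(w j k).
set G := `|local_error _ _ _ _ i j|.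
have wik0 : 0 <= w i k by exact: wS.1.
have wjk0 : 0 <= w j k by exact: wS.1.
have wij0 : 0 <= w i j by exact: wS.1.
have wjk : w j k <= w i k := superadditive_mono wS ij jk (leqnn _).
have wij : w i j <= w i k := superadditive_mono wS (leqnn _) ij jk.
have nh : `|local_error mu tau y d i j + \sum_(i <= l < j) d l| <= G + L * w i k.
  apply: le_trans (ler_normD _ _) _; rewrite lerD2l.
  by apply: le_trans (norm_sum_le_control tG dL ij) _; rewrite ler_wpM2l.
have p1 : w j k `^ al <= w i k `^ ga.
  apply: le_trans (powR_le (ltW al0) wjk0 wjk) (powR_al_ga wik0 _).
  exact: le_trans we eps1.
have p2 : w j k `^ al <= eps `^ al.
  by apply: powR_le => //; [exact: ltW|exact: le_trans wjk we].
have := ler_wpM2l (mulr_ge0 C0 (powR_ge0 (w j k) al)) nh.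
move=> /(le_trans _) h; apply: le_trans (lerD (lexx _) (h _ (lexx _))) _.
have q1 : C * w j k `^ al * G <= C * eps `^ al * G by rewrite ler_wpM2r ?normr_ge0// ler_wpM2l.
have q2 : C * w j k `^ al * (L * w i k) <= C * w i k `^ ga * (L * w i k).
  by rewrite ler_wpM2r ?mulr_ge0// ler_wpM2l.
nra.
Qed.

End OnGrid.
End Schemes.

Section Stability.
Context {R : realType} {V : normedModType R}.

Lemma exists_argmax (f : nat -> R) i n : (i <= n)%N ->
  exists j, [/\ (i <= j)%N, (j <= n)%N & forall k, (i <= k)%N -> (k <= n)%N -> f k <= f j].
Proof.
elim: n => [|n IH].
  rewrite leqn0 => /eqP ->; exists 0%N; split=> // k _; rewrite leqn0 => /eqP ->//.
rewrite leq_eqVlt => /predU1P[->|].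
  exists n.+1; split=> // k nk kn.
  by have -> : k = n.+1 by apply/eqP; rewrite eqn_leq nk kn.
rewrite ltnS => /IH[j [ij jn jmax]].
have [fn|fn] := leP (f n.+1) (f j).
  exists j; split=> //; first exact: leqW.
  move=> k ik; rewrite leq_eqVlt => /predU1P[->//|]; rewrite ltnS; exact: jmax.
exists n.+1; split=> //; first exact: leqW (leq_trans ij jn).
move=> k ik; rewrite leq_eqVlt => /predU1P[->//|]; rewrite ltnS => kn.
exact: le_trans (jmax k ik kn) (ltW fn).
Qed.

Variables (T C L al ga : R) (om : R -> R -> R) (mu : R -> R -> V -> V).
Hypotheses (C0 : 0 <= C) (L0 : 0 <= L) (ga0 : 0 < ga) (gaal : ga <= al).
Hypotheses (omC : control T om) (muF : almost_flow T C al ga om mu).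

(** The perturbations of the two schemes may differ by a term proportional to
    the distance of the states, as drifts do, up to an error [e] that will only
    enter through its sum. *)
Definition perturbed_pair tau (y z d d' : nat -> V) (e : nat -> R) :=
  [/\ scheme mu tau y d, scheme mu tau z d',
      forall k, `|d k| <= L * om (tau k) (tau k.+1),
      forall k, `|d' k| <= L * om (tau k) (tau k.+1)
    & forall k, 0 <= e k /\
        `|d' k - d k| <= L * om (tau k) (tau k.+1) * `|z k - y k| + e k].

(** Let [M] be the largest distance of the two schemes on the interval. The
    difference of their local errors is sewn with the superadditive weight
    [M * om + sum e]; hence [M] is at most the initial distance plus the sum of
    the [e k] plus a multiple of [om * M], and the last term is absorbed when
    [om] is small. *)
Lemma scheme_stability_local : exists2 eps, 0 < eps <= 1 & exists2 K, 0 <= K &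
  forall tau y z d d' e, grid T tau -> perturbed_pair tau y z d d' e ->
  forall i n, (i <= n)%N -> om (tau i) (tau n) <= eps ->
  `|z n - y n| <= K * (`|z i - y i| + \sum_(i <= k < n) e k).
Proof.
have al0 : 0 < al by exact: lt_le_trans gaal.
have h2 := half_powR_lt1 ga0.
have a0 : 0 < (1 - 2^-1 `^ ga) / 2 by rewrite divr_gt0// subr_gt0.
have [eps2 /andP[eps20 eps21] eps2P] := exists_small_powR al0 C0 a0.
have [eps1 /andP[eps10 eps11] [K1 K10 apri]] := scheme_apriori C0 L0 ga0 gaal omC muF.
have S0 : 0 <= sewing_const ga := sewing_const_ge0 ga0.
have [S SE] : exists S : R, S = sewing_const ga by eexists.
rewrite -SE in S0.
have [C1 C1E] : exists C1 : R, C1 = C * (2 + L + (1 + C) * (K1 + L)) by eexists.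
have C10 : 0 <= C1 by rewrite C1E mulr_ge0// !addr_ge0// mulr_ge0// addr_ge0.
have SC1 : 0 <= S * C1 by rewrite mulr_ge0.
(* Below [eps3] the terms proportional to [M] add up to at most [M / 2]. *)
pose eps3 := (2 * (L + S * C1 + 1))^-1.
have SC1L : 0 < L + S * C1 + 1 by rewrite ltr_wpDl// addr_ge0.
have eps30 : 0 < eps3 by rewrite invr_gt0 mulr_gt0.
pose eps := Num.min eps1 (Num.min eps2 eps3).
have [e1 e2 e3] : [/\ eps <= eps1, eps <= eps2 & eps <= eps3].
  by split; rewrite !ge_min lexx ?orbT.
have eps0 : 0 < eps by rewrite !lt_min eps10 eps20 eps30.
have epsle1 : eps <= 1 := le_trans e1 eps11.
exists eps; first by rewrite eps0.
exists (2 * (1 + C) + 2 * (1 + S * C1)).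
  by rewrite addr_ge0 ?mulr_ge0 ?addr_ge0.
move=> tau y z d d' e tG [scy scz dL dL' de] i n iln win.
pose w a b := om (tau a) (tau b).
have wS : superadditive w := grid_control omC tG.
pose E a b := \sum_(a <= k < b) e k.
have ES : superadditive E by apply: superadditive_partial_sum => k; exact: (de k).1.
have [m [im mn mmax]] := exists_argmax (fun k => `|z k - y k|) iln.
pose M := `|z m - y m|.
have M0 : 0 <= M by exact: normr_ge0.
have NS : superadditive (fun a b => (C1 * M) * w a b + C1 * E a b).
  by apply: superadditive_lin => //; rewrite mulr_ge0.
have [tm tT] := tG.
pose G a b := local_error mu tau z d' a b - local_error mu tau y d a b.
have DE a b : (i <= a)%N -> (a <= b)%N -> (b <= n)%N ->
    `|\sum_(a <= k < b) d' k - \sum_(a <= k < b) d k| <= L * M * w a b + E a b.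
  move=> ia ab bn; rewrite -sumrB; apply: le_trans (ler_norm_sum _ _ _) _.
  rewrite big_nat_cond.
  have H k : ((a <= k < b) && true)%N ->
      `|d' k - d k| <= L * M * w k k.+1 + e k.
    rewrite andbT => /andP[ak kb]; apply: le_trans (de k).2 _; rewrite lerD2r.
    have -> : L * M * w k k.+1 = L * w k k.+1 * M by ring.
    apply: ler_wpM2l.
      by rewrite mulr_ge0// wS.1.
    apply: mmax; [exact: leq_trans ak|exact: leq_trans (ltnW kb) bn].
  apply: le_trans (ler_sum _ H) _; rewrite -big_nat_cond big_split/= lerD2r.
  rewrite -mulr_sumr ler_wpM2l ?mulr_ge0//; exact: (superadditive_sum wS).
have wsmall a b : (i <= a)%N -> (a <= b)%N -> (b <= n)%N -> w a b <= eps.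
  by move=> ia ab bn; exact: le_trans (superadditive_mono wS ia ab bn) win.
have GP : forall a b, (a <= b)%N -> [/\ (i <= a)%N, (a <= b)%N & (b <= n)%N] ->
    `|G a b| <= S * ((C1 * M) * w a b + C1 * E a b) * w a b `^ ga.
  rewrite SE; apply: (@discrete_sewing _ _ (fun a b => [/\ (i <= a)%N, (a <= b)%N & (b <= n)%N])
    G _ w ga (C * eps `^ al) ga0 wS NS).
  - move=> a a' b' b [ia ab bn] aa ab' bb; split=> //; first exact: leq_trans aa.
    exact: leq_trans bn.
  - by move=> a; rewrite /G !(local_error_diag ga0 gaal omC muF)// subrr.
  - by move=> a; rewrite /G !local_error_step// subrr.
  - by rewrite mulr_ge0 ?powR_ge0.
  - by apply: eps2P => //; exact: ltW.
  move=> a b c ab bc [ia ac cn].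
  have /andP[ta0 taT] := tT a; have /andP[tb0 tbT] := tT b; have /andP[tc0 tcT] := tT c.
  have bn := leq_trans bc cn.
  have wac0 : 0 <= w a c by exact: wS.1.
  have wbc0 : 0 <= w b c by exact: wS.1.
  have wab0 : 0 <= w a b by exact: wS.1.
  have wbc : w b c <= w a c := superadditive_mono wS ab bc (leqnn _).
  have wab : w a b <= w a c := superadditive_mono wS (leqnn _) ab bc.
  have wac1 : w a c <= eps by exact: wsmall.
  have Ma : `|z a - y a| <= M by apply: mmax => //; exact: leq_trans ac cn.
  have EE : E a b <= E a c := superadditive_mono ES (leqnn _) ab bc.
  have Eab0 : 0 <= E a b by exact: ES.1.
  have -> : G a c - G a b - G b c =
    (local_error mu tau z d' a c - local_error mu tau z d' a b - local_error mu tau z d' b c) -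
    (local_error mu tau y d a c - local_error mu tau y d a b - local_error mu tau y d b c).
    by rewrite /G; zmod.
  rewrite !local_error_delta//.
  set xz := z a + _; set xy := y a + _.
  set hz := local_error mu tau z d' a b + _; set hy := local_error mu tau y d a b + _.
  set Dz := defect _ _ _ _ _; set Dy := defect _ _ _ _ _.
  have -> : - Dz + (mu (tau b) (tau c) (xz + hz) - mu (tau b) (tau c) xz) -
     (- Dy + (mu (tau b) (tau c) (xy + hy) - mu (tau b) (tau c) xy)) =
     - (Dz - Dy) + (mu (tau b) (tau c) (xz + hz) - mu (tau b) (tau c) xz -
       (mu (tau b) (tau c) (xy + hy) - mu (tau b) (tau c) xy)) by zmod.
  apply: le_trans (ler_normD _ _) _; rewrite normrN.
  apply: le_trans (lerD (flow_defect_lip muF (z a) (y a) ta0 (tm _ _ ab) (tm _ _ bc) tcT)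
    (flow_4points muF xz hz xy hy tb0 (tm _ _ bc) tcT)) _.
  rewrite -/(w a c) -/(w b c).
  have p1 : w b c `^ al <= w a c `^ ga.
    apply: le_trans (powR_le (ltW al0) wbc0 wbc) (powR_al_ga ga0 gaal wac0 _).
    exact: le_trans wac1 epsle1.
  have p2 : w b c `^ al <= eps `^ al.
    by apply: powR_le => //; [exact: ltW|exact: le_trans wbc wac1].
  have hh : `|hz - hy| <= `|G a b| + (L * M * w a b + E a b).
    have -> : hz - hy = G a b + (\sum_(a <= k < b) d' k - \sum_(a <= k < b) d k).
      by rewrite /hz /hy /G; zmod.
    by apply: le_trans (ler_normD _ _) _; rewrite lerD2l DE.
  have xx : `|xz - xy| <= (1 + C) * M.
    have -> : xz - xy = (z a - y a) + (mu (tau a) (tau b) (z a) - mu (tau a) (tau b) (y a)).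
      by rewrite /xz /xy; zmod.
    apply: le_trans (ler_normD _ _) _; rewrite mulrDl mul1r; apply: lerD => //.
    apply: le_trans (flow_lip muF _ _ ta0 (tm _ _ ab) tbT) _; apply: ler_pM => //.
      by rewrite mulr_ge0 ?powR_ge0.
    apply: ler_piMr => //; apply: (powR_le1 ga0 gaal) => //.
    exact: le_trans (le_trans wab wac1) epsle1.
  have nz : `|hz| <= (K1 + L) * w a c.
    apply: le_trans (ler_normD _ _) _; rewrite mulrDl; apply: lerD; last first.
      apply: le_trans (norm_sum_le_control L0 omC tG dL' ab) _.
      by rewrite ler_wpM2l.
    have we1 : om (tau a) (tau b) <= eps1 := le_trans (le_trans wab wac1) e1.
    apply: le_trans (apri _ _ _ tG scz dL' _ _ ab we1) _.
    apply: ler_wpM2l => //; apply: (le_trans _ wab); apply: ler_piMr => //.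
    apply: le_trans (powR_le (ltW ga0) wab0 (le_trans wab (le_trans wac1 epsle1))) _.
    by rewrite powR1.
  have wg0 : 0 <= w a c `^ ga by exact: powR_ge0.
  set g := w a c `^ ga in p1 wg0 *; set q := w b c `^ al in p1 p2 *.
  have q0 : 0 <= q by exact: powR_ge0.
  have t1 : C * (w a c * g) * `|z a - y a| <= C * (w a c * g) * M.
    by apply: ler_wpM2l => //; rewrite !mulr_ge0.
  have t2 : C * q * `|hz - hy| <=
      C * eps `^ al * `|G a b| + C * g * (L * M * w a c + E a c).
    apply: le_trans (ler_wpM2l (mulr_ge0 C0 q0) hh) _; rewrite mulrDr.
    apply: lerD; first by rewrite ler_wpM2r// ler_wpM2l.
    apply: ler_pM; [exact: mulr_ge0|by rewrite addr_ge0// !mulr_ge0| |].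
      by rewrite ler_wpM2l.
    by rewrite lerD// ler_wpM2l// mulr_ge0.
  have t3 : C * q * (`|xz - xy| * `|hz|) <= C * g * ((1 + C) * M * ((K1 + L) * w a c)).
    apply: ler_pM; [exact: mulr_ge0|by rewrite mulr_ge0|by rewrite ler_wpM2l|].
    exact: ler_pM.
  rewrite [X in _ + X]mulrDr.
  apply: le_trans (lerD t1 (lerD t2 t3)) _.
  have Eac0 : 0 <= E a c := le_trans Eab0 EE.
  have t4 : 0 <= C * g * E a c * (1 + L + (1 + C) * (K1 + L)).
    by rewrite !mulr_ge0// !addr_ge0// mulr_ge0// addr_ge0.
  have t5 : 0 <= C * g * M * w a c by rewrite !mulr_ge0.
  rewrite -subr_ge0; apply: le_trans t4 _; rewrite C1E -subr_ge0.
  by rewrite [leRHS](_ : _ = C * g * M * w a c)//; ring.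
have wim : w i m <= eps by exact: wsmall.
have wim0 : 0 <= w i m by exact: wS.1.
have Gim : `|G i m| <= S * C1 * (M * w i m + E i m).
  apply: le_trans (GP i m im (And3 (leqnn i) im mn)) _.
  have -> : S * C1 * (M * w i m + E i m) = S * (C1 * M * w i m + C1 * E i m) by ring.
  apply: ler_piMr; last first.
    apply: le_trans (powR_le (ltW ga0) wim0 (le_trans wim epsle1)) _.
    by rewrite powR1.
  by rewrite mulr_ge0// addr_ge0// !mulr_ge0// ES.1.
have Eim : E i m <= E i n := superadditive_mono ES (leqnn _) im mn.
have /andP[ti0 tiT] := tT i; have /andP[tm0 tmT] := tT m.
have MM : M <= (1 + C) * `|z i - y i| + (L * M * w i m + E i m)
     + S * C1 * (M * w i m + E i m).
  have ME : M = `|(z i - y i) + (mu (tau i) (tau m) (z i) - mu (tau i) (tau m) (y i))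
     + (\sum_(i <= k < m) d' k - \sum_(i <= k < m) d k) + G i m|.
    by rewrite /M /G /local_error; congr `|_|; zmod.
  rewrite {1}ME; apply: le_trans (ler_normD _ _) _; apply: lerD => //.
  apply: le_trans (ler_normD _ _) _; apply: lerD; last exact: DE.
  apply: le_trans (ler_normD _ _) _; rewrite mulrDl mul1r lerD2l.
  apply: le_trans (flow_lip muF _ _ ti0 (tm _ _ im) tmT) _.
  apply: ler_wpM2r => //; apply: ler_piMr => //; apply: (powR_le1 ga0 gaal) => //.
  exact: le_trans wim epsle1.
have half : (L + S * C1) * (M * w i m) <= M / 2.
  have : (L + S * C1 + 1) * w i m <= 2^-1.
    apply: le_trans (ler_wpM2l _ (le_trans wim e3)) _; first lra.
    by rewrite /eps3 invfM mulrA mulrAC divff ?mul1r//; lra.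
  by nra.
have Ein0 : 0 <= E i n by exact: ES.1.
have SEm : S * C1 * E i m <= S * C1 * E i n by rewrite ler_wpM2l.
apply: le_trans (mmax n iln (leqnn _)) _; rewrite -/M -/(E i n).
have zi0 : 0 <= `|z i - y i| by [].
have CE : 0 <= C * E i n by rewrite mulr_ge0.
have SZ : 0 <= S * C1 * `|z i - y i| by rewrite mulr_ge0.
lra.
Qed.

End Stability.

Section GlobalStability.
Context {R : realType} {V : normedModType R}.
Variables (T C L al ga : R) (om : R -> R -> R) (mu : R -> R -> V -> V).
Hypotheses (T0 : 0 <= T) (C0 : 0 <= C) (L0 : 0 <= L) (ga0 : 0 < ga) (gaal : ga <= al).
Hypotheses (omC : control T om) (muF : almost_flow T C al ga om mu).

(** Induction on the number [m] of units [eps] of control. The last index [j]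
    reached with [m] units is followed by a single step, whose control can be
    large but which expands distances at most by the factor [A], and beyond that
    step superadditivity leaves less than one unit. *)
Lemma scheme_stability : exists2 K, 0 <= K &
  forall tau (y z d d' : nat -> V) e, grid T tau ->
  perturbed_pair L om mu tau y z d d' e ->
  forall i n, (i <= n)%N ->
  `|z n - y n| <= K * (`|z i - y i| + \sum_(i <= k < n) e k).
Proof.
have al0 : 0 < al by exact: lt_le_trans gaal.
have [eps /andP[eps0 eps1] [K K0 loc]] :=
  scheme_stability_local C0 L0 ga0 gaal omC muF.
pose W := om 0 T.
have W0 : 0 <= W by exact: (control_ge0 omC).
have [A AE] : exists A : R, A = 1 + C * W `^ al + L * W by eexists.
have A0 : 0 <= A by rewrite AE !addr_ge0// !mulr_ge0// powR_ge0.
have main (m : nat) : exists2 Km, 0 <= Km &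
  forall tau (y z d d' : nat -> V) e, grid T tau ->
  perturbed_pair L om mu tau y z d d' e ->
  forall i n, (i <= n)%N -> om (tau i) (tau n) <= m%:R * eps ->
  `|z n - y n| <= Km * (`|z i - y i| + \sum_(i <= k < n) e k).
  elim: m => [|m [Km Km0 IH]].
    exists K => // tau y z d d' e tG pp i n iln; rewrite mul0r => w0.
    by apply: (loc _ _ _ _ _ _ tG pp) => //; exact: le_trans w0 (ltW eps0).
  exists (Km + K * (A * Km + 1)); first by rewrite !(addr_ge0, mulr_ge0).
  move=> tau y z d d' e tG pp i n iln wm.
  have wS := grid_control omC tG.
  have ES : superadditive (fun a b => \sum_(a <= k < b) e k).
    by apply: superadditive_partial_sum => k; case: pp => _ _ _ _ /(_ k)[].
  have S0 : 0 <= `|z i - y i| + \sum_(i <= k < n) e k.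
    by rewrite addr_ge0 ?ES.1.
  pose Q j := (i <= j <= n)%N && (om (tau i) (tau j) <= m%:R * eps).
  have exQ : exists j, Q j.
    by exists i; rewrite /Q leqnn iln/= (superadditive_diag _ wS) mulr_ge0// ltW.
  have Qn j : Q j -> (j <= n)%N by move=> /andP[/andP[]].
  have [j /andP[/andP[ij jn] wij] jmax] := ex_maxnP exQ Qn.
  have KK : 0 <= K * (A * Km + 1) by rewrite !(addr_ge0, mulr_ge0).
  move: jn; rewrite leq_eqVlt => /predU1P[jn|jn].
    rewrite -jn in S0 *; apply: le_trans (IH _ _ _ _ _ _ tG pp i j ij wij) _.
    by apply: ler_wpM2r => //; rewrite lerDl.
  have wjn : om (tau j.+1) (tau n) <= eps.
    have : ~~ Q j.+1 by apply/negP => /jmax; rewrite ltnn.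
    rewrite /Q jn (leqW ij)/= -ltNge => wij1.
    have := wS.2 i j.+1 n (leqW ij) jn; rewrite -natr1 mulrDl mul1r in wm.
    by move: wm wij1; lra.
  have h1 := IH _ _ _ _ _ _ tG pp i j ij wij.
  have h2 := loc _ _ _ _ _ _ tG pp j.+1 n jn wjn.
  have h3 : `|z j.+1 - y j.+1| <= A * `|z j - y j| + e j.
    case: pp => scy scz dL dL' /(_ j)[ej dd].
    have [tm tT] := tG.
    have /andP[tj0 tjT] := tT j; have /andP[tj10 tj1T] := tT j.+1.
    have wW : om (tau j) (tau j.+1) <= W.
      by apply: (control_mono omC) => //; exact: tm.
    have w0 : 0 <= om (tau j) (tau j.+1) by apply: (control_ge0 omC) => //; exact: tm.
    rewrite scy scz.
    have -> : z j + mu (tau j) (tau j.+1) (z j) + d' j -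
       (y j + mu (tau j) (tau j.+1) (y j) + d j) = (z j - y j) +
       (mu (tau j) (tau j.+1) (z j) - mu (tau j) (tau j.+1) (y j)) + (d' j - d j).
      by zmod.
    apply: le_trans (ler_normD _ _) _; rewrite AE !mulrDl mul1r -[leRHS]addrA.
    apply: lerD; last first.
      by apply: le_trans dd _; rewrite lerD2r ler_wpM2r// ler_wpM2l.
    apply: le_trans (ler_normD _ _) _; rewrite lerD2l.
    apply: le_trans (flow_lip muF _ _ tj0 (tm _ _ (leqnSn _)) tj1T) _.
    rewrite ler_wpM2r// ler_wpM2l//; apply: powR_le => //; exact: ltW.
  have Eij : \sum_(i <= k < j) e k + e j + \sum_(j.+1 <= k < n) e k = \sum_(i <= k < n) e k.
    by rewrite -big_nat_recr//= -big_cat_nat// leqW.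
  have Ej0 : 0 <= e j by case: pp => _ _ _ _ /(_ j)[].
  have E1 : 0 <= \sum_(i <= k < j) e k by apply: ES.1.
  have E2 : 0 <= \sum_(j.+1 <= k < n) e k by apply: ES.1.
  apply: le_trans h2 _; apply: (@le_trans _ _ (K * (A * Km + 1) * (`|z i - y i| + \sum_(i <= k < n) e k))); last first.
    by apply: ler_wpM2r => //; rewrite lerDr.
  rewrite -mulrA; apply: ler_wpM2l => //.
  move: h1 h3 E1 E2 S0; rewrite -Eij.
  set a := `|z i - y i|; set b := `|z j - y j|; set c := `|z j.+1 - y j.+1|.
  set s1 := \sum_(i <= k < j) e k; set s2 := \sum_(j.+1 <= k < n) e k.
  move=> h1 h3 E1 E2 S0.
  have h4 := ler_wpM2l A0 h1.
  have a0 : 0 <= a by exact: normr_ge0.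
  have h5 : 0 <= A * Km * (e j + s2) by rewrite !mulr_ge0// addr_ge0.
  have -> : (A * Km + 1) * (a + (s1 + e j + s2)) =
    A * (Km * (a + s1)) + A * Km * (e j + s2) + (a + (s1 + e j + s2)) by ring.
  apply: le_trans (lerD h3 (lexx s2)) _; apply: le_trans (lerD (lerD h4 (lexx _)) (lexx _)) _.
  clear -h5 a0 E1; lra.
have [m mW] : exists m : nat, W <= m%:R * eps.
  exists (Num.bound (W / eps)); rewrite -ler_pdivrMr//.
  by apply/ltW/archi_boundP; rewrite divr_ge0// ltW.
have [Km Km0 mainm] := main m; exists Km => // tau y z d d' e tG pp i n iln.
apply: (mainm _ _ _ _ _ _ tG pp) => //; apply: le_trans mW.
have [tm tT] := tG; have /andP[ti0 tiT] := tT i; have /andP[tn0 tnT] := tT n.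
apply: (control_mono omC) => //; exact: tm.
Qed.

End GlobalStability.

(** * Partitions *)

Section Partitions.
Context {R : realType}.
Implicit Types (s t u v h : R) (pi rho : seq R).

Definition mesh_lt h s pi := path (fun a b => b - a < h) s pi.

Lemma mesh_ltP h s t pi : reflect
  (forall i, (i < size pi)%N -> nth t (s :: pi) i.+1 - nth t (s :: pi) i < h)
  (mesh_lt h s pi).
Proof. exact: (pathP t). Qed.

Lemma mesh_to_0P s t (P : set (seq R)) : mesh_to_0 s t P <->
  exists2 h, 0 < h & forall pi, itv_partition s t pi -> mesh_lt h s pi -> P pi.
Proof.
split=> -[h h0 hP]; exists h => // pi.
  by move=> ip /(mesh_ltP _ _ t) mp; apply: hP.
by move=> [ip mp]; apply: hP => //; apply/(mesh_ltP _ _ t).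
Qed.

Lemma mesh_lt_le h h' s pi : h <= h' -> mesh_lt h s pi -> mesh_lt h' s pi.
Proof. by move=> hh; apply: sub_path => a b /lt_le_trans; exact. Qed.

(** Half the mesh is stepped over at a time, so that a last step of length up to
    [h / 2] still makes the mesh less than [h]. *)
Lemma exists_fine_partition s t h : 0 < h -> s <= t ->
  exists2 pi, itv_partition s t pi & mesh_lt h s pi.
Proof.
move=> h0 st.
have [n] : exists n : nat, t - s <= n%:R * (h / 2).
  exists (Num.bound ((t - s) / (h / 2))); rewrite -ler_pdivrMr ?divr_gt0//.
  by apply/ltW/archi_boundP; rewrite !divr_ge0// ?subr_ge0// ltW.
elim: n s st => [|n IH] s st.
  rewrite mul0r subr_le0 => ts; have -> : s = t by apply/eqP; rewrite eq_le st ts.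
  by exists [::].
move=> tsn; have [ts|ts] := leP (t - s) (h / 2).
  move: st; rewrite le_eqVlt => /predU1P[->|st]; first by exists [::].
  exists [:: t]; first exact: itv_partition1.
  by rewrite /mesh_lt/= andbT; lra.
have [||pi [pp /eqP pl] pm] := IH (s + h / 2).
- lra.
- by move: tsn; rewrite -natr1 mulrDl mul1r; lra.
exists (s + h / 2 :: pi).
  by split; [rewrite /= pp andbT; lra|rewrite /= pl].
by apply/andP; split=> //; lra.
Qed.

#[global] Instance mesh_to_0_proper s t : s <= t -> ProperFilter (mesh_to_0 s t).
Proof.
move=> st; apply: filter_from_proper; last first.
  move=> h /= h0; have [pi ip mp] := exists_fine_partition h0 st.
  by exists pi; split=> //; apply/(mesh_ltP _ _ t).
apply: filter_from_filter; first by exists 1 => /=.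
move=> i j /= i0 j0; exists (Num.min i j); first by rewrite /= lt_min i0.
move=> pi [ip mp]; split; split=> // k kp; apply: lt_le_trans (mp k kp) _.
  by rewrite ge_min lexx.
by rewrite ge_min lexx orbT.
Qed.

Lemma lt_path_last_ge s pi u : path <%R s pi -> u \in s :: pi -> u <= last s pi.
Proof.
elim: pi s u => [|x r IH] s u /=; first by rewrite inE => _ /eqP ->.
move=> /andP[sx xr]; rewrite inE => /predU1P[->|]; last exact: IH.
by apply: (le_trans (ltW sx)); apply: IH => //; exact: mem_head.
Qed.

Lemma itv_partition_mem s t pi u : itv_partition s t pi -> u \in s :: pi ->
  s <= u <= t.
Proof.
move=> [sp /eqP <-] us; rewrite lt_path_last_ge// andbT.
move: us; rewrite inE => /predU1P[->//|upi].
by move: sp; rewrite lt_path_sortedE => /andP[/allP/(_ _ upi)/ltW].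
Qed.

Lemma lt_path_last_eq s pi u : path <%R s pi -> u \in s :: pi ->
  (forall x, x \in pi -> x <= u) -> last s pi = u.
Proof.
move=> sp us pu; apply/eqP; rewrite eq_le lt_path_last_ge// andbT.
have : last s pi \in s :: pi by exact: mem_last.
rewrite inE => /predU1P[->|]; last exact: pu.
move: us; rewrite inE => /predU1P[->//|upi].
by move: sp; rewrite lt_path_sortedE => /andP[/allP/(_ _ upi)/ltW].
Qed.

Lemma itv_partition_filter s t rho u : itv_partition s t rho -> u \in s :: rho ->
  itv_partition s u [seq x <- rho | x <= u].
Proof.
move=> rp us; have [pr _] := rp; have /andP[su _] := itv_partition_mem rp us.
have pf : path <%R s [seq x <- rho | x <= u] by apply: path_filter => //; exact: lt_trans.
split=> //; apply/eqP; apply: lt_path_last_eq => //.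
  by move: us; rewrite !inE mem_filter lexx.
by move=> x; rewrite mem_filter => /andP[].
Qed.

Lemma itv_partition_filter2 s t rho u v : itv_partition s t rho ->
  v \in s :: rho -> s <= u -> u <= v ->
  itv_partition u v [seq x <- rho | u < x <= v].
Proof.
move=> rp vs su uv; have [pr _] := rp.
have pf : path <%R u [seq x <- rho | u < x <= v].
  rewrite lt_path_sortedE; apply/andP; split.
    by apply/allP => x; rewrite mem_filter => /andP[/andP[]].
  by apply: sorted_filter; [exact: lt_trans|exact: path_sorted pr].
split=> //; apply/eqP; apply: lt_path_last_eq => //.
  move: uv; rewrite le_eqVlt => /predU1P[->|uv]; first exact: mem_head.
  move: vs; rewrite !inE => /predU1P[vs|vr]; first by rewrite vs ltNge su in uv.
  by rewrite mem_filter uv lexx vr orbT.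
by move=> x; rewrite mem_filter => /andP[/andP[]].
Qed.

Lemma filter_le_cat rho u v : sorted <%R rho -> u <= v ->
  [seq x <- rho | x <= v] = [seq x <- rho | x <= u] ++ [seq x <- rho | u < x <= v].
Proof.
elim: rho => // x r IH xr uv /=.
have [xu|ux] := leP x u.
  by rewrite (le_trans xu uv)/= IH//; exact: path_sorted xr.
have ru y : y \in r -> u < y.
  move=> yr; move: xr; rewrite /= lt_path_sortedE => /andP[/allP/(_ _ yr) + _].
  exact: lt_trans.
have -> : [seq y <- r | y <= u] = [::].
  apply/eqP; rewrite -[_ == _]negbK -has_filter; apply/negP => /hasP[y /ru].
  by rewrite ltNge => /negbTE ->.
have -> : [seq y <- r | y <= v] = [seq y <- r | u < y <= v].
  by apply: eq_in_filter => y /ru ->.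
by [].
Qed.

Definition common_refinement pi1 pi2 := sort <=%R (undup (pi1 ++ pi2)).

Lemma common_refinement_mem pi1 pi2 x :
  (x \in common_refinement pi1 pi2) = (x \in pi1) || (x \in pi2).
Proof. by rewrite mem_sort mem_undup mem_cat. Qed.

Lemma common_refinement_partition s t pi1 pi2 : itv_partition s t pi1 ->
  itv_partition s t pi2 -> itv_partition s t (common_refinement pi1 pi2).
Proof.
move=> p1 p2; set rho := common_refinement pi1 pi2.
have sr : path <%R s rho.
  rewrite lt_path_sortedE; apply/andP; split.
    apply/allP => x; rewrite common_refinement_mem => /orP[|] xp.
      by move: p1 => [+ _]; rewrite lt_path_sortedE => /andP[/allP/(_ _ xp)].
    by move: p2 => [+ _]; rewrite lt_path_sortedE => /andP[/allP/(_ _ xp)].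
  by rewrite sort_lt_sorted undup_uniq.
split=> //; apply/eqP; apply: lt_path_last_eq => //.
  have [_ /eqP l1] := p1; have := mem_last s pi1.
  by rewrite l1 !inE common_refinement_mem => /orP[]->; rewrite ?orbT.
move=> x; rewrite common_refinement_mem => /orP[|] xp.
  by have /andP[] : s <= x <= t by apply: (itv_partition_mem p1); rewrite inE xp orbT.
by have /andP[] : s <= x <= t by apply: (itv_partition_mem p2); rewrite inE xp orbT.
Qed.

Lemma itv_partition_sorted s t pi i j : itv_partition s t pi -> (i <= j)%N ->
  nth t (s :: pi) i <= nth t (s :: pi) j.
Proof.
move=> ip ij; have [js|js] := ltnP j (size (s :: pi)); last first.
  rewrite [leRHS]nth_default//; have [is_|is_] := ltnP i (size (s :: pi)).
    exact: itv_partition_nth_le.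
  by rewrite nth_default.
apply: (sorted_leq_nth le_trans lexx t (s := s :: pi)) => //; rewrite ?inE//.
  by have [sp _] := ip; apply: sub_path sp => x y /ltW.
exact: leq_ltn_trans js.
Qed.

Lemma itv_partition_grid T s t pi : 0 <= s -> t <= T -> itv_partition s t pi ->
  grid T (nth t (s :: pi)).
Proof.
move=> s0 tT ip; split=> [i j|i]; first exact: itv_partition_sorted.
have st := itv_partition_le ip.
have [is_|is_] := ltnP i (size (s :: pi)); last first.
  by rewrite nth_default// tT (le_trans s0 st).
by rewrite (le_trans s0 (itv_partition_nth_ge is_ ip)) (le_trans (itv_partition_nth_le is_ ip)).
Qed.

End Partitions.

(** * Convergence of the Euler scheme *)

Section Euler.
Context {R : realType} {V : completeNormedModType R}.

Fixpoint euler (psi : R -> R -> V -> V) (s : R) (y : V) (pi : seq R) : V :=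
  if pi is v :: pi' then euler psi v (y + psi s v y) pi' else y.

Lemma euler_cat psi s y pi1 pi2 :
  euler psi s y (pi1 ++ pi2) = euler psi (last s pi1) (euler psi s y pi1) pi2.
Proof. by elim: pi1 s y => //= v pi1 IH s y; rewrite IH. Qed.

Lemma euler_take psi s t y pi k : (k < size pi)%N ->
  euler psi s y (take k.+1 pi) = euler psi s y (take k pi)
    + psi (nth t (s :: pi) k) (nth t (s :: pi) k.+1) (euler psi s y (take k pi)).
Proof.
elim: k pi s y => [|k IH] [|v pi] s y //=; first by rewrite take0.
rewrite ltnS => kp; exact: IH.
Qed.

Variables (T C L al ga : R) (om : R -> R -> R) (mu B : R -> R -> V -> V).
Hypotheses (T0 : 0 <= T) (C0 : 0 <= C) (L0 : 0 <= L) (ga0 : 0 < ga)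
  (gaal : ga <= al) (al1 : al <= 1).
Hypotheses (omC : control T om) (muF : almost_flow T C al ga om mu)
  (BD : drift T L om B).

Let psi s t y := mu s t y + B s t y.

Let al0 : 0 < al. Proof. exact: lt_le_trans gaal. Qed.

Lemma drift_diag s y : 0 <= s -> s <= T -> B s s y = 0.
Proof.
move=> s0 sT; apply/eqP; rewrite -normr_eq0 eq_le normr_ge0 andbT.
by have := drift_bounded BD y s0 (lexx s) sT; rewrite (control_diag omC)// mulr0.
Qed.

Lemma euler_scheme s t y pi : 0 <= s -> t <= T -> itv_partition s t pi ->
  let tau := nth t (s :: pi) in let z k := euler psi s y (take k pi) in
  scheme mu tau z (fun k => B (tau k) (tau k.+1) (z k)).
Proof.
move=> s0 tT ip tau z k; have [kp|kp] := ltnP k (size pi).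
  by rewrite /z (euler_take _ _ t)// /psi addrA.
(* Past the last node the default value of [nth] is [t]: all further steps are
   trivial and the scheme is constant. *)
have t0 : 0 <= t := le_trans s0 (itv_partition_le ip).
have tk i : (size pi <= i)%N -> tau i = t.
  move=> pk; rewrite /tau; move: pk; rewrite leq_eqVlt => /predU1P[<-|pk].
    exact: itv_partition_nth_size.
  by rewrite nth_default.
rewrite /z !take_oversize ?tk ?(leqW kp)//.
by rewrite (flow_diag ga0 gaal omC muF)// drift_diag// !addr0.
Qed.

Lemma drift_sum tau y i j : grid T tau -> (i <= j)%N ->
  \sum_(i <= k < j) B (tau k) (tau k.+1) y = B (tau i) (tau j) y.
Proof.
move=> [tm tT]; have ti k : 0 <= tau k /\ tau k <= T by apply/andP; exact: tT.
elim: j => [|j IH].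
  by rewrite leqn0 => /eqP ->; rewrite big_geq// drift_diag; [|apply (ti 0%N).1|apply (ti 0%N).2].
rewrite leq_eqVlt => /predU1P[->|].
  by rewrite big_geq// drift_diag; [|apply (ti j.+1).1|apply (ti j.+1).2].
rewrite ltnS => ij; rewrite big_nat_recr//= IH//.
by rewrite [RHS](drift_add BD (r := tau j))//; [exact: (ti i).1|exact: tm|exact: tm|exact: (ti j.+1).2].
Qed.

(** Many steps against one: the a priori bound compares the flow parts, and the
    drift is compared with its value at the initial state, from which the scheme
    has moved by at most a multiple of [om `^ ga]. *)
Lemma euler_local : exists2 eps, 0 < eps <= 1 & exists2 K, 0 <= K &
  forall s t y pi, 0 <= s -> t <= T -> itv_partition s t pi -> om s t <= eps ->
  `|euler psi s y pi - y - psi s t y| <= K * (om s t * om s t `^ ga).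
Proof.
have [eps /andP[eps0 eps1] [K K0 apri]] := scheme_apriori C0 L0 ga0 gaal omC muF.
exists eps; first by rewrite eps0.
exists (K + L * (C + L + K)); first by rewrite !(addr_ge0, mulr_ge0).
move=> s t y pi s0 tT ip we.
have tG := itv_partition_grid s0 tT ip.
have sc := euler_scheme y s0 tT ip.
have st := itv_partition_le ip.
set tau := nth t (s :: pi) in tG sc; set z := fun k => euler psi s y (take k pi) in sc.
set d := fun k => B (tau k) (tau k.+1) (z k) in sc.
have [tm tT'] := tG.
have ti k : 0 <= tau k /\ tau k <= T by apply/andP; exact: tT'.
have dL k : `|d k| <= L * om (tau k) (tau k.+1).
  by apply: (drift_bounded BD); [exact: (ti k).1|exact: tm|exact: (ti k.+1).2].
have tau0 : tau 0%N = s by [].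
have taun : tau (size pi) = t by exact: itv_partition_nth_size.
have z0 : z 0%N = y by rewrite /z take0.
have zn : z (size pi) = euler psi s y pi by rewrite /z take_size.
have w0 : 0 <= om s t by apply: (control_ge0 omC).
have w1 : om s t <= 1 := le_trans we eps1.
have wk k : (k <= size pi)%N -> 0 <= om s (tau k) <= om s t.
  move=> kp; have ks := tm 0%N k (leq0n k); have kt := tm _ _ kp.
  rewrite tau0 in ks; rewrite taun in kt.
  by rewrite (control_mono omC)// (control_ge0 omC)// (le_trans kt).
have g1 : om s t `^ ga <= 1.
  by apply: le_trans (powR_le (ltW ga0) w0 w1) _; rewrite powR1.
have g0 : 0 <= om s t `^ ga by exact: powR_ge0.
have wg : om s t <= om s t `^ ga.
  move: w0; rewrite le_eqVlt => /predU1P[<-|w0]; first exact: powR_ge0.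
  by apply: ger1_powR; [rewrite w0|exact: le_trans gaal al1].
have zy k : (k <= size pi)%N -> `|z k - y| <= (C + L + K) * om s t `^ ga.
  move=> kp; have /andP[wk0 wkt] := wk k kp.
  have wke : om (tau 0%N) (tau k) <= eps := le_trans wkt we.
  have := apri _ _ _ tG sc dL 0%N k (leq0n k) wke; rewrite tau0 => h.
  have -> : z k - y = mu s (tau k) y + \sum_(0 <= l < k) d l + local_error mu tau z d 0%N k.
    by rewrite /local_error tau0 z0; zmod.
  apply: le_trans (ler_normD _ _) _; rewrite mulrDl; apply: lerD; last first.
    apply: le_trans h _; apply: ler_wpM2l => //.
    have gk : om s (tau k) `^ ga <= om s t `^ ga by apply: powR_le => //; exact: ltW.
    apply: le_trans _ gk; apply: ler_piMl; first exact: powR_ge0.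
    exact: le_trans wkt w1.
  apply: le_trans (ler_normD _ _) _; rewrite mulrDl; apply: lerD; last first.
    apply: le_trans (norm_sum_le_control L0 omC tG dL (leq0n k)) _.
    by rewrite tau0 ler_wpM2l// (le_trans wkt).
  apply: le_trans (flow_bounded muF _ s0 _ (ti k).2) _; first exact: (tm 0%N).
  apply: ler_wpM2l => //; apply: le_trans (powR_le (ltW al0) wk0 wkt) _.
  exact: powR_al_ga.
have we' : om (tau 0%N) (tau (size pi)) <= eps by rewrite tau0 taun.
have := apri _ _ _ tG sc dL 0%N (size pi) (leq0n _) we'; rewrite tau0 taun => h.
have -> : euler psi s y pi - y - psi s t y = local_error mu tau z d 0%N (size pi) +
   (\sum_(0 <= k < size pi) d k - B s t y).
  by rewrite /local_error tau0 taun z0 zn /psi; zmod.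
apply: le_trans (ler_normD _ _) _; rewrite mulrDl; apply: lerD => //.
have -> : B s t y = \sum_(0 <= k < size pi) B (tau k) (tau k.+1) y.
  by rewrite drift_sum// tau0 taun.
rewrite -sumrB; apply: le_trans (ler_norm_sum _ _ _) _.
have H k : ((0 <= k < size pi) && true)%N ->
    `|d k - B (tau k) (tau k.+1) y| <= L * (C + L + K) * om s t `^ ga * om (tau k) (tau k.+1).
  rewrite andbT => /andP[_ kp].
  apply: le_trans (drift_lip BD _ _ (ti k).1 (tm _ _ (leqnSn k)) (ti k.+1).2) _.
  have wkk : 0 <= om (tau k) (tau k.+1).
    by apply: (control_ge0 omC); [exact: (ti k).1|exact: tm|exact: (ti k.+1).2].
  rewrite -mulrA [X in _ <= X](_ : _ = L * (om (tau k) (tau k.+1) * ((C + L + K) * om s t `^ ga))); last by ring.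
  by rewrite ler_wpM2l// ler_wpM2l// zy// ltnW.
rewrite big_nat_cond; apply: le_trans (ler_sum _ H) _; rewrite -big_nat_cond -mulr_sumr.
rewrite [leRHS](_ : _ = L * (C + L + K) * om s t `^ ga * om s t); last by ring.
apply: ler_wpM2l; first by rewrite !(mulr_ge0, addr_ge0).
by have := superadditive_sum (grid_control omC tG) (leq0n (size pi)); rewrite tau0 taun.
Qed.

Definition step_error (Z : R -> V) u v := Z v - Z u - psi u v (Z u).

(** Sampled at the nodes of a partition, [Z] is a scheme perturbed by its one-step
    errors, whose sum is at most a multiple of [eta `^ ga]. *)
Lemma euler_compare K' : 0 <= K' -> exists2 K, 0 <= K &
  forall s t pi (Z : R -> V) eta, 0 <= s -> t <= T -> itv_partition s t pi ->
  0 <= eta -> eta <= 1 ->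
  (forall k, (k < size pi)%N ->
     let u := nth t (s :: pi) k in let v := nth t (s :: pi) k.+1 in
     om u v <= eta /\ `|step_error Z u v| <= K' * (om u v * om u v `^ ga)) ->
  `|Z t - euler psi s (Z s) pi| <= K * eta `^ ga.
Proof.
move=> K'0; pose L' := L + K'.
have L'0 : 0 <= L' by rewrite addr_ge0.
have [K K0 stab] := scheme_stability T0 C0 L'0 ga0 gaal omC muF.
have W0 : 0 <= om 0 T by exact: (control_ge0 omC).
exists (K * (K' * om 0 T)); first by rewrite !mulr_ge0.
move=> s t pi Z eta s0 tT ip eta0 eta1 cell.
have tG := itv_partition_grid s0 tT ip.
have sc := euler_scheme (Z s) s0 tT ip.
have st := itv_partition_le ip.
set tau := nth t (s :: pi) in tG sc cell; set y := fun k => euler psi s (Z s) (take k pi) in sc.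
set d := fun k => B (tau k) (tau k.+1) (y k) in sc.
have [tm tT'] := tG.
have ti k : 0 <= tau k /\ tau k <= T by apply/andP; exact: tT'.
have wk k : 0 <= om (tau k) (tau k.+1).
  by apply: (control_ge0 omC); [exact: (ti k).1|exact: tm|exact: (ti k.+1).2].
have tau0 : tau 0%N = s by [].
have taun : tau (size pi) = t by exact: itv_partition_nth_size.
have tk i : (size pi <= i)%N -> tau i = t.
  move=> pk; rewrite /tau; move: pk; rewrite leq_eqVlt => /predU1P[<-//|pk].
  by rewrite nth_default.
have t0 : 0 <= t := le_trans s0 st.
have cell' k : om (tau k) (tau k.+1) <= eta /\ `|step_error Z (tau k) (tau k.+1)| <=
    K' * (om (tau k) (tau k.+1) * om (tau k) (tau k.+1) `^ ga).
  have [kp|kp] := ltnP k (size pi); first exact: cell.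
  rewrite !tk ?(leqW kp)// (control_diag omC)// mul0r mulr0; split=> //.
  by rewrite /step_error /psi (flow_diag ga0 gaal omC muF)// drift_diag// !subrr !addr0 subrr normr0.
pose z k := Z (tau k).
pose d' k := B (tau k) (tau k.+1) (z k) + step_error Z (tau k) (tau k.+1).
pose e k := K' * (eta `^ ga * om (tau k) (tau k.+1)).
have ek k : `|step_error Z (tau k) (tau k.+1)| <= e k.
  have [w1 w2] := cell' k; apply: le_trans w2 _; rewrite ler_wpM2l// mulrC ler_wpM2r//.
  by apply: powR_le => //; exact: ltW.
have eL k : e k <= K' * om (tau k) (tau k.+1).
  rewrite ler_wpM2l// ler_piMl//.
  by apply: le_trans (powR_le (ltW ga0) eta0 eta1) _; rewrite powR1.
have BL x k : `|B (tau k) (tau k.+1) x| <= L * om (tau k) (tau k.+1).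
  by apply: (drift_bounded BD); [exact: (ti k).1|exact: tm|exact: (ti k.+1).2].
have pp : perturbed_pair L' om mu tau y z d d' e.
  split=> // k.
  - by rewrite /z /d' /step_error /psi; zmod.
  - by apply: le_trans (BL _ k) _; rewrite ler_wpM2r// lerDl.
  - apply: le_trans (ler_normD _ _) _; rewrite mulrDl; apply: lerD => //.
    exact: le_trans (ek k) (eL k).
  split; first by rewrite !mulr_ge0// powR_ge0.
  rewrite /d' addrAC; apply: le_trans (ler_normD _ _) _; apply: lerD => //.
  apply: le_trans (drift_lip BD _ _ (ti k).1 (tm _ _ (leqnSn k)) (ti k.+1).2) _.
  by rewrite ler_wpM2r// ler_wpM2r// lerDl.
have := stab _ _ _ _ _ _ tG pp 0%N (size pi) (leq0n _).
rewrite {1 2}/z tau0 taun /y take0 take_size subrr normr0 add0r => h.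
apply: le_trans h _; rewrite -!mulrA; apply: ler_wpM2l => //.
rewrite -mulr_sumr; apply: ler_wpM2l => //; rewrite -mulr_sumr mulrC.
apply: ler_wpM2r; first exact: powR_ge0.
have := superadditive_sum (grid_control omC tG) (leq0n (size pi)); rewrite tau0 taun => h.
by apply: le_trans h _; apply: (control_mono omC).
Qed.

Lemma control_mesh eta : 0 < eta -> exists2 h, 0 < h & forall s t pi,
  0 <= s -> t <= T -> itv_partition s t pi -> mesh_lt h s pi ->
  forall k, (k < size pi)%N -> om (nth t (s :: pi) k) (nth t (s :: pi) k.+1) <= eta.
Proof.
move=> eta0; have [h h0 hP] := control_small omC eta0; exists h => //.
move=> s t pi s0 tT ip /(mesh_ltP _ _ t) mp k kp.
have [tm tT'] := itv_partition_grid s0 tT ip.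
have /andP[k0 _] := tT' k; have /andP[_ k1] := tT' k.+1.
by apply: hP => //; [exact: tm|exact/ltW/mp].
Qed.

(** The values of the fine scheme at the nodes of the coarse partition have small
    one-step errors because each coarse cell is subdivided by the fine partition. *)
Lemma euler_refine : forall e, 0 < e -> exists2 h, 0 < h &
  forall s t y pi rho, 0 <= s -> t <= T -> itv_partition s t pi ->
  itv_partition s t rho -> mesh_lt h s pi -> {subset pi <= rho} ->
  `|euler psi s y rho - euler psi s y pi| <= e.
Proof.
move=> e e0; have [eps /andP[eps0 eps1] [K' K'0 loc]] := euler_local.
have [K K0 cmp] := euler_compare K'0.
have [eta1 /andP[eta10 eta11] eta1P] := exists_small_powR ga0 K0 e0.
pose eta := Num.min eps eta1.
have eta0 : 0 < eta by rewrite lt_min eps0.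
have [h h0 hP] := control_mesh eta0; exists h => // s t y pi rho s0 tT ip ir mp sub.
pose Z u := euler psi s y [seq x <- rho | x <= u].
have [sr lr] := ir.
have Zs : Z s = y.
  rewrite /Z; have -> : [seq x <- rho | x <= s] = [::]; last by [].
  apply/eqP; rewrite -[_ == _]negbK -has_filter; apply/negP => /hasP[x xr].
  move: sr; rewrite lt_path_sortedE => /andP[/allP/(_ _ xr)].
  by rewrite ltNge => /negbTE ->.
have Zt : Z t = euler psi s y rho.
  rewrite /Z; congr euler; apply/all_filterP/allP => x xr.
  by have /andP[] : s <= x <= t by apply: (itv_partition_mem ir); rewrite inE xr orbT.
rewrite -Zt -{1}Zs; apply: le_trans (cmp s t pi Z eta s0 tT ip (ltW eta0) _ _) (eta1P _ (ltW eta0) _).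
- by rewrite ge_min eps1.
- move=> k kp u v; split; first exact: (hP _ _ _ s0 tT).
  have memrho x : x \in s :: pi -> x \in s :: rho.
    by rewrite !inE => /predU1P[->|/sub ->]; rewrite ?eqxx ?orbT.
  have us : u \in s :: rho by apply/memrho/mem_nth; exact: ltnW.
  have vs : v \in s :: rho by apply/memrho/mem_nth.
  have uv : u <= v by apply: itv_partition_sorted.
  have /andP[su ut] := itv_partition_mem ir us.
  have /andP[sv vt] := itv_partition_mem ir vs.
  rewrite /step_error /Z (filter_le_cat (path_sorted sr) uv) euler_cat.
  have [_ /eqP ->] := itv_partition_filter ir us.
  apply: loc; [exact: le_trans su|exact: le_trans tT| |].
    exact: (itv_partition_filter2 ir).
  apply: le_trans (hP _ _ _ s0 tT ip mp k kp) _.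
  by rewrite ge_min lexx.
- by rewrite ge_min lexx orbT.
Qed.

(** Two partitions of small mesh are compared through their common refinement. *)
Theorem euler_cvg s t y : 0 <= s -> s <= t -> t <= T ->
  cvg (euler psi s y @ mesh_to_0 s t).
Proof.
move=> s0 st tT; have FF := mesh_to_0_proper st.
apply/cauchy_cvgP/cauchyP => e e0.
have e20 : 0 < e / 2 / 2 by rewrite !divr_gt0.
have [h h0 hP] := euler_refine e20.
have [pi0 ip0 mp0] := exists_fine_partition h0 st.
exists (euler psi s y pi0); rewrite /fmap /=.
apply/mesh_to_0P; exists h => // pi ip mp /=.
rewrite -ball_normE /ball_ /=.
pose rho := common_refinement pi0 pi.
have ir : itv_partition s t rho := common_refinement_partition ip0 ip.
have h1 : `|euler psi s y rho - euler psi s y pi0| <= e / 2 / 2.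
  by apply: (hP s t) => // x xp; rewrite common_refinement_mem xp.
have h2 : `|euler psi s y rho - euler psi s y pi| <= e / 2 / 2.
  by apply: (hP s t) => // x xp; rewrite common_refinement_mem xp orbT.
rewrite distrC in h1.
apply: le_lt_trans (ler_distD (euler psi s y rho) _ _) _.
by apply: le_lt_trans (lerD h1 h2) _; rewrite -splitr ltr_pdivrMr ?ltr_pMr//; lra.
Qed.

(** Any path with small one-step errors is the limit of the scheme: this is
    both the consistency of the scheme and the uniqueness of its limit. *)
Theorem euler_cvg_to (Z : R -> V) K' eps s t : 0 < eps -> 0 <= K' -> 0 <= s -> s <= t -> t <= T ->
  (forall u v, s <= u -> u <= v -> v <= t -> om u v <= eps ->
     `|step_error Z u v| <= K' * (om u v * om u v `^ ga)) ->
  euler psi s (Z s) @ mesh_to_0 s t --> Z t.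
Proof.
move=> eps0 K'0 s0 st tT Zstep; have FF := mesh_to_0_proper st.
apply/cvgrPdist_le => e e0.
have [K K0 cmp] := euler_compare K'0.
have [eta1 /andP[eta10 eta11] eta1P] := exists_small_powR ga0 K0 e0.
pose eta := Num.min eps eta1.
have eta0 : 0 < eta by rewrite lt_min eps0.
have [h h0 hP] := control_mesh eta0.
apply/mesh_to_0P; exists h => // pi ip mp.
apply: le_trans (cmp s t pi Z eta s0 tT ip (ltW eta0) _ _) (eta1P _ (ltW eta0) _).
- by rewrite ge_min eta11 orbT.
- move=> k kp u v; have w : om u v <= eta := hP _ _ _ s0 tT ip mp k kp.
  split=> //; apply: Zstep.
  + by apply: itv_partition_nth_ge => //; exact: ltnW.
  + exact: (itv_partition_sorted ip).
  + exact: itv_partition_nth_le.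
  + by apply: le_trans w _; rewrite ge_min lexx.
- by rewrite ge_min lexx orbT.
Qed.

Definition euler_limit s y t := lim (euler psi s y @ mesh_to_0 s t).

Lemma euler_limit0 s y : 0 <= s -> s <= T -> euler_limit s y s = y.
Proof.
move=> s0 sT; have FF := mesh_to_0_proper (lexx s).
apply: cvg_lim => //; apply/cvgrPdist_le => e e0; apply/mesh_to_0P; exists 1 => // pi.
by move=> /itv_partitionxx -> _; rewrite subrr normr0 ltW.
Qed.

(** The bound for many steps passes to the limit along partitions that contain
    both [s] and [t]. *)
Theorem euler_limit_step : exists2 eps, 0 < eps <= 1 & exists2 K, 0 <= K &
  forall y (s t : R), 0 <= s -> s <= t -> t <= T -> om s t <= eps ->
  `|step_error (euler_limit 0 y) s t| <= K * (om s t * om s t `^ ga).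
Proof.
have [eps /andP[eps0 eps1] [K K0 loc]] := euler_local.
exists eps; first by rewrite eps0.
exists K => // y s t s0 st tT we; set Y := euler_limit 0 y.
have w0 : 0 <= om s t by exact: (control_ge0 omC).
pose A := 1 + (1 + C * om s t `^ al + L * om s t).
have A0 : 0 < A by rewrite ltr_pwDl// !addr_ge0// mulr_ge0// powR_ge0.
apply/ler_addgt0Pr => e e0; pose e' := e / A.
have e'0 : 0 < e' by rewrite divr_gt0.
have Ycvg (r : R) : 0 <= r -> r <= T -> exists2 h, 0 < h & forall pi,
    itv_partition 0 r pi -> mesh_lt h 0 pi -> `|Y r - euler psi 0 y pi| <= e'.
  move=> r0 rT; have FF := mesh_to_0_proper r0.
  have /cvgrPdist_le/(_ _ e'0) := @euler_cvg 0 r y (lexx 0) r0 rT.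
  by move/mesh_to_0P.
have sT := le_trans st tT; have t0 := le_trans s0 st.
have [hs hs0 hsP] := Ycvg s s0 sT; have [ht ht0 htP] := Ycvg t t0 tT.
pose h := Num.min hs ht.
have h0 : 0 < h by rewrite lt_min hs0.
have [p1 ip1 mp1] := exists_fine_partition h0 s0.
have [p2 ip2 mp2] := exists_fine_partition h0 st.
have [_ /eqP l1] := ip1.
have hs1 : `|Y s - euler psi 0 y p1| <= e'.
  by apply: hsP => //; apply: mesh_lt_le mp1; rewrite ge_min lexx.
have ht1 : `|Y t - euler psi 0 y (p1 ++ p2)| <= e'.
  apply: htP; first exact: itv_partition_cat ip2.
  apply: (@mesh_lt_le _ h); first by rewrite ge_min lexx orbT.
  by rewrite /mesh_lt cat_path l1; apply/andP.
have := loc s t (euler psi 0 y p1) p2 s0 tT ip2 we.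
rewrite euler_cat l1 in ht1.
set a := euler psi 0 y p1 in hs1 ht1 *; set b := euler psi s a p2 in ht1 *.
move=> h1.
have -> : step_error Y s t = (b - a - psi s t a) + ((Y t - b) - (Y s - a)
    - ((mu s t (Y s) - mu s t a) + (B s t (Y s) - B s t a))).
  by rewrite /step_error /psi; zmod.
apply: le_trans (ler_normD _ _) _; apply: lerD => //.
have -> : e = e' + (e' + (C * om s t `^ al * e' + L * om s t * e')).
  have eA : e' * A = e by rewrite divfK// gt_eqF.
  by rewrite -{1}eA /A; ring.
apply: le_trans (ler_normB _ _) _; rewrite [leRHS]addrA; apply: lerD.
  by apply: le_trans (ler_normB _ _) _; exact: lerD.
apply: le_trans (ler_normD _ _) _; apply: lerD.
  apply: le_trans (flow_lip muF _ _ s0 st tT) _; rewrite ler_wpM2l//.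
  by rewrite mulr_ge0// powR_ge0.
apply: le_trans (drift_lip BD _ _ s0 st tT) _; rewrite ler_wpM2l//.
by rewrite mulr_ge0.
Qed.

End Euler.

(** * Finite variation and controls *)

Section UniformContinuity.
Context {R : realType}.

Lemma within_continuous_ballP (M : pseudoMetricType R) (E : normedModType R)
    (K : set M) (f : M -> E) :
  {within K, continuous f} <->
  forall x, K x -> forall e, 0 < e -> exists2 h, 0 < h &
    forall y, K y -> ball x h y -> `|f x - f y| <= e.
Proof.
split=> [/subspace_continuousP fK x Kx e e0|fK].
  have /cvgrPdist_le/(_ _ e0) := fK x Kx.
  rewrite near_withinE => /nbhs_ballP[h /= h0 hP]; exists h => // y Ky xy.
  exact: hP.
apply/subspace_continuousP => x Kx; apply/cvgrPdist_le => e e0.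
rewrite near_withinE; have [h h0 hP] := fK x Kx e e0.
by apply/nbhs_ballP; exists h => //= y xy Ky; exact: hP.
Qed.

Lemma compact_uniformly_continuous (M : pseudoMetricType R) (E : normedModType R)
    (K : set M) (f : M -> E) : compact K -> {within K, continuous f} ->
  forall e, 0 < e -> exists2 h, 0 < h &
    forall x y, K x -> K y -> ball x h y -> `|f x - f y| <= e.
Proof.
move=> /compact_near_coveringP cK /within_continuous_ballP fK e e0.
have := cK R (at_right 0) (fun h x => forall y, K x -> K y -> ball x h y -> `|f x - f y| <= e) _ _.
move=> /(_ _ _)[].
  move=> x Kx; have e20 : 0 < e / 2 by rewrite divr_gt0.
  have [h h0 hP] := fK x Kx _ e20.
  have h20 : 0 < h / 2 by rewrite divr_gt0.
  exists (ball x (h / 2), [set r | 0 < r < h / 2]).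
    split=> /=; first by apply/nbhs_ballP; exists (h / 2).
    by near=> r; apply/andP; split; near: r; [exact: nbhs_right_gt|exact: nbhs_right_lt].
  move=> [z r] /= [xz /andP[r0 rh]] y Kz Ky zy.
  have xz' : ball x h z by apply: le_ball xz; rewrite ler_pdivrMr//; lra.
  have xy : ball x h y.
    rewrite (splitr h); apply: ball_triangle xz _; apply: le_ball zy; exact: ltW.
  rewrite (splitr e); apply: le_trans (ler_distD (f x) _ _) _.
  by rewrite distrC; apply: lerD; exact: hP.
move=> r /= r0 rP; exists (r / 2); first by rewrite divr_gt0.
move=> x y Kx Ky xy; apply: (rP (r / 2)) => //=; last by rewrite divr_gt0.
by rewrite sub0r normrN gtr0_norm ?divr_gt0// ltr_pdivrMr// ltr_pMr//; lra.
Unshelve. all: by end_near. Qed.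

End UniformContinuity.

Section Variation.
Context {R : realType}.
Implicit Types (W om a b : R -> R -> R).

Definition weak_control (T : R) W :=
  (forall s t, 0 <= s -> s <= t -> t <= T -> 0 <= W s t) /\
  (forall s r t, 0 <= s -> s <= r -> r <= t -> t <= T -> W s r + W r t <= W s t).

Lemma weak_control_mono T W s s' t' t : weak_control T W ->
  0 <= s -> s <= s' -> s' <= t' -> t' <= t -> t <= T -> W s' t' <= W s t.
Proof.
move=> [W0 WS] s0 ss st tt tT.
have h1 := WS _ _ _ s0 ss (le_trans st tt) tT.
have h2 := WS _ _ _ (le_trans s0 ss) st tt tT.
have h3 := W0 _ _ s0 ss (le_trans (le_trans st tt) tT).
have h4 := W0 _ _ (le_trans s0 (le_trans ss st)) tt tT.
lra.
Qed.

Lemma control_weak T om : control T om -> weak_control T om.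
Proof. by case. Qed.

Lemma weak_control_add T W1 W2 : weak_control T W1 -> weak_control T W2 ->
  weak_control T (fun s t => W1 s t + W2 s t).
Proof.
move=> [p1 q1] [p2 q2]; split=> [s t *|s r t s0 sr rt tT]; first by rewrite addr_ge0 ?p1 ?p2.
by have := q1 _ _ _ s0 sr rt tT; have := q2 _ _ _ s0 sr rt tT; lra.
Qed.

Lemma weak_control_scale T W c : 0 <= c -> weak_control T W ->
  weak_control T (fun s t => c * W s t).
Proof.
move=> c0 [p1 q1]; split=> [s t *|s r t s0 sr rt tT]; first by rewrite mulr_ge0 ?p1.
by rewrite -mulrDr ler_wpM2l// q1.
Qed.

Lemma control_add T om1 om2 : control T om1 -> control T om2 ->
  control T (fun s t => om1 s t + om2 s t).
Proof.
move=> o1 o2; have [p q] := weak_control_add (control_weak o1) (control_weak o2).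
split=> // e e0; have e20 : 0 < e / 2 by rewrite divr_gt0.
have [h1 h10 h1P] := control_small o1 e20; have [h2 h20 h2P] := control_small o2 e20.
exists (Num.min h1 h2); first by rewrite lt_min h10.
move=> s t s0 st tT; rewrite le_min => /andP[t1 t2].
by rewrite (splitr e) lerD ?h1P ?h2P.
Qed.

Lemma control_length (T : R) : control T (fun s t : R => t - s).
Proof.
split=> [s t s0 st _|s r t s0 sr rt _|e e0]; first by rewrite subr_ge0.
  by rewrite addrC addrA subrK.
by exists e.
Qed.

(** A superadditive majorant of the [q]-th power is easier to transform than a
    supremum over partitions, to which it is equivalent by
    [variation_norm_finiteP]. *)
Definition finite_variation (T q : R) a := exists2 W, weak_control T W &
  forall s t, 0 <= s -> s <= t -> t <= T -> a s t `^ q <= W s t.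

Lemma finite_variation_le T q a b : 0 <= q -> finite_variation T q a ->
  (forall s t, 0 <= s -> s <= t -> t <= T -> 0 <= b s t <= a s t) ->
  finite_variation T q b.
Proof.
move=> q0 [W Wc aW] ba; exists W => // s t s0 st tT.
have /andP[b0 bas] := ba s t s0 st tT.
exact: le_trans (powR_le q0 b0 bas) (aW s t s0 st tT).
Qed.

Lemma finite_variation_scale T q a c : 0 <= q -> 0 <= c ->
  (forall s t, 0 <= s -> s <= t -> t <= T -> 0 <= a s t) ->
  finite_variation T q a -> finite_variation T q (fun s t => c * a s t).
Proof.
move=> q0 c0 a0 [W Wc aW]; exists (fun s t => c `^ q * W s t).
  by apply: weak_control_scale => //; exact: powR_ge0.
move=> s t s0 st tT; rewrite powRM ?a0// ler_wpM2l ?powR_ge0// aW//.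
Qed.

Lemma finite_variation_add T q a b : 0 <= q ->
  (forall s t, 0 <= s -> s <= t -> t <= T -> 0 <= a s t) ->
  (forall s t, 0 <= s -> s <= t -> t <= T -> 0 <= b s t) ->
  finite_variation T q a -> finite_variation T q b ->
  finite_variation T q (fun s t => a s t + b s t).
Proof.
move=> q0 a0 b0 [W1 W1c aW] [W2 W2c bW].
exists (fun s t => 2 `^ q * (W1 s t + W2 s t)).
  by apply: weak_control_scale; [exact: powR_ge0|exact: weak_control_add].
move=> s t s0 st tT; have a0' := a0 s t s0 st tT; have b0' := b0 s t s0 st tT.
have aW' := aW s t s0 st tT; have bW' := bW s t s0 st tT.
have key x y : 0 <= x -> 0 <= y -> x <= y -> (x + y) `^ q <= 2 `^ q * (x `^ q + y `^ q).
  move=> x0 y0 xy; apply: (@le_trans _ _ ((2 * y) `^ q)).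
    by apply: powR_le => //; [exact: addr_ge0|rewrite mulr_natl mulr2n lerD2r].
  by rewrite powRM// ler_wpM2l ?powR_ge0// lerDr powR_ge0.
have [ab|ba] := leP (a s t) (b s t).
  by apply: le_trans (key _ _ a0' b0' ab) _; rewrite ler_wpM2l ?powR_ge0// lerD.
rewrite addrC; apply: le_trans (key _ _ b0' a0' (ltW ba)) _.
by rewrite ler_wpM2l ?powR_ge0// addrC lerD.
Qed.

Lemma powR_split (x y r : R) : 1 <= r -> 0 <= x -> x <= y -> x `^ r <= x * y `^ (r - 1).
Proof.
move=> r1 x0 xy.
have r0 : 0 < r by exact: lt_le_trans r1.
rewrite -(mulr_powRB1 x0 r0) ler_wpM2l//; apply: powR_le => //.
by rewrite subr_ge0.
Qed.

(** A power at least one of a bounded superadditive function is dominated by a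
    multiple of that function. *)
Lemma finite_variation_control T W r q : 0 <= r -> 1 <= r * q -> weak_control T W ->
  finite_variation T q (fun s t => W s t `^ r).
Proof.
move=> r0 rq Wc; exists (fun s t => W 0 T `^ (r * q - 1) * W s t).
  by apply: weak_control_scale => //; exact: powR_ge0.
move=> s t s0 st tT; rewrite -powRrM [leRHS]mulrC; apply: powR_split => //.
  exact: Wc.1.
exact: (weak_control_mono Wc).
Qed.

Lemma finite_variation_length (T q : R) : 1 <= q ->
  finite_variation T q (fun s t : R => t - s).
Proof.
move=> q1; have := @finite_variation_control T (fun s t => t - s) 1 q ler01.
rewrite mul1r => /(_ q1 (control_weak (control_length T))).
case=> W Wc WP; exists W => // s t s0 st tT.
by have := WP s t s0 st tT; rewrite powRr1// subr_ge0.
Qed.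

Lemma finite_variation_sqr T p a :
  (forall s t, 0 <= s -> s <= t -> t <= T -> 0 <= a s t) ->
  finite_variation T p a -> finite_variation T (p / 2) (fun s t => a s t ^+ 2).
Proof.
move=> a0 [W Wc aW]; exists W => // s t s0 st tT.
have a0' := a0 s t s0 st tT.
by rewrite -powR_mulrn// -powRrM mulrC divfK// aW.
Qed.

Lemma finite_variation_up T q q' a : 0 < q -> q <= q' ->
  (forall s t, 0 <= s -> s <= t -> t <= T -> 0 <= a s t) ->
  finite_variation T q a -> finite_variation T q' a.
Proof.
move=> q0 qq a0 [W Wc aW]; have qq1 : 1 <= q' / q by rewrite ler_pdivlMr// mul1r.
have [|V Vc VP] := @finite_variation_control T W 1 (q' / q) ler01 _ Wc.
  by rewrite mul1r.
exists V => // s t s0 st tT; have a0' := a0 s t s0 st tT.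
apply: le_trans (VP s t s0 st tT); rewrite powRr1; last exact: Wc.1.
have {1}-> : q' = q * (q' / q) by rewrite mulrCA mulfV ?mulr1// gt_eqF.
rewrite powRrM; apply: powR_le; [|exact: powR_ge0|exact: aW].
exact: le_trans qq1.
Qed.

(** Finite [q]-variation of a continuous path does not give a control that is
    small near the diagonal without further work on the supremum. Any larger
    exponent [q'] does: the largest value of [a `^ (q' - q)] over subintervals is
    monotone in the interval, so multiplying by it preserves superadditivity, and
    it tends to zero with the length of the interval. *)
Lemma finite_variation_small_control T q q' a : 0 <= T -> 0 < q -> q < q' ->
  (forall s t, 0 <= s -> s <= t -> t <= T -> 0 <= a s t) ->
  (forall e, 0 < e -> exists2 h, 0 < h &
    forall s t, 0 <= s -> s <= t -> t <= T -> t - s <= h -> a s t <= e) ->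
  finite_variation T q a ->
  exists2 om, control T om &
    forall s t, 0 <= s -> s <= t -> t <= T -> a s t `^ q' <= om s t.
Proof.
move=> T0 q0 qq a0 asmall [W Wc aW].
pose r := q' - q; have r0 : 0 < r by rewrite subr_gt0.
pose S s t := [set x | exists u v, [/\ s <= u, u <= v, v <= t & x = a u v `^ r]].
pose m s t := sup (S s t).
have Sne s t : s <= t -> S s t !=set0 by move=> st; exists (a s t `^ r), s, t.
have Sub s t : 0 <= s -> t <= T -> ubound (S s t) ((W 0 T) `^ (q^-1 * r)).
  move=> s0 tT _ [u [v [su uv vt ->]]].
  have u0 := le_trans s0 su; have vT := le_trans vt tT.
  have -> : a u v `^ r = (a u v `^ q) `^ (q^-1 * r).
    by rewrite -powRrM mulrA mulfV ?mul1r// gt_eqF.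
  apply: powR_le; [by rewrite mulr_ge0// ?invr_ge0 ltW|exact: powR_ge0|].
  by apply: le_trans (aW u v u0 uv vT) _; apply: (weak_control_mono Wc).
have Ssup s t : 0 <= s -> s <= t -> t <= T -> has_sup (S s t).
  by move=> s0 st tT; split; [exact: Sne|exists ((W 0 T) `^ (q^-1 * r)); exact: Sub].
have mge s t u v : 0 <= s -> s <= u -> u <= v -> v <= t -> t <= T -> a u v `^ r <= m s t.
  move=> s0 su uv vt tT; apply: sup_upper_bound; last by exists u, v.
  by apply: Ssup => //; exact: le_trans su (le_trans uv vt).
have m0 s t : 0 <= s -> s <= t -> t <= T -> 0 <= m s t.
  by move=> s0 st tT; apply: le_trans (mge s t s t s0 (lexx _) st (lexx _) tT); exact: powR_ge0.
have mmono s s' t' t : 0 <= s -> s <= s' -> s' <= t' -> t' <= t -> t <= T -> m s' t' <= m s t.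
  move=> s0 ss st tt tT; apply: ge_sup; first exact: Sne.
  move=> _ [u [v [su uv vt ->]]]; apply: mge => //; first exact: le_trans su.
  exact: le_trans tt.
exists (fun s t => W s t * m s t); last first.
  move=> s t s0 st tT; have a0' := a0 s t s0 st tT.
  have -> : q' = q + r by rewrite addrC subrK.
  rewrite powRD; last by rewrite gt_eqF// addr_gt0.
  by apply: ler_pM; rewrite ?powR_ge0// ?aW// mge.
split.
- by move=> s t s0 st tT; rewrite mulr_ge0 ?m0// Wc.1.
- move=> s u t s0 su ut tT; have uT := le_trans ut tT; have u0 := le_trans s0 su.
  apply: (@le_trans _ _ ((W s u + W u t) * m s t)).
    rewrite mulrDl; apply: lerD; apply: ler_wpM2l; rewrite ?Wc.1//; exact: mmono.
  by rewrite ler_wpM2r ?m0 ?Wc.2// (le_trans su).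
move=> e e0; have W0 : 0 <= W 0 T by exact: Wc.1.
have W1 : 0 < W 0 T + 1 by rewrite ltr_wpDl.
have [d /andP[d0 _] dP] := exists_small_powR r0 ler01 (divr_gt0 e0 W1).
have [h h0 hP] := asmall d d0; exists h => // s t s0 st tT ts.
have me : m s t <= e / (W 0 T + 1).
  apply: ge_sup; first exact: Sne.
  move=> _ [u [v [su uv vt ->]]].
  have u0 := le_trans s0 su; have vT := le_trans vt tT.
  rewrite -[leLHS]mul1r; apply: dP; first exact: a0.
  apply: hP => //; lra.
apply: (@le_trans _ _ (W 0 T * (e / (W 0 T + 1)))).
  by apply: ler_pM; rewrite ?m0 ?Wc.1//; apply: (weak_control_mono Wc).
by rewrite mulrCA ler_piMr ?(ltW e0)// ler_pdivrMr// mul1r lerDl.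
Qed.

End Variation.

Section VariationNorm.
Context {R : realType}.

Lemma partition_sum_nil (F : zmodType) (A : R -> R -> F) s t :
  partition_sum A s t [::] = 0.
Proof. by rewrite /partition_sum big_geq. Qed.

Lemma partition_sum_cons (F : zmodType) (A : R -> R -> F) s t v pi :
  partition_sum A s t (v :: pi) = A s v + partition_sum A v t pi.
Proof. by rewrite /partition_sum /= big_nat_recl. Qed.

Lemma partition_sum_cat (F : zmodType) (A : R -> R -> F) s r t pi1 pi2 :
  itv_partition s r pi1 ->
  partition_sum A s t (pi1 ++ pi2) = partition_sum A s r pi1 + partition_sum A r t pi2.
Proof.
elim: pi1 s => [|v pi1 IH] s.
  by move=> /itv_partition_nil ->; rewrite partition_sum_nil add0r.
by move=> /itv_partition_cons/IH e; rewrite cat_cons !partition_sum_cons e addrA.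
Qed.

Lemma partition_sum_ge0 (A : R -> R -> R) s t pi : (forall u v, 0 <= A u v) ->
  0 <= partition_sum A s t pi.
Proof. by move=> A0; apply: sumr_ge0. Qed.

Lemma partition_sum_le_control T (A W : R -> R -> R) s t pi : weak_control T W ->
  0 <= s -> t <= T -> itv_partition s t pi ->
  (forall u v, 0 <= u -> u <= v -> v <= T -> A u v <= W u v) ->
  partition_sum A s t pi <= W s t.
Proof.
move=> Wc + + + AW; elim: pi s => [|v pi IH] s s0 tT ip.
  rewrite partition_sum_nil; apply: Wc.1 => //; exact: itv_partition_le ip.
have ip' := itv_partition_cons ip; have vt := itv_partition_le ip'.
have sv : s <= v by case: ip => /= /andP[/ltW].
rewrite partition_sum_cons; apply: le_trans (Wc.2 s v t s0 sv vt tT).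
by apply: lerD; [apply: AW => //; exact: le_trans vt tT|apply: IH => //; exact: le_trans sv].
Qed.

(** The supremum over the partitions of [s, t] is superadditive by concatenation,
    and finite because a partition of [s, t] extends to one of [0, T]. *)
Lemma variation_norm_finiteP (E : normedModType R) (q T : R) (A : R -> R -> E) :
  0 < q -> 0 <= T -> (forall s, 0 <= s -> s <= T -> A s s = 0) ->
  (variation_norm q A 0 T < +oo)%E <-> finite_variation T q (fun s t => `|A s t|).
Proof.
move=> q0 T0 A0; have qn0 : q^-1 != 0 by rewrite invr_eq0 gt_eqF.
pose P u v := `|A u v| `^ q.
have P0 u v : 0 <= P u v by exact: powR_ge0.
rewrite /variation_norm; split=> [/(lty_poweRy qn0) |[W Wc AW]]; last first.
  apply: poweR_lty; apply: le_lt_trans (ltry (W 0 T)).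
  apply/ereal_supP => _ [pi ip <-]; rewrite lee_fin.
  exact: (partition_sum_le_control Wc).
set S := ereal_sup _ => Sy.
have bnd s t pi : 0 <= s -> t <= T -> itv_partition s t pi -> partition_sum P s t pi <= fine S.
  move=> s0 tT ip; have st := itv_partition_le ip.
  have part (u v : R) : u <= v -> exists p, itv_partition u v p.
    by move=> /(exists_fine_partition (@ltr01 R))[p ? _]; exists p.
  have [p1 i1] := part 0 s s0; have [p2 i2] := part t T tT.
  have big : ((partition_sum P 0 T (p1 ++ (pi ++ p2)))%:E <= S)%E.
    apply: ereal_sup_ubound; exists (p1 ++ (pi ++ p2)) => //.
    exact: itv_partition_cat i1 (itv_partition_cat ip i2).
  have Sfin : S \is a fin_num.
    rewrite fin_numElt Sy andbT; apply: lt_le_trans big; exact: ltNyr.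
  have := big; rewrite -(fineK Sfin) lee_fin (partition_sum_cat _ _ _ i1).
  rewrite (partition_sum_cat _ _ _ ip).
  have := partition_sum_ge0 0 s p1 P0; have := partition_sum_ge0 t T p2 P0; lra.
pose B s t := [set partition_sum P s t pi | pi in itv_partition s t].
have Bsup s t : 0 <= s -> s <= t -> t <= T -> has_sup (B s t).
  move=> s0 st tT; split.
    have [pi ip _] := exists_fine_partition (@ltr01 R) st.
    by exists (partition_sum P s t pi), pi.
  by exists (fine S) => _ [pi ip <-]; exact: bnd.
have Bub s t pi : 0 <= s -> t <= T -> itv_partition s t pi ->
    partition_sum P s t pi <= sup (B s t).
  move=> s0 tT ip; apply: sup_upper_bound; last by exists pi.
  by apply: Bsup => //; exact: itv_partition_le ip.
exists (fun s t => sup (B s t)); last first.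
  move=> s t s0; rewrite le_eqVlt => /predU1P[<-|st] tT.
    rewrite A0// normr0 powR0 ?gt_eqF//.
    by have := Bub s s [::] s0 tT; rewrite partition_sum_nil; apply.
  have := Bub s t [:: t] s0 tT (itv_partition1 st).
  by rewrite partition_sum_cons partition_sum_nil addr0.
split=> [s t s0 st tT|s r t s0 sr rt tT].
  have [pi ip _] := exists_fine_partition (@ltr01 R) st.
  exact: le_trans (partition_sum_ge0 s t pi P0) (Bub s t pi s0 tT ip).
have r0 := le_trans s0 sr; have rT := le_trans rt tT.
rewrite -lerBrDr; apply: ge_sup; first exact: (Bsup s r s0 sr rT).1.
move=> _ [p1 i1 <-]; rewrite lerBrDl -lerBrDr; apply: ge_sup.
  exact: (Bsup r t r0 rt tT).1.
move=> _ [p2 i2 <-]; rewrite lerBrDl -(partition_sum_cat _ _ _ i1).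
by apply: Bub => //; exact: itv_partition_cat i2.
Qed.

End VariationNorm.

(** * Differential calculus *)

Section MatrixNorm.
Context {R : realType}.

Lemma mx_entry_le k l (A : 'M[R]_(k, l)) i j : `|A i j| <= `|A|.
Proof.
rewrite [leRHS]/Num.Def.normr/= mx_normrE.
exact: (le_bigmax _ (fun ij : 'I_k * 'I_l => `|A ij.1 ij.2|) (i, j)).
Qed.

Lemma mx_norm_le k l (A : 'M[R]_(k, l)) c : 0 <= c ->
  (forall i j, `|A i j| <= c) -> `|A| <= c.
Proof.
move=> c0 Ac; rewrite [leLHS]/Num.Def.normr/= mx_normrE.
by apply: bigmax_le => // -[i j] _; exact: Ac.
Qed.

Lemma mx_entryB_le k l (A B : 'M[R]_(k, l)) i j : `|A i j - B i j| <= `|A - B|.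
Proof. by have := mx_entry_le (A - B) i j; rewrite !mxE. Qed.

Lemma within_continuous_entry (M : pseudoMetricType R) (K : set M) k l
    (F : M -> 'M[R]_(k, l)) i j :
  {within K, continuous F} -> {within K, continuous (fun z => F z i j : R^o)}.
Proof.
move=> /within_continuous_ballP FK; apply/within_continuous_ballP => x Kx e e0.
have [h h0 hP] := FK x Kx e e0; exists h => // y Ky xy.
exact: le_trans (mx_entryB_le _ _ _ _) (hP y Ky xy).
Qed.

Lemma colB k l (A B : 'M[R]_(k, l)) j : col j (A - B) = col j A - col j B.
Proof. by apply/matrixP => i q; rewrite !mxE. Qed.

Lemma col_norm_le k l j (A : 'M[R]_(k, l)) : `|col j A| <= `|A|.
Proof. by apply: mx_norm_le => // i q; rewrite mxE; exact: mx_entry_le. Qed.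

Lemma mulmx_sum_col k l (A : 'M[R]_(k, l)) (v : 'cV[R]_l) :
  A *m v = \sum_j v j 0 *: col j A.
Proof.
apply/matrixP => i q; rewrite !mxE summxE; apply: eq_bigr => j _.
by rewrite !mxE (ord1 q) mulrC.
Qed.

Lemma uniform_bound (I : finType) (P : I -> R -> Prop) :
  (forall i C C', C <= C' -> P i C -> P i C') ->
  (forall i, exists2 C, 0 <= C & P i C) -> exists2 C, 0 <= C & forall i, P i C.
Proof.
move=> Pmono H.
have [C CP] := choice (fun i => let: ex_intro2 C C0 PC := H i in
  ex_intro (fun C => 0 <= C /\ P i C) C (conj C0 PC)).
exists (\sum_i C i); first by apply: sumr_ge0 => i _; exact: (CP i).1.
move=> i; apply: Pmono (CP i).2; rewrite (bigD1 i)//= lerDl.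
by apply: sumr_ge0 => j _; exact: (CP j).1.
Qed.

Lemma mulmx_norm_le k l m (A : 'M[R]_(k, l)) (B : 'M[R]_(l, m)) :
  `|A *m B| <= l%:R * (`|A| * `|B|).
Proof.
apply: mx_norm_le; first by rewrite !mulr_ge0.
move=> i j; rewrite mxE; apply: le_trans (ler_norm_sum _ _ _) _.
rewrite -[X in X%:R](card_ord l) mulr_natl -sumr_const; apply: ler_sum => q _.
by rewrite normrM ler_pM// mx_entry_le.
Qed.

End MatrixNorm.

Section OneVariable.
Context {R : realType}.

Lemma MVT_line (psi dpsi : R -> R) (a b : R) :
  (forall x : R, is_derive x (1 : R) psi (dpsi x)) ->
  exists2 r, 0 <= r <= 1 & psi b - psi a = dpsi (a + r * (b - a)) * (b - a).
Proof.
move=> d.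
have cont (u v : R) : {within `[u, v], continuous psi}.
  apply: continuous_subspaceT => x; apply: differentiable_continuous.
  by apply/derivable1_diffP; apply: ex_derive.
wlog ab : a b / a <= b => [H|].
  have [ab|/ltW ba] := leP a b; first exact: H.
  have [r /andP[r0 r1] e] := H b a ba; exists (1 - r); first lra.
  have -> : a + (1 - r) * (b - a) = b + r * (a - b) by ring.
  by rewrite -opprB e -mulrN opprB.
have [c] := MVT_segment ab (fun x _ => d x) (cont a b).
rewrite in_itv/= => /andP[ac cb] e.
move: ab; rewrite le_eqVlt => /predU1P[ab|ab].
  by exists 0; rewrite ?lexx ?ler01// ab !subrr mulr0.
exists ((c - a) / (b - a)).
  by rewrite divr_ge0 ?subr_ge0 ?(ltW ab)//= ler_pdivrMr ?subr_gt0// mul1r lerD2r.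
by rewrite divfK ?subr_eq0 ?gt_eqF// (_ : a + (c - a) = c)//; ring.
Qed.

End OneVariable.

Section Slices.
Context {R : realType} {V : normedModType R}.

(** A directional derivative depends on the map only through its values on a
    line. This carries derivatives over from a map to its slices and translates,
    even when their domains are different spaces. *)
Lemma is_derive_eq_quotient (V1 V2 : normedModType R) (f1 : V1 -> R^o) (f2 : V2 -> R^o)
    a1 v1 a2 v2 (df : R) :
  (forall h : R, f1 (h *: v1 + a1) = f2 (h *: v2 + a2)) ->
  is_derive a1 v1 f1 df -> is_derive a2 v2 f2 df.
Proof.
move=> e12 [d1 d1E].
have e0 : f1 a1 = f2 a2 by have := e12 0; rewrite !scale0r !add0r.
have E : (fun h : R => h^-1 *: ((f1 \o shift a1) (h *: v1) - f1 a1)) =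
         (fun h : R => h^-1 *: ((f2 \o shift a2) (h *: v2) - f2 a2)).
  by apply/funext => h /=; rewrite e12 e0.
by split; [rewrite /derivable -E|rewrite -d1E /derive -E].
Qed.

Lemma is_derive_line (f : V -> R^o) x e (eta d : R) :
  is_derive (x + eta *: e) e f d -> is_derive eta (1 : R) (fun c : R => f (x + c *: e) : R) d.
Proof.
apply: is_derive_eq_quotient => h /=.
have -> : h *: (1 : R) = h by exact: mulr1.
by congr f; rewrite scalerDl; zmod.
Qed.

Lemma is_derive_translate (f : V -> R^o) x k e (d : R) :
  is_derive (x + k) e f d -> is_derive k e (fun c => f (x + c)) d.
Proof. by apply: is_derive_eq_quotient => h; congr f; zmod. Qed.

End Slices.

Section Axes.
Context {R : realType} {n : nat}.
Notation V := 'cV[R]_n.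

Definition axis (l : 'I_n) : V := delta_mx l 0.

(** Moving one coordinate at a time gives the mean value inequality from
    partial derivatives alone; [a] is a candidate gradient to compare with. *)
Lemma axis_mean_value (F : V -> R^o) (g : 'I_n -> V -> R) (a : 'I_n -> R) r C x y :
  0 <= C -> (forall z l, is_derive z (axis l) F (g l z)) ->
  (forall z l, `|z| <= r -> `|g l z - a l| <= C) -> `|x| <= r -> `|y| <= r ->
  `|F y - F x - \sum_l (y l 0 - x l 0) * a l| <= n%:R * (C * `|y - x|).
Proof.
move=> C0 dF gC xr yr.
pose z k : V := \col_(i < n) (if (i < k)%N then y i 0 else x i 0).
have main k : (k <= n)%N ->
  `|F (z k) - F x - \sum_(l < n | (l < k)%N) (y l 0 - x l 0) * a l| <= k%:R * (C * `|y - x|).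
  elim: k => [_|k IH kn].
    have -> : z 0%N = x by apply/matrixP => i j; rewrite mxE ltn0 ord1.
    by rewrite big_pred0 ?subrr ?subr0 ?normr0 ?mul0r// => l; rewrite ltn0.
  pose o := Ordinal kn.
  have zE : z k.+1 = z k + (y o 0 - x o 0) *: axis o.
    apply/matrixP => i j; rewrite !mxE ord1 eqxx andbT ltnS.
    have [->|io] := eqVneq i o; first by rewrite /= leqnn ltnn mulr1 addrC subrK.
    rewrite mulr0 addr0 leq_eqVlt; case: eqP => //= ik.
    by case/eqP: io; exact: val_inj.
  have [q /andP[q0 q1]] := @MVT_line R (fun c => F (z k + c *: axis o))
    (fun c => g o (z k + c *: axis o)) 0 (y o 0 - x o 0)
    (fun c => is_derive_line (dF _ _)).
  rewrite scale0r addr0 -zE add0r subr0 => e.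
  have -> : F (z k.+1) - F x - \sum_(l < n | (l < k.+1)%N) (y l 0 - x l 0) * a l =
    (F (z k) - F x - \sum_(l < n | (l < k)%N) (y l 0 - x l 0) * a l) +
    (g o (z k + (q * (y o 0 - x o 0)) *: axis o) - a o) * (y o 0 - x o 0).
    rewrite (bigD1 o)//= (eq_bigl (fun l : 'I_n => (l < k)%N)); last first.
      move=> l; have [->|lo] := eqVneq l o; first by rewrite andbF ltnn.
      have lk : (l : nat) != k by apply: contra lo => /eqP lk; apply/eqP/val_inj.
      by rewrite andbT ltnS [RHS]ltn_neqAle lk.
    by rewrite [X in _ = _ + X]mulrBl -e; ring.
  apply: le_trans (ler_normD _ _) _; rewrite -[k.+1%:R]natr1 [leRHS]mulrDl mul1r.
  apply: lerD; first exact: IH (ltnW kn).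
  rewrite normrM; apply: ler_pM => //; last first.
    by have := mx_entry_le (y - x) o 0; rewrite !mxE.
  apply: gC; apply: mx_norm_le; first exact: le_trans xr.
  move=> i j; rewrite !mxE ord1 eqxx andbT.
  have [->|io] := eqVneq i o; last first.
    rewrite mulr0 addr0; case: ifP => _; first exact: le_trans (mx_entry_le _ _ _) yr.
    exact: le_trans (mx_entry_le _ _ _) xr.
  rewrite /= ltnn mulr1.
  have := le_trans (mx_entry_le x o 0) xr; have := le_trans (mx_entry_le y o 0) yr.
  move: q0 q1; set u := x o 0; set v := y o 0; rewrite !ler_norml => q0 q1 /andP[v1 v2] /andP[u1 u2].
  by apply/andP; split; nra.
have := main n (leqnn n).
have -> : z n = y by apply/matrixP => i j; rewrite mxE ltn_ord ord1.
by rewrite (eq_bigl xpredT)// => l; rewrite ltn_ord.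
Qed.

Lemma axis_lipschitz (F : V -> R^o) (g : 'I_n -> V -> R) C x y : 0 <= C ->
  (forall z l, is_derive z (axis l) F (g l z)) ->
  (forall z l, `|g l z| <= C) -> `|F y - F x| <= n%:R * (C * `|y - x|).
Proof.
move=> C0 dF gC.
have := @axis_mean_value F g (fun=> 0) (`|x| + `|y|) C x y C0 dF.
rewrite big1 ?subr0; last by move=> l _; rewrite mulr0.
apply; [by move=> z l _; rewrite subr0 gC|by rewrite lerDl|by rewrite lerDr].
Qed.

Definition taylor1 (f : V -> R) (g : 'I_n -> V -> R) x h :=
  f (x + h) - f x - \sum_l h l 0 * g l x.

(** Two applications of the mean value inequality. To move the base point one
    uses the map [k |-> f (x + k) - f (x' + k)], whose gradient changes between [0]
    and [h] by a second difference; to move the increment, [k |-> f (x' + k)]. *)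
Lemma taylor1_lipschitz (f : V -> R^o) (g : 'I_n -> V -> R) C : 0 <= C ->
  (forall z l, is_derive z (axis l) f (g l z)) ->
  (forall z z' l, `|g l z - g l z'| <= C * `|z - z'|) ->
  (forall z z' k l, `|g l (z + k) - g l z - (g l (z' + k) - g l z')|
     <= C * (`|z - z'| * `|k|)) ->
  forall x h x' h', `|taylor1 f g x h - taylor1 f g x' h'| <=
    n%:R * C * (`|x - x'| * `|h| ^+ 2 + `|h - h'| * (`|h| + `|h'|)).
Proof.
move=> C0 df gL gD x h x' h'.
have -> : taylor1 f g x h - taylor1 f g x' h' =
  (taylor1 f g x h - taylor1 f g x' h) + (taylor1 f g x' h - taylor1 f g x' h') by ring.
apply: le_trans (ler_normD _ _) _; rewrite mulrDr; apply: lerD.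
  have := @axis_mean_value (fun k => f (x + k) - f (x' + k))
    (fun l k => g l (x + k) - g l (x' + k)) (fun l => g l x - g l x') `|h|
    (C * (`|x - x'| * `|h|)) 0 h.
  rewrite subr0 !addr0 normr0 => H.
  have -> : taylor1 f g x h - taylor1 f g x' h = f (x + h) - f (x' + h) - (f x - f x') -
      \sum_l (h l 0 - (0 : V) l 0) * (g l x - g l x').
    rewrite /taylor1; have -> : \sum_l (h l 0 - (0 : V) l 0) * (g l x - g l x') =
      \sum_l h l 0 * g l x - \sum_l h l 0 * g l x'.
      by rewrite -sumrB; apply: eq_bigr => l _; rewrite mxE subr0 mulrBr.
    ring.
  apply: le_trans (H _ _ _ _ _) _ => //.
  - by rewrite !mulr_ge0.
  - by move=> z l; apply: is_deriveB; apply: is_derive_translate; exact: df.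
  - move=> z l zh; have := gD x x' z l.
    have -> : g l (x + z) - g l (x' + z) - (g l x - g l x') =
      g l (x + z) - g l x - (g l (x' + z) - g l x') by ring.
    move=> /le_trans; apply; rewrite ler_wpM2l// ler_wpM2l//.
  - by rewrite le_eqVlt; apply/orP; left; apply/eqP; ring.
have := @axis_mean_value (fun k => f (x' + k)) (fun l k => g l (x' + k))
  (fun l => g l x') (`|h| + `|h'|) (C * (`|h| + `|h'|)) h' h.
have -> : taylor1 f g x' h - taylor1 f g x' h' =
    f (x' + h) - f (x' + h') - \sum_l (h l 0 - h' l 0) * g l x'.
  rewrite /taylor1; have -> : \sum_l (h l 0 - h' l 0) * g l x' =
    \sum_l h l 0 * g l x' - \sum_l h' l 0 * g l x'.
    by rewrite -sumrB; apply: eq_bigr => l _; rewrite mulrBl.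
  ring.
move=> H; apply: le_trans (H _ _ _ _ _) _.
- by rewrite mulr_ge0// addr_ge0.
- by move=> z l; apply: is_derive_translate; exact: df.
- move=> z l zr; apply: le_trans (gL _ _ _) _; rewrite ler_wpM2l//.
  by have -> : x' + z - x' = z by zmod.
- by rewrite lerDr.
- by rewrite lerDl.
by rewrite le_eqVlt; apply/orP; left; apply/eqP; ring.
Qed.

End Axes.

Section StripRegularity.
Context {R : realType} {n : nat}.
Variable T : R.
Hypothesis T0 : 0 < T.
Notation V := 'cV[R]_n.
Notation Z := (R^o * V)%type.
Let D : set Z := [set z | z.1 \in `[0, T]].

Lemma strip_interior (z : Z) : 0 < z.1 < T -> D° z.
Proof.
move=> /andP[z0 zT]; rewrite /interior/=.
exists (`]0, T[%classic, setT) => /=; last first.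
  by move=> [t x] /= [+ _]; rewrite in_itv/= => /andP[t0 tT]; rewrite /D/= in_itv/= !ltW.
split; last exact: filterT.
by apply: open_nbhs_nbhs; split; [exact: interval_open|rewrite /= in_itv/= z0].
Qed.

Lemma Ckb_entry k a b (F : Z -> 'M[R]_(a, b)) i j : Ckb D k F ->
  Ckb D k (fun z => F z i j : R^o).
Proof.
have entry_bound (G : Z -> 'M[R]_(a, b)) : (exists M, forall z, D z -> `|G z| <= M) ->
    exists M, forall z, D z -> `|G z i j| <= M.
  by move=> [M GM]; exists M => z Dz; exact: le_trans (mx_entry_le _ _ _) (GM z Dz).
elim: k F => [|k IH] F /= [cF FM dF].
  by split; [exact: within_continuous_entry|exact: entry_bound|].
split; [exact: within_continuous_entry|exact: entry_bound|].
move=> v; have [g [gd gC]] := dF v.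
exists (fun z => g z i j); split; last exact: IH.
move=> z Dz; have [d1 d2] := gd z Dz.
split; first exact: (derivable_mxP _ _ _).1 d1 i j.
by rewrite -d2 derive_mx// mxE.
Qed.

Lemma near_interior_time t d : 0 <= t <= T -> 0 < d ->
  exists2 t', 0 < t' < T & `|t - t'| < d.
Proof.
move=> /andP[t0 tT] d0.
pose r := Num.min 2^-1 (d / (T + 1)).
have r0 : 0 < r by rewrite lt_min invr_gt0 ltr0n divr_gt0// addr_gt0.
have r1 : r <= 2^-1 by rewrite ge_min lexx.
have r2 : r * (T + 1) <= d by rewrite -ler_pdivlMr ?addr_gt0// ge_min lexx orbT.
have r3 : 0 <= 1 - r by lra.
have a1 : 0 < r * T by rewrite mulr_gt0.
have a2 : 0 <= t * (1 - r) by rewrite mulr_ge0.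
have a3 : 0 <= (T - t) * (1 - r) by rewrite mulr_ge0// subr_ge0.
(* Moving towards the midpoint leaves the end times. *)
exists (t + r * (T / 2 - t)); first by clear -a1 a2 a3; apply/andP; split; lra.
have -> : t - (t + r * (T / 2 - t)) = r * (t - T / 2) by ring.
rewrite normrM (gtr0_norm r0); apply: lt_le_trans r2; rewrite (ltr_pM2l r0) ltr_norml.
clear -t0 tT T0; apply/andP; split; lra.
Qed.

Section OneDirection.
Variables (f g : Z -> R^o) (e : V).
Hypotheses (fC : {within D, continuous f}) (gC : {within D, continuous g}).
Hypothesis (dfg : forall z, D° z -> is_derive z (0, e) f (g z)).

Lemma is_derive_slice_interior t x : 0 < t < T ->
  is_derive x e (fun x => f (t, x)) (g (t, x)).
Proof.
move=> tT; have := dfg (strip_interior (z := (t, x)) tT).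
apply: is_derive_eq_quotient => h; congr f; rewrite /= -[RHS]/(t, _).
by apply/pair_equal_spec; split => //=; rewrite scaler0 add0r.
Qed.

(** At the end times the derivative in the space direction is recovered from
    interior times, uniformly for small increments, by continuity of [g]. *)
Lemma is_derive_slice t x : 0 <= t <= T ->
  is_derive x e (fun x => f (t, x)) (g (t, x)).
Proof.
move=> tT; have Dt y : D (t, y) by rewrite /D/= in_itv.
suff cv : (fun h : R => h^-1 *: (((fun x => f (t, x)) \o shift x) (h *: e) - f (t, x)))
    h @[h --> 0^'] --> g (t, x).
  by split; [apply/cvg_ex; exists (g (t, x))|exact: cvg_lim cv].
apply/cvgrPdist_le => eps eps0.
have [d d0 dP] := (within_continuous_ballP _ _).1 gC (t, x) (Dt x) eps eps0.
have e1 : 0 < `|e| + 1 by rewrite ltr_wpDl.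
near=> h.
have h0 : h != 0 by near: h; exact: nbhs_dnbhs_neq.
have hd : `|h| * (`|e| + 1) < d.
  rewrite -ltr_pdivlMr//; near: h; apply: dnbhs0_lt; exact: divr_gt0.
have key : `|f (t, x + h *: e) - f (t, x) - h * g (t, x)| <= eps * `|h|.
  apply/ler_addgt0Pr => eta eta0; have eta20 : 0 < eta / 2 by rewrite divr_gt0.
  have [d1 d10 d1P] := (within_continuous_ballP _ _).1 fC _ (Dt (x + h *: e)) _ eta20.
  have [d2 d20 d2P] := (within_continuous_ballP _ _).1 fC _ (Dt x) _ eta20.
  have dd : 0 < Num.min d (Num.min d1 d2) by rewrite !lt_min d0 d10.
  have [t' t'T tt'] := near_interior_time tT dd.
  have [td td1 td2] : [/\ `|t - t'| < d, `|t - t'| < d1 & `|t - t'| < d2].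
    by move: tt'; rewrite !lt_min => /and3P[].
  have Dt' y : D (t', y) by rewrite /D/= in_itv/=; case/andP: t'T => p q; rewrite !ltW.
  have b1 := d1P (t', x + h *: e) (Dt' _) (conj td1 (ballxx _ d10)).
  have b2 := d2P (t', x) (Dt' _) (conj td2 (ballxx _ d20)).
  have [q /andP[q0 q1]] := @MVT_line R (fun c => f (t', x + c *: e))
    (fun c => g (t', x + c *: e)) 0 h
    (fun c => is_derive_line (is_derive_slice_interior (x + c *: e) t'T)).
  rewrite scale0r addr0 add0r subr0 => m.
  have gb : `|g (t, x) - g (t', x + (q * h) *: e)| <= eps.
    apply: dP => //; split => //=; rewrite -ball_normE/= opprD addrA subrr add0r normrN.
    rewrite normrZ normrM (ger0_norm q0); apply: le_lt_trans hd.
    apply: ler_pM; rewrite ?mulr_ge0//; last by rewrite lerDl.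
    by rewrite ler_piMl.
  have -> : f (t, x + h *: e) - f (t, x) - h * g (t, x) =
    (g (t', x + (q * h) *: e) - g (t, x)) * h +
    ((f (t, x + h *: e) - f (t', x + h *: e)) - (f (t, x) - f (t', x))).
    by rewrite mulrBl -m; ring.
  apply: le_trans (ler_normD _ _) _; apply: lerD.
    by rewrite normrM distrC ler_wpM2r.
  by apply: le_trans (ler_normB _ _) _; rewrite (splitr eta) lerD.
have -> : g (t, x) - h^-1 *: (((fun x => f (t, x)) \o shift x) (h *: e) - f (t, x)) =
    - (h^-1 * (f (t, x + h *: e) - f (t, x) - h * g (t, x))).
  rewrite /= [h *: e + x]addrC mulrBr mulKf// -[_ *: _]/(h^-1 * _); ring.
rewrite normrN normrM normfV ler_pdivrMl ?normr_gt0// [leRHS]mulrC; exact: key.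
Unshelve. all: by end_near. Qed.

End OneDirection.

Lemma time_lipschitz (f g : Z -> R^o) M s t x : {within D, continuous f} ->
  (forall z, D° z -> is_derive z (1, 0) f (g z)) -> (forall z, D z -> `|g z| <= M) ->
  0 <= s <= T -> 0 <= t <= T -> `|f (t, x) - f (s, x)| <= M * `|t - s|.
Proof.
move=> fC dfg gM; wlog st : s t / s <= t => [H sT tT|/andP[s0 _] /andP[_ tT]].
  have [st|/ltW ts] := leP s t; first exact: H.
  by rewrite distrC (distrC t); exact: H.
have DD r y : r \in `[s, t] -> D (r, y).
  by rewrite /D/= !in_itv/= => /andP[sr rt]; rewrite (le_trans s0 sr) (le_trans rt tT).
have cfr : {within `[s, t], continuous (fun r => f (r, x))}.
  apply/within_continuous_ballP => r rst e e0.
  have [d d0 dP] := (within_continuous_ballP _ _).1 fC (r, x) (DD r x rst) e e0.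
  by exists d => // r' r'st rr'; apply: dP; [exact: DD|split => //=; exact: ballxx].
have dfr (r : R) : r \in `]s, t[ -> is_derive r (1 : R) (fun r : R => f (r, x) : R) (g (r, x)).
  rewrite in_itv/= => /andP[sr rt].
  have rT : 0 < r < T by rewrite (le_lt_trans s0 sr) (lt_le_trans rt tT).
  have := dfg _ (strip_interior (z := (r, x)) rT).
  apply: is_derive_eq_quotient => h; congr f; apply/pair_equal_spec; split => //=.
  by rewrite scaler0 add0r.
have [c cst ->] := MVT_segment st dfr cfr.
by rewrite normrM ler_wpM2r// gM//; exact: DD.
Qed.

(** Bounds of a map on the strip up to mixed second order, which are what the
    defect estimates of one-step schemes use. *)
Record second_order_bounded (W : normedModType R) (C : R) (f : R -> V -> W) : Prop := {
  sob_bounded : forall t x, 0 <= t <= T -> `|f t x| <= C;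
  sob_space : forall t x y, 0 <= t <= T -> `|f t x - f t y| <= C * `|x - y|;
  sob_time : forall s t x, 0 <= s <= T -> 0 <= t <= T ->
    `|f t x - f s x| <= C * `|t - s|;
  sob_space2 : forall t x y h, 0 <= t <= T ->
    `|f t (x + h) - f t x - (f t (y + h) - f t y)| <= C * (`|x - y| * `|h|);
  sob_mixed : forall s t x y, 0 <= s <= T -> 0 <= t <= T ->
    `|f t x - f s x - (f t y - f s y)| <= C * (`|t - s| * `|x - y|) }.

Lemma Ckb_continuous k (W : normedModType R) (f : Z -> W) : Ckb D k f -> {within D, continuous f}.
Proof. by case: k => [|k] []. Qed.

Lemma Ckb_bounded k (W : normedModType R) (f : Z -> W) : Ckb D k f ->
  exists2 M, 0 <= M & forall z, D z -> `|f z| <= M.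
Proof.
move=> fC; have [M fM] : exists M : R, forall z, D z -> `|f z| <= M by case: k fC => [|k] [].
by exists `|M| => // z /fM h; apply: le_trans h (ler_norm _).
Qed.

Lemma Ckb_space_gradient k (f : Z -> R^o) : Ckb D k.+1 f ->
  exists g : 'I_n -> Z -> R^o, forall l, Ckb D k (g l) /\
    forall t x, 0 <= t <= T -> is_derive x (axis l) (fun x => f (t, x)) (g l (t, x)).
Proof.
move=> fC; have [cf _ df] := fC.
have [g gP] := choice (fun l : 'I_n => df (0, axis l)).
exists g => l; have [dg gC] := gP l; split=> // t x tT.
exact: (is_derive_slice cf (Ckb_continuous gC) dg).
Qed.

Lemma Ckb_lipschitz k (f : Z -> R^o) : Ckb D k.+1 f -> exists2 C, 0 <= C &
  (forall t x y, 0 <= t <= T -> `|f (t, x) - f (t, y)| <= C * `|x - y|) /\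
  (forall s t x, 0 <= s <= T -> 0 <= t <= T ->
    `|f (t, x) - f (s, x)| <= C * `|t - s|).
Proof.
move=> fC; have [cf _ df] := fC; have [g gP] := Ckb_space_gradient fC.
have [M M0 MP] : exists2 M, 0 <= M & forall l z, D z -> `|g l z| <= M.
  apply: uniform_bound => [l A A' AA gA z Dz|l]; first exact: le_trans (gA z Dz) AA.
  exact: Ckb_bounded (gP l).1.
have [g0 [dg0 g0C]] := df (1, 0); have [N N0 NP] := Ckb_bounded g0C.
exists (n%:R * M + N); first by rewrite addr_ge0// mulr_ge0.
split=> [t x y tT|s t x sT tT]; last first.
  apply: le_trans (time_lipschitz x cf dg0 NP sT tT) _.
  by rewrite ler_wpM2r// lerDr mulr_ge0.
apply: le_trans (axis_lipschitz (F := fun x => f (t, x)) (g := fun l x => g l (t, x))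
  (C := M) y x M0 _ _) _.
- by move=> z l; exact: (gP l).2.
- by move=> z l; apply: MP; rewrite /D/= in_itv.
by rewrite mulrA ler_wpM2r// lerDl.
Qed.

(** The second differences in space and the mixed differences are increments of a
    difference of two values of [f], whose partial derivatives are differences of
    those of [f]; these are Lipschitz in space and time. *)
Lemma Ckb_second_order_bounded (f : Z -> R^o) : Ckb D 2 f ->
  exists2 C, 0 <= C & second_order_bounded C (fun t x => f (t, x) : R^o).
Proof.
move=> fC; have [M M0 fM] := Ckb_bounded fC.
have [L L0 [Lx Lt]] := Ckb_lipschitz fC.
have [g gP] := Ckb_space_gradient fC.
have [S S0 SP] : exists2 S, 0 <= S & forall l,
    (forall t x y, 0 <= t <= T -> `|g l (t, x) - g l (t, y)| <= S * `|x - y|) /\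
    (forall s t x, 0 <= s <= T -> 0 <= t <= T ->
      `|g l (t, x) - g l (s, x)| <= S * `|t - s|).
  apply: uniform_bound => [l A A' AA [h1 h2]|l]; last exact: Ckb_lipschitz (gP l).1.
  split=> [t x y tT|s t x sT tT].
    by apply: le_trans (h1 t x y tT) _; rewrite ler_wpM2r.
  by apply: le_trans (h2 s t x sT tT) _; rewrite ler_wpM2r.
have nS0 : 0 <= n%:R * S by rewrite mulr_ge0.
exists (M + L + n%:R * S); first by rewrite !addr_ge0.
split.
- by move=> t x tT; apply: le_trans (fM (t, x) _) _; [rewrite /D/= in_itv|lra].
- by move=> t x y tT; apply: le_trans (Lx t x y tT) _; rewrite ler_wpM2r//; lra.
- by move=> s t x sT tT; apply: le_trans (Lt s t x sT tT) _; rewrite ler_wpM2r//; lra.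
- move=> t x y h tT.
  have := axis_lipschitz (F := fun z => f (t, z + h) - f (t, z))
    (g := fun l z => g l (t, z + h) - g l (t, z)) (C := S * `|h|) y x _ _ _.
  move=> H; apply: le_trans (H _ _ _) _; first exact: mulr_ge0.
  + move=> z l; apply: is_deriveB; last exact: (gP l).2.
    have -> : (fun z => f (t, z + h)) = (fun z => f (t, h + z)).
      by apply/funext => w; rewrite [w + h]addrC.
    rewrite [z + h]addrC; apply: (is_derive_translate (f := fun z => f (t, z))).
    exact: (gP l).2.
  + move=> z l; have := (SP l).1 t (z + h) z tT.
    by have -> : z + h - z = h by zmod.
  rewrite [leLHS](_ : _ = n%:R * S * (`|x - y| * `|h|)); last by ring.
  by rewrite ler_wpM2r ?mulr_ge0//; lra.
move=> s t x y sT tT.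
have := axis_lipschitz (F := fun z => f (t, z) - f (s, z))
  (g := fun l z => g l (t, z) - g l (s, z)) (C := S * `|t - s|) y x _ _ _.
move=> H; apply: le_trans (H _ _ _) _; first exact: mulr_ge0.
- by move=> z l; apply: is_deriveB; exact: (gP l).2.
- by move=> z l; exact: (SP l).2.
rewrite [leLHS](_ : _ = n%:R * S * (`|t - s| * `|x - y|)); last by ring.
by rewrite ler_wpM2r ?mulr_ge0//; lra.
Qed.

End StripRegularity.

Section MatrixRegularity.
Context {R : realType} {n : nat}.
Variable T : R.
Hypothesis T0 : 0 < T.
Notation V := 'cV[R]_n.
Notation Z := (R^o * V)%type.
Notation D := ([set z : R^o * V | z.1 \in `[0, T]]).

Lemma sob_le (W : normedModType R) C C' (f : R -> V -> W) : C <= C' ->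
  second_order_bounded T C f -> second_order_bounded T C' f.
Proof.
move=> CC [h1 h2 h3 h4 h5]; split.
- by move=> t x tT; exact: le_trans (h1 t x tT) CC.
- by move=> t x y tT; apply: le_trans (h2 t x y tT) _; rewrite ler_wpM2r.
- by move=> s t x sT tT; apply: le_trans (h3 s t x sT tT) _; rewrite ler_wpM2r.
- by move=> t x y h tT; apply: le_trans (h4 t x y h tT) _; rewrite ler_wpM2r// mulr_ge0.
- by move=> s t x y sT tT; apply: le_trans (h5 s t x y sT tT) _; rewrite ler_wpM2r// mulr_ge0.
Qed.

Lemma sob_mx a b (f : R -> V -> 'M[R]_(a, b)) C : 0 <= C ->
  (forall i j, second_order_bounded T C (fun t x => f t x i j : R^o)) ->
  second_order_bounded T C f.
Proof.
move=> C0 h; split.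
- by move=> t x tT; apply: mx_norm_le => // i j; exact: (sob_bounded (h i j)).
- move=> t x y tT; apply: mx_norm_le => [|i j]; first by rewrite !mulr_ge0.
  by rewrite !mxE; exact: (sob_space (h i j)).
- move=> s t x sT tT; apply: mx_norm_le => [|i j]; first by rewrite !mulr_ge0.
  by rewrite !mxE; exact: (sob_time (h i j)).
- move=> t x y k tT; apply: mx_norm_le => [|i j]; first by rewrite !mulr_ge0.
  by rewrite !mxE; exact: (sob_space2 (h i j)).
- move=> s t x y sT tT; apply: mx_norm_le => [|i j]; first by rewrite !mulr_ge0.
  by rewrite !mxE; exact: (sob_mixed (h i j)).
Qed.

Lemma sob_entry a b (f : R -> V -> 'M[R]_(a, b)) C i j : second_order_bounded T C f ->
  second_order_bounded T C (fun t x => f t x i j : R^o).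
Proof.
have e4 (A B D E : 'M[R]_(a, b)) : `|A i j - B i j - (D i j - E i j)| <= `|A - B - (D - E)|.
  by have := mx_entry_le (A - B - (D - E)) i j; rewrite !mxE.
move=> [h1 h2 h3 h4 h5]; split.
- by move=> t x tT; exact: le_trans (mx_entry_le _ _ _) (h1 t x tT).
- by move=> t x y tT; exact: le_trans (mx_entryB_le _ _ _ _) (h2 t x y tT).
- by move=> s t x sT tT; exact: le_trans (mx_entryB_le _ _ _ _) (h3 s t x sT tT).
- by move=> t x y h tT; exact: le_trans (e4 _ _ _ _) (h4 t x y h tT).
- by move=> s t x y sT tT; exact: le_trans (e4 _ _ _ _) (h5 s t x y sT tT).
Qed.

(** The discrete Leibniz rule for the second difference of a product over the
    four corners of a rectangle with sides [u] and [v]. *)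
Lemma mulmx_four_points a b c (a11 a12 a21 a22 : 'M[R]_(a, b))
    (b11 b12 b21 b22 : 'M[R]_(b, c)) A B u v :
  0 <= A -> 0 <= B -> 0 <= u -> 0 <= v -> `|a22| <= A -> `|b11| <= B ->
  `|a21 - a22| <= A * u -> `|a12 - a22| <= A * v ->
  `|b11 - b12| <= B * u -> `|b11 - b21| <= B * v ->
  `|a11 - a12 - (a21 - a22)| <= A * (u * v) ->
  `|b11 - b12 - (b21 - b22)| <= B * (u * v) ->
  `|a11 *m b11 - a12 *m b12 - (a21 *m b21 - a22 *m b22)|
    <= 4 * b%:R * A * B * (u * v).
Proof.
move=> A0 B0 u0 v0 ha hb hau hav hbu hbv haa hbb.
have -> : a11 *m b11 - a12 *m b12 - (a21 *m b21 - a22 *m b22) =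
  (a11 - a12 - (a21 - a22)) *m b11 + (a21 - a22) *m (b11 - b21)
  + (a12 - a22) *m (b11 - b12) + a22 *m (b11 - b12 - (b21 - b22)).
  by rewrite !(mulmxBl, mulmxBr); zmod.
have -> : 4 * b%:R * A * B * (u * v) = b%:R * (A * (u * v) * B) +
  b%:R * (A * u * (B * v)) + b%:R * (A * v * (B * u)) + b%:R * (A * (B * (u * v))) by ring.
apply: le_trans (ler_normD _ _) _; apply: lerD; last first.
  by apply: le_trans (mulmx_norm_le _ _) _; rewrite ler_wpM2l// ler_pM.
apply: le_trans (ler_normD _ _) _; apply: lerD; last first.
  by apply: le_trans (mulmx_norm_le _ _) _; rewrite ler_wpM2l// ler_pM.
apply: le_trans (ler_normD _ _) _; apply: lerD.
  by apply: le_trans (mulmx_norm_le _ _) _; rewrite ler_wpM2l// ler_pM.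
by apply: le_trans (mulmx_norm_le _ _) _; rewrite ler_wpM2l// ler_pM.
Qed.

Lemma mulmx_two_points a b c (a1 a2 : 'M[R]_(a, b)) (b1 b2 : 'M[R]_(b, c)) A B Au Bu :
  0 <= A -> 0 <= B -> `|a2| <= A -> `|b1| <= B -> `|a1 - a2| <= Au -> `|b1 - b2| <= Bu ->
  `|a1 *m b1 - a2 *m b2| <= b%:R * (Au * B + A * Bu).
Proof.
move=> A0 B0 ha hb hau hbu.
have -> : a1 *m b1 - a2 *m b2 = (a1 - a2) *m b1 + a2 *m (b1 - b2).
  by rewrite mulmxBl mulmxBr; zmod.
apply: le_trans (ler_normD _ _) _; rewrite mulrDr; apply: lerD.
  by apply: le_trans (mulmx_norm_le _ _) _; rewrite ler_wpM2l// ler_pM.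
by apply: le_trans (mulmx_norm_le _ _) _; rewrite ler_wpM2l// ler_pM.
Qed.

Lemma sob_mulmx a b c (f : R -> V -> 'M[R]_(a, b)) (g : R -> V -> 'M[R]_(b, c)) A B :
  0 <= A -> 0 <= B -> second_order_bounded T A f -> second_order_bounded T B g ->
  second_order_bounded T (4 * b%:R * A * B) (fun t x => f t x *m g t x).
Proof.
move=> A0 B0 [f1 f2 f3 f4 f5] [g1 g2 g3 g4 g5].
have bAB : 0 <= b%:R * A * B by rewrite !mulr_ge0.
have K2 u : 0 <= u -> b%:R * (A * u * B + A * (B * u)) <= 4 * b%:R * A * B * u.
  move=> u0; rewrite -subr_ge0.
  have -> : 4 * b%:R * A * B * u - b%:R * (A * u * B + A * (B * u)) = 2 * (b%:R * A * B) * u by ring.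
  by rewrite !mulr_ge0.
split.
- move=> t x tT; apply: le_trans (mulmx_norm_le _ _) _.
  apply: (@le_trans _ _ (b%:R * (A * B))); last by lra.
  by rewrite ler_wpM2l// ler_pM// ?f1 ?g1.
- move=> t x y tT; apply: le_trans (K2 _ (normr_ge0 _)).
  by apply: mulmx_two_points; rewrite ?f1 ?g1 ?f2 ?g2.
- move=> s t x sT tT; apply: le_trans (K2 _ (normr_ge0 _)).
  by apply: mulmx_two_points; rewrite ?f1 ?g1 ?f3 ?g3.
- move=> t x y h tT; rewrite (mulrC `|x - y|).
  have yh : (x + h) - (y + h) = x - y by zmod.
  have hy : y + h - y = h by zmod.
  have hx : x + h - x = h by zmod.
  apply: mulmx_four_points => //; rewrite ?f1 ?g1//.
  + by rewrite -{2}hy f2.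
  + exact: f2.
  + by rewrite -{2}hx g2.
  + by rewrite -yh g2.
  + by rewrite (mulrC `|h|) f4.
  + by rewrite (mulrC `|h|) g4.
move=> s t x y sT tT.
apply: mulmx_four_points; [by []|by []|exact: normr_ge0|exact: normr_ge0|exact: f1|exact: g1|
  exact: f3|exact: f2|exact: g3|exact: g2|exact: f5|exact: g5].
Qed.

Lemma Ckb_mx_second_order_bounded a b (F : Z -> 'M[R]_(a, b)) : Ckb D 2 F ->
  exists2 C, 0 <= C & second_order_bounded T C (fun t x => F (t, x)).
Proof.
move=> FC.
have [C C0 CP] : exists2 C, 0 <= C & forall ij : 'I_a * 'I_b,
    second_order_bounded T C (fun t x => F (t, x) ij.1 ij.2 : R^o).
  apply: uniform_bound => [ij A A' AA|ij]; first exact: sob_le.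
  exact: (Ckb_second_order_bounded T0 (Ckb_entry ij.1 ij.2 FC)).
by exists C => //; apply: sob_mx => // i j; exact: (CP (i, j)).
Qed.

Lemma Ckb_directional (W : normedModType R) k (F : Z -> W) v : Ckb D k.+1 F ->
  exists g : Z -> W, Ckb D k g /\ forall z, (D : set Z)° z -> is_derive z v F (g z).
Proof. by case=> _ _ /(_ v)[g [gd gC]]; exists g. Qed.

Lemma Ckb_mx_slice a b k k' (F G : Z -> 'M[R]_(a, b)) e : Ckb D k F -> Ckb D k' G ->
  (forall z, (D : set Z)° z -> is_derive z (0, e) F (G z)) ->
  forall t x i j, 0 <= t <= T ->
  is_derive x e (fun x => F (t, x) i j : R^o) (G (t, x) i j).
Proof.
move=> FC GC dF t x i j tT.
apply: (@is_derive_slice R n T T0 (fun z => F z i j) (fun z => G z i j)) => //.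
- exact: Ckb_continuous (Ckb_entry i j FC).
- exact: Ckb_continuous (Ckb_entry i j GC).
move=> z Dz; have [d1 d2] := dF z Dz; split.
  exact: (derivable_mxP _ _ _).1 d1 i j.
by rewrite -d2 derive_mx// mxE.
Qed.

Lemma Ckb_le (W : normedModType R) k (F : Z -> W) : Ckb D k.+1 F -> Ckb D k F.
Proof.
elim: k F => [|k IH] F [c b d]; first by split.
by split=> // v; have [g [dg gC]] := d v; exists g; split=> //; exact: IH.
Qed.

Definition taylor_col d (sigma : R -> V -> 'M[R]_(n, d)) j t x h : V :=
  col j (sigma t (x + h)) - col j (sigma t x) - nabla_x sigma t x j *m h.

(** All that is used of the regularity of [sigma]. The third derivatives only
    enter through the second order bounds of the Jacobian matrices. *)
Record regular_coefficient d (C : R) (sigma : R -> V -> 'M[R]_(n, d)) : Prop := {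
  regular_sigma : second_order_bounded T C sigma;
  regular_nabla : forall j, second_order_bounded T C (fun t x => nabla_x sigma t x j);
  regular_taylor : forall j t x h x' h', 0 <= t <= T ->
    `|taylor_col sigma j t x h - taylor_col sigma j t x' h'|
     <= C * (`|x - x'| * `|h| ^+ 2 + `|h - h'| * (`|h| + `|h'|)) }.

Lemma Ckb_regular_coefficient d (sigma : R -> V -> 'M[R]_(n, d)) :
  Ckb D 3 (fun z => sigma z.1 z.2) -> exists2 C, 0 <= C & regular_coefficient C sigma.
Proof.
move=> sC.
have sC2 : Ckb D 2 (fun z => sigma z.1 z.2) := Ckb_le sC.
have [C1 C10 C1P] := Ckb_mx_second_order_bounded sC2.
have [G GP] := choice (fun l : 'I_n => Ckb_directional (0, axis l) sC).
have dG l := Ckb_mx_slice sC (GP l).1 (GP l).2.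
have GE t x j : 0 <= t <= T ->
    nabla_x sigma t x j = \matrix_(i, l) G l (t, x) i j.
  move=> tT; apply/matrixP => i l; rewrite !mxE.
  rewrite derive_mx; last by apply/derivable_mxP => i' j'; exact: (@ex_derive _ _ _ _ _ _ _ (dG l t x i' j' tT)).
  by rewrite mxE; exact: (@derive_val _ _ _ _ _ _ _ (dG l t x i j tT)).
have [S S0 GS] : exists2 S, 0 <= S & forall l, second_order_bounded T S (fun t x => G l (t, x)).
  apply: uniform_bound => [l A A' AA|l]; first exact: sob_le.
  exact: (Ckb_mx_second_order_bounded (GP l).1).
have nS0 : 0 <= n%:R * S by rewrite mulr_ge0.
exists (C1 + S + n%:R * S); first by rewrite !addr_ge0.
split.
- by apply: sob_le C1P; lra.
- move=> j; apply: (@sob_le _ S); first lra.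
  have [h1 h2 h3 h4 h5] : second_order_bounded T S (fun t x => \matrix_(i, l) G l (t, x) i j : 'M[R]_n).
    apply: sob_mx => // i l; have := sob_entry i j (GS l).
    by congr second_order_bounded; apply/funext => t; apply/funext => x; rewrite mxE.
  by split=> *; rewrite !GE//; [exact: h1|exact: h2|exact: h3|exact: h4|exact: h5].
move=> j t x h x' h' tT.
have X0 : 0 <= `|x - x'| * `|h| ^+ 2 + `|h - h'| * (`|h| + `|h'|).
  by rewrite addr_ge0// mulr_ge0 ?exprn_ge0// addr_ge0.
apply: (@le_trans _ _ (n%:R * S * (`|x - x'| * `|h| ^+ 2 + `|h - h'| * (`|h| + `|h'|)))); last first.
  by rewrite ler_wpM2r//; lra.
apply: mx_norm_le => [|i q]; first by rewrite mulr_ge0.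
have TE y k : taylor_col sigma j t y k i q =
    taylor1 (fun x => sigma t x i j) (fun l x => G l (t, x) i j) y k.
  rewrite /taylor_col /taylor1 GE// !mxE; congr (_ - _).
  by apply: eq_bigr => l _; rewrite !mxE mulrC (ord1 q).
rewrite !mxE in TE *; rewrite -!/(taylor_col _ _ _ _ _).
have := @taylor1_lipschitz R n (fun x => sigma t x i j) (fun l x => G l (t, x) i j) S S0 _ _ _ x h x' h'.
rewrite -!TE => H; apply: (le_trans _ (H _ _ _)).
- by rewrite !mxE.
- by move=> z l; exact: dG.
- by move=> z z' l; exact: (sob_space (sob_entry i j (GS l)) z z' tT).
by move=> z z' k l; exact: (sob_space2 (sob_entry i j (GS l)) z z' k tT).
Qed.

Lemma taylor_col_le d C (sigma : R -> V -> 'M[R]_(n, d)) j t x h :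
  regular_coefficient C sigma -> 0 <= t <= T -> `|taylor_col sigma j t x h| <= C * `|h| ^+ 2.
Proof.
move=> sreg tT; have := regular_taylor sreg j x h x 0 tT.
have -> : taylor_col sigma j t x 0 = 0 by rewrite /taylor_col mulmx0 addr0 subrr subr0.
have xx : `|x - x| = 0 by rewrite subrr; exact: normr0.
have z0 : `|0 : V| = 0 by exact: normr0.
by rewrite xx mul0r add0r !subr0 z0 addr0 -expr2.
Qed.

End MatrixRegularity.

(** * The one-step flow of a rough differential equation *)

Section OrderCalculus.
Context {R : realType}.
Variables (T c : R) (w : R -> R -> R).
Hypothesis c0 : 0 <= c.
Hypothesis w0 : forall s t, 0 <= s -> s <= t -> t <= T -> 0 <= w s t.
Hypothesis wc : forall s t, 0 <= s -> s <= t -> t <= T -> w s t <= c.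

(** Bounded by a multiple of [w ^+ k], with a Lipschitz constant in the state of
    the same size. The class is stable under sums, and orders add up under
    products, so that estimating a defect amounts to counting orders. *)
Definition order_lip (V W : normedModType R) k (f : R -> R -> R -> V -> W) :=
  exists2 K, 0 <= K & forall s r t x y, 0 <= s -> s <= r -> r <= t -> t <= T ->
    `|f s r t x| <= K * w s t ^+ k /\
    `|f s r t x - f s r t y| <= K * w s t ^+ k * `|x - y|.

Section Vectors.
Context {V W : normedModType R}.
Implicit Types f g : R -> R -> R -> V -> W.

Lemma order_lip_ext k f g :
  (forall s r t y, 0 <= s -> s <= r -> r <= t -> t <= T -> f s r t y = g s r t y) ->
  order_lip k f -> order_lip k g.
Proof.
move=> e [K K0 KP]; exists K => // s r t x y s0 sr rt tT.
by rewrite -!e//; exact: KP.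
Qed.

Lemma order_lip_le k f : order_lip k.+1 f -> order_lip k f.
Proof.
move=> [K K0 KP]; exists (K * c); first exact: mulr_ge0.
move=> s r t x y s0 sr rt tT; have [h1 h2] := KP s r t x y s0 sr rt tT.
have st := le_trans sr rt.
have le : K * w s t ^+ k.+1 <= K * c * w s t ^+ k.
  by rewrite exprS mulrA ler_wpM2r ?exprn_ge0 ?w0// ler_wpM2l// wc.
by split; [exact: le_trans h1 le|apply: le_trans h2 _; rewrite ler_wpM2r].
Qed.

Lemma order_lip_add k f g : order_lip k f -> order_lip k g ->
  order_lip k (fun s r t y => f s r t y + g s r t y).
Proof.
move=> [K K0 KP] [L L0 LP]; exists (K + L); first exact: addr_ge0.
move=> s r t x y s0 sr rt tT; have [h1 h2] := KP s r t x y s0 sr rt tT.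
have [h3 h4] := LP s r t x y s0 sr rt tT; rewrite !mulrDl; split.
  by apply: le_trans (ler_normD _ _) _; exact: lerD.
by rewrite opprD addrACA; apply: le_trans (ler_normD _ _) _; exact: lerD.
Qed.

Lemma order_lip_opp k f : order_lip k f -> order_lip k (fun s r t y => - f s r t y).
Proof.
move=> [K K0 KP]; exists K => // s r t x y s0 sr rt tT.
have [h1 h2] := KP s r t x y s0 sr rt tT.
by rewrite -opprD !normrN.
Qed.

Lemma order_lip_sum k (I : finType) (F : I -> R -> R -> R -> V -> W) :
  (forall i, order_lip k (F i)) -> order_lip k (fun s r t y => \sum_i F i s r t y).
Proof.
move=> FP.
suff H (l : seq I) : order_lip k (fun s r t y => \sum_(i <- l) F i s r t y) by exact: H.
elim: l => [|i l IH].
  exists 0 => // s r t x y _ _ _ _; rewrite !big_nil subrr normr0 !mul0r; split=> //.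
apply: (@order_lip_ext _ (fun s r t y => F i s r t y + \sum_(i <- l) F i s r t y)).
  by move=> *; rewrite big_cons.
exact: order_lip_add.
Qed.

Lemma order_lip_const k (a : R -> R -> R -> W) K : 0 <= K ->
  (forall s r t, 0 <= s -> s <= r -> r <= t -> t <= T -> `|a s r t| <= K * w s t ^+ k) ->
  order_lip k (fun s r t (_ : V) => a s r t).
Proof.
move=> K0 aK; exists K => // s r t x y s0 sr rt tT; split; first exact: aK.
by rewrite subrr normr0 !mulr_ge0// exprn_ge0// w0// (le_trans sr).
Qed.

Lemma order_lip_scale k (a : R -> R -> R -> R) f :
  (forall s r t, 0 <= s -> s <= r -> r <= t -> t <= T -> `|a s r t| <= w s t) ->
  order_lip k f -> order_lip k.+1 (fun s r t y => a s r t *: f s r t y).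
Proof.
move=> aK [K K0 KP]; exists K => // s r t x y s0 sr rt tT.
have [h1 h2] := KP s r t x y s0 sr rt tT; have aw := aK s r t s0 sr rt tT.
rewrite -scalerBr !normrZ exprS (mulrCA K) -[in X in _ /\ X]mulrA.
by split; exact: ler_pM.
Qed.

End Vectors.

Section Matrices.
Context {V : normedModType R}.

Lemma order_lip_mulmx k l a b e (f : R -> R -> R -> V -> 'M[R]_(a, b))
    (g : R -> R -> R -> V -> 'M[R]_(b, e)) :
  order_lip k f -> order_lip l g ->
  order_lip (k + l) (fun s r t y => f s r t y *m g s r t y).
Proof.
move=> [K K0 KP] [L L0 LP]; exists (b%:R * (2 * (K * L))); first by rewrite !mulr_ge0.
move=> s r t x y s0 sr rt tT; have [h1 h2] := KP s r t x y s0 sr rt tT.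
have [h3 h4] := LP s r t x y s0 sr rt tT.
have [h5 _] := KP s r t y x s0 sr rt tT.
have wst0 : 0 <= w s t by apply: w0 => //; exact: le_trans sr rt.
have KL : 0 <= b%:R * (K * L * w s t ^+ (k + l)) by rewrite !mulr_ge0// exprn_ge0.
split.
  apply: le_trans (mulmx_norm_le _ _) _.
  apply: (@le_trans _ _ (b%:R * (K * w s t ^+ k * (L * w s t ^+ l)))).
    by rewrite ler_wpM2l// ler_pM.
  have -> : b%:R * (K * w s t ^+ k * (L * w s t ^+ l)) = b%:R * (K * L * w s t ^+ (k + l)).
    by rewrite exprD; ring.
  rewrite -subr_ge0; rewrite [leRHS](_ : _ = b%:R * (K * L * w s t ^+ (k + l)))//; ring.
have wk : 0 <= w s t ^+ k by exact: exprn_ge0.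
have wl : 0 <= w s t ^+ l by exact: exprn_ge0.
apply: le_trans (mulmx_two_points (A := K * w s t ^+ k) (B := L * w s t ^+ l) _ _ h5 h3 h2 h4) _.
- exact: mulr_ge0.
- exact: mulr_ge0.
by rewrite le_eqVlt; apply/orP; left; apply/eqP; rewrite exprD; ring.
Qed.

Lemma order_lip_col k a b j (f : R -> R -> R -> V -> 'M[R]_(a, b)) :
  order_lip k f -> order_lip k (fun s r t y => col j (f s r t y)).
Proof.
move=> [K K0 KP]; exists K => // s r t x y s0 sr rt tT.
have [h1 h2] := KP s r t x y s0 sr rt tT; split.
  exact: le_trans (col_norm_le _ _) h1.
by rewrite -colB; exact: le_trans (col_norm_le _ _) h2.
Qed.

End Matrices.
End OrderCalculus.

Section RoughFlow.
Context {R : realType} {n d : nat}.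
Notation V := 'cV[R]_n.
Variables (T C c : R) (w : R -> R -> R).
Variables (sigma : R -> V -> 'M[R]_(n, d)) (X : R -> 'cV[R]_d) (XX : R -> R -> 'M[R]_d).

(** The second order Taylor step of the equation, also known as Davie's
    expansion. *)
Definition rough_step s t (y : V) : V := sigma s y *m increment X s t
  + \sum_j (nabla_x sigma s y j *m sigma s y) *m col j (XX s t).

Hypotheses (T0 : 0 <= T) (C0 : 0 <= C) (c0 : 0 <= c).
Hypothesis sreg : regular_coefficient T C sigma.
Hypothesis w0 : forall s t, 0 <= s -> s <= t -> t <= T -> 0 <= w s t.
Hypothesis wc : forall s t, 0 <= s -> s <= t -> t <= T -> w s t <= c.
Hypothesis wmono : forall s s' t' t, 0 <= s -> s <= s' -> s' <= t' -> t' <= t -> t <= T ->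
  w s' t' <= w s t.
Hypothesis Xw : forall s t, 0 <= s -> s <= t -> t <= T -> `|increment X s t| <= w s t.
Hypothesis XXw : forall s t, 0 <= s -> s <= t -> t <= T -> `|XX s t| <= w s t ^+ 2.
Hypothesis lenw : forall s t, 0 <= s -> s <= t -> t <= T -> t - s <= c * w s t ^+ 2.
Hypothesis chen : forall s r t, 0 <= s -> s <= r -> r <= t -> t <= T ->
  forall j, col j (XX s t) = col j (XX s r) + col j (XX r t)
    + increment X r t j 0 *: increment X s r.

Notation order := (order_lip T w).
Let inT t : 0 <= t -> t <= T -> 0 <= t <= T. Proof. by move=> -> ->. Qed.
Let second a b C' (f : R -> V -> 'M[R]_(a, b)) := second_order_bounded T C' f.

Lemma order_coefficient a b C' (f : R -> V -> 'M[R]_(a, b)) : 0 <= C' -> second C' f ->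
  order 0 (fun s r t y => f s y).
Proof.
move=> C'0 fS; exists C' => // s r t x y s0 sr rt tT; rewrite expr0 mulr1.
have sT : 0 <= s <= T by rewrite s0 (le_trans sr (le_trans rt tT)).
by split; [exact: (sob_bounded fS)|exact: (sob_space fS)].
Qed.

Lemma order_increment_left : order (V := V) 1 (fun s r t _ => increment X s r).
Proof.
apply: (order_lip_const w0 (K := 1)) => // s r t s0 sr rt tT; rewrite mul1r expr1.
by apply: le_trans (Xw s0 sr (le_trans rt tT)) _; exact: wmono.
Qed.

Lemma order_second_left : order (V := V) 2 (fun s r t _ => XX s r).
Proof.
apply: (order_lip_const w0 (K := 1)) => // s r t s0 sr rt tT; rewrite mul1r.
have rT := le_trans rt tT.
apply: le_trans (XXw s0 sr rT) _; rewrite ler_pXn2r ?nnegrE ?w0//; first exact: wmono.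
exact: le_trans sr rt.
Qed.

Lemma order_second_right : order (V := V) 2 (fun s r t _ => XX r t).
Proof.
apply: (order_lip_const w0 (K := 1)) => // s r t s0 sr rt tT; rewrite mul1r.
have r0 := le_trans s0 sr.
apply: le_trans (XXw r0 rt tT) _; rewrite ler_pXn2r ?nnegrE ?w0//; first exact: wmono.
exact: le_trans sr rt.
Qed.

Definition second_coefficient j s y := nabla_x sigma s y j *m sigma s y.

Let Cg := 4 * n%:R * C * C.
Let Cg0 : 0 <= Cg. Proof. by rewrite !mulr_ge0. Qed.

Lemma second_coefficient_bounded j : second Cg (second_coefficient j).
Proof. exact: (sob_mulmx C0 C0 (regular_nabla sreg j) (regular_sigma sreg)). Qed.

Lemma order_second_part :
  order 2 (fun s r t y => \sum_j second_coefficient j s y *m col j (XX s r)).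
Proof.
apply: order_lip_sum => j; apply: (order_lip_mulmx w0 (k := 0) (l := 2)).
  exact: order_coefficient (second_coefficient_bounded j).
exact: (order_lip_col j order_second_left).
Qed.

Lemma order_step : order 1 (fun s r t y => rough_step s r y).
Proof.
apply: order_lip_add; last by apply: (order_lip_le c0 w0 wc); exact: order_second_part.
apply: (order_lip_mulmx w0 (k := 0) (l := 1)); last exact: order_increment_left.
exact: order_coefficient (regular_sigma sreg).
Qed.

(** The order is two because time increments are of order two in [w]. *)
Lemma order_time_change a b C' (f : R -> V -> 'M[R]_(a, b)) : 0 <= C' -> second C' f ->
  order 2 (fun s r t y => f r (y + rough_step s r y) - f s (y + rough_step s r y)).
Proof.
move=> C'0 fS; have [K K0 KP] := order_step.
have cK : 0 <= 1 + K * c by rewrite addr_ge0// mulr_ge0.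
exists (C' * c * (1 + K * c)); first by rewrite !mulr_ge0.
move=> s r t x y s0 sr rt tT; have [_ h2] := KP s r t x y s0 sr rt tT.
have [r0 rT st] := And3 (le_trans s0 sr) (le_trans rt tT) (le_trans sr rt).
have rs : `|r - s| <= c * w s t ^+ 2.
  rewrite ger0_norm ?subr_ge0//; apply: le_trans (lenw s0 st tT).
  by rewrite lerD2r.
have sT := le_trans st tT.
have ws : 0 <= c * w s t ^+ 2 by rewrite mulr_ge0// exprn_ge0// w0.
split.
  apply: le_trans (sob_time fS _ (inT s0 sT) (inT r0 rT)) _.
  apply: le_trans (ler_wpM2l C'0 rs) _.
  rewrite [leRHS](_ : _ = C' * (c * w s t ^+ 2) * (1 + K * c)); last by ring.
  by apply: ler_peMr; [exact: mulr_ge0|by rewrite lerDl mulr_ge0].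
apply: le_trans (sob_mixed fS _ _ (inT s0 sT) (inT r0 rT)) _.
rewrite [leRHS](_ : _ = C' * (c * w s t ^+ 2 * ((1 + K * c) * `|x - y|))); last by ring.
rewrite ler_wpM2l// ler_pM//.
have -> : x + rough_step s r x - (y + rough_step s r y) =
  (x - y) + (rough_step s r x - rough_step s r y) by zmod.
apply: le_trans (ler_normD _ _) _; rewrite mulrDl mul1r lerD2l.
apply: le_trans h2 _; rewrite expr1 ler_wpM2r// ler_wpM2l// wc//.
Qed.

Lemma order_space_change a b C' (f : R -> V -> 'M[R]_(a, b)) : 0 <= C' -> second C' f ->
  order 1 (fun s r t y => f s (y + rough_step s r y) - f s y).
Proof.
move=> C'0 fS; have [K K0 KP] := order_step.
exists (C' * (K + K)); first by rewrite mulr_ge0// addr_ge0.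
move=> s r t x y s0 sr rt tT; have [h1 h2] := KP s r t x y s0 sr rt tT.
have [rT st] := (le_trans rt tT, le_trans sr rt).
have sT := inT s0 (le_trans st tT).
have [h3 _] := KP s r t y x s0 sr rt tT.
have Kw : 0 <= K * w s t by rewrite mulr_ge0// w0.
rewrite expr1 in h1 h2 h3 *; split.
  apply: le_trans (sob_space fS _ _ sT) _; rewrite -mulrA ler_wpM2l//.
  have -> : x + rough_step s r x - x = rough_step s r x by zmod.
  by apply: le_trans h1 _; rewrite ler_wpM2r ?lerDl// w0.
set m := rough_step s r in h1 h2 h3 *.
have -> : f s (x + m x) - f s x - (f s (y + m y) - f s y) =
  (f s (x + m x) - f s x - (f s (y + m x) - f s y)) + (f s (y + m x) - f s (y + m y)).
  by zmod.
apply: le_trans (ler_normD _ _) _.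
apply: le_trans (lerD (sob_space2 fS _ _ _ sT) (sob_space fS _ _ sT)) _.
have -> : y + m x - (y + m y) = m x - m y by zmod.
rewrite -mulrDr -!mulrA ler_wpM2l// mulrDl; apply: lerD.
  by rewrite mulrC mulrA ler_wpM2r.
by rewrite mulrA.
Qed.

Lemma order_taylor j : order 2 (fun s r t y => taylor_col sigma j s y (rough_step s r y)).
Proof.
have [K K0 KP] := order_step.
have K2 : 0 <= K ^+ 2 by exact: exprn_ge0.
exists (C * (3 * K ^+ 2)); first by rewrite !mulr_ge0.
move=> s r t x y s0 sr rt tT; have [h1 h2] := KP s r t x y s0 sr rt tT.
have [rT st] := (le_trans rt tT, le_trans sr rt).
have sT := inT s0 (le_trans st tT).
have [h3 _] := KP s r t y x s0 sr rt tT.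
have ws : 0 <= w s t by exact: w0.
rewrite expr1 in h1 h2 h3.
have Kw : 0 <= K * w s t by rewrite mulr_ge0.
set m := rough_step s r in h1 h2 h3 *.
have m2 : `|m x| ^+ 2 <= K ^+ 2 * w s t ^+ 2.
  by rewrite -exprMn ler_pXn2r ?nnegrE.
have KK : 0 <= K ^+ 2 * w s t ^+ 2 by rewrite mulr_ge0// exprn_ge0.
split.
  apply: le_trans (taylor_col_le j x (m x) sreg sT) _; rewrite -mulrA ler_wpM2l//; apply: le_trans m2 _.
  by rewrite -mulrA ler_peMl//; lra.
apply: le_trans (regular_taylor sreg j _ _ _ _ sT) _.
rewrite [leRHS](_ : _ = C * (`|x - y| * (K ^+ 2 * w s t ^+ 2)
   + K * w s t * `|x - y| * (K * w s t + K * w s t))); last by ring.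
apply: ler_wpM2l => //.
apply: lerD; first by rewrite ler_wpM2l.
by apply: ler_pM => //; exact: lerD.
Qed.

(** The defect of a step is a sum of products of an increment of the driver
    with a remainder; by Chen's relation the terms of order one and two cancel. *)
Lemma rough_defectE s r t y : 0 <= s -> s <= r -> r <= t -> t <= T ->
  let y' := y + rough_step s r y in
  defect rough_step s r t y =
  - (\sum_j increment X r t j 0 *: (col j (sigma r y' - sigma s y')
      + taylor_col sigma j s y (rough_step s r y)
      + nabla_x sigma s y j *m \sum_k second_coefficient k s y *m col k (XX s r))
  + \sum_j ((second_coefficient j r y' - second_coefficient j s y')
      + (second_coefficient j s y' - second_coefficient j s y)) *m col j (XX r t)).
Proof.
move=> s0 sr rt tT y'.
have incX : increment X s t = increment X s r + increment X r t.
  by rewrite /increment; zmod.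
have E1 j : increment X r t j 0 *: (col j (sigma r y' - sigma s y')
      + taylor_col sigma j s y (rough_step s r y)
      + nabla_x sigma s y j *m \sum_k second_coefficient k s y *m col k (XX s r)) =
   increment X r t j 0 *: col j (sigma r y') - increment X r t j 0 *: col j (sigma s y)
   - increment X r t j 0 *: (second_coefficient j s y *m increment X s r).
  rewrite -!scalerBr; congr (_ *: _).
  rewrite colB /taylor_col -/y' /rough_step mulmxDr /second_coefficient !mulmxA; zmod.
rewrite (eq_bigr _ (fun j _ => E1 j)) !sumrB -!mulmx_sum_col.
have E2 : \sum_j ((second_coefficient j r y' - second_coefficient j s y')
      + (second_coefficient j s y' - second_coefficient j s y)) *m col j (XX r t) =
   \sum_j second_coefficient j r y' *m col j (XX r t) -
   \sum_j second_coefficient j s y *m col j (XX r t).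
  by rewrite -sumrB; apply: eq_bigr => j _; rewrite -mulmxBl; congr (_ *m _); zmod.
rewrite E2 /defect -/y'.
have E3 : rough_step s t y = sigma s y *m increment X s r + sigma s y *m increment X r t
  + (\sum_j second_coefficient j s y *m col j (XX s r) +
     \sum_j second_coefficient j s y *m col j (XX r t) +
     \sum_j increment X r t j 0 *: (second_coefficient j s y *m increment X s r)).
  rewrite /rough_step incX mulmxDr; congr (_ + _); rewrite -!big_split/=.
  by apply: eq_bigr => j _; rewrite (chen s0 sr rt tT) /increment !mulmxDr -scalemxAr mulmxDr.
rewrite E3.
have E4 : rough_step s r y = sigma s y *m increment X s r +
  \sum_j second_coefficient j s y *m col j (XX s r) by [].
have E5 : rough_step r t y' = sigma r y' *m increment X r t +
  \sum_j second_coefficient j r y' *m col j (XX r t) by [].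
rewrite E5 E4; zmod.
Qed.

(** In each product of [rough_defectE] the orders of the factors add up to three:
    an increment of the path meets terms of order two, the second level of the
    driver meets increments of the coefficients. *)
Lemma order_defect : order 3 (fun s r t y => defect rough_step s r t y).
Proof.
apply: order_lip_ext (fun s r t y s0 sr rt tT => esym (rough_defectE y s0 sr rt tT)) _.
apply: order_lip_opp; apply: order_lip_add.
  apply: order_lip_sum => j; apply: (order_lip_scale (k := 2)).
    move=> s r t s0 sr rt tT; apply: le_trans (mx_entry_le _ _ _) _.
    by apply: le_trans (Xw (le_trans s0 sr) rt tT) _; apply: wmono.
  apply: order_lip_add; first apply: order_lip_add.
  - exact: (order_lip_col j (order_time_change C0 (regular_sigma sreg))).
  - exact: order_taylor.
  apply: (order_lip_mulmx w0 (k := 0) (l := 2)); last exact: order_second_part.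
  exact: order_coefficient (regular_nabla sreg j).
apply: order_lip_sum => j; apply: (order_lip_mulmx w0 (k := 1) (l := 2)).
  apply: order_lip_add.
    apply: (order_lip_le c0 w0 wc).
    exact: order_time_change Cg0 (second_coefficient_bounded j).
  exact: order_space_change Cg0 (second_coefficient_bounded j).
exact: (order_lip_col j order_second_right).
Qed.

End RoughFlow.

Section FlowsOfDrivers.
Context {R : realType} {n d : nat}.
Notation V := 'cV[R]_n.
Variables (T al : R) (om : R -> R -> R) (X : R -> 'cV[R]_d) (XX : R -> R -> 'M[R]_d).

(** The exponent [al] is the inverse of a variation exponent. The control
    dominates the length of intervals as well, so that the drift and the time
    dependence of the coefficients are measured by it too. *)
Record rough_driver : Prop := RoughDriver {
  driver_control : control T om;
  driver_length : forall s t, 0 <= s -> s <= t -> t <= T -> t - s <= om s t;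
  driver_first : forall s t, 0 <= s -> s <= t -> t <= T ->
    `|increment X s t| <= om s t `^ al;
  driver_second : forall s t, 0 <= s -> s <= t -> t <= T ->
    `|XX s t| <= (om s t `^ al) ^+ 2;
  driver_chen : forall s r t, 0 <= s -> s <= r -> r <= t -> t <= T -> forall j,
    col j (XX s t) = col j (XX s r) + col j (XX r t)
      + increment X r t j 0 *: increment X s r }.

Hypotheses (T0 : 0 <= T) (al3 : 1 < 3 * al) (al2 : 2 * al <= 1).
Hypothesis driver : rough_driver.

Let w s t := om s t `^ al.
Let al0 : 0 < al. Proof. by move: al3; lra. Qed.

Lemma mulr_powR_cube x : 0 <= x -> x * x `^ (3 * al - 1) = (x `^ al) ^+ 3.
Proof.
move=> x0; rewrite mulr_powRB1//; last by move: al3; lra.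
by rewrite mulrC powRrM powR_mulrn// powR_ge0.
Qed.

(** Since [2 * al <= 1], the length of an interval is of second order in
    [om `^ al]. *)
Lemma driver_weight_bound : exists2 c, 0 <= c &
  forall s t, 0 <= s -> s <= t -> t <= T -> w s t <= c /\ t - s <= c * w s t ^+ 2.
Proof.
have omC := driver_control driver.
have W0 : 0 <= om 0 T by exact: (control_ge0 omC).
exists (om 0 T `^ al + om 0 T `^ (1 - 2 * al)); first by rewrite addr_ge0// powR_ge0.
move=> s t s0 st tT; have w0 := control_ge0 omC s0 st tT.
have wW : om s t <= om 0 T by exact: (control_mono omC).
split.
  apply: (@le_trans _ _ (om 0 T `^ al)); last by rewrite lerDl powR_ge0.
  by apply: powR_le => //; exact: ltW.
apply: le_trans (driver_length driver s0 st tT) _.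
move: (w0); rewrite le_eqVlt => /predU1P[<-|w1].
  by rewrite mulr_ge0 ?addr_ge0 ?powR_ge0// exprn_ge0// powR_ge0.
have -> : om s t = om s t `^ (1 - 2 * al) * w s t ^+ 2.
  rewrite /w -powR_mulrn ?powR_ge0// -powRrM -powRD; last by apply/implyP => _; rewrite gt_eqF.
  by rewrite (_ : 1 - 2 * al + al * 2%:R = 1) ?powRr1//; ring.
rewrite ler_wpM2r ?exprn_ge0 ?powR_ge0//.
apply: (@le_trans _ _ (om 0 T `^ (1 - 2 * al))); last by rewrite lerDr powR_ge0.
by apply: powR_le => //; rewrite subr_ge0.
Qed.

Let w_ge0 s t : 0 <= s -> s <= t -> t <= T -> 0 <= w s t.
Proof. by move=> *; exact: powR_ge0. Qed.

Let w_mono s s' t' t : 0 <= s -> s <= s' -> s' <= t' -> t' <= t -> t <= T ->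
  w s' t' <= w s t.
Proof.
move=> s0 ss st tt tT; apply: powR_le; first exact: ltW.
  by apply: (control_ge0 (driver_control driver)) => //; [exact: le_trans ss|exact: le_trans tT].
exact: (control_mono (driver_control driver)).
Qed.

Lemma four_points_bound (f : V -> 'M[R]_(n, d)) C x h x' h' : 0 <= C ->
  (forall x y, `|f x - f y| <= C * `|x - y|) ->
  (forall x y h, `|f (x + h) - f x - (f (y + h) - f y)| <= C * (`|x - y| * `|h|)) ->
  `|f (x + h) - f x - (f (x' + h') - f x')| <= C * (`|h - h'| + `|x - x'| * `|h|).
Proof.
move=> C0 f1 f2.
have -> : f (x + h) - f x - (f (x' + h') - f x') =
  (f (x' + h) - f (x' + h')) + (f (x + h) - f x - (f (x' + h) - f x')) by zmod.
apply: le_trans (ler_normD _ _) _; rewrite mulrDr lerD//.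
by have := f1 (x' + h) (x' + h'); have -> : x' + h - (x' + h') = h - h' by zmod.
Qed.

Lemma almost_flow_of_order (mu : R -> R -> V -> V) K4 : 0 <= K4 ->
  order_lip T w 1 (fun s r t y => mu s r y) ->
  order_lip T w 3 (fun s r t y => defect mu s r t y) ->
  (forall s t x h x' h', 0 <= s -> s <= t -> t <= T ->
    `|mu s t (x + h) - mu s t x - (mu s t (x' + h') - mu s t x')|
      <= K4 * w s t * (`|h - h'| + `|x - x'| * `|h|)) ->
  exists2 K, 0 <= K & almost_flow T K al (3 * al - 1) om mu.
Proof.
move=> K40 [K1 K10 K1P] [K3 K30 K3P] K4P.
have om0 := control_ge0 (driver_control driver).
exists (K1 + K3 + K4); first by rewrite !addr_ge0.
split.
- move=> s t y s0 st tT; have [h _] := K1P s t t y y s0 st (lexx t) tT.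
  apply: le_trans h _; rewrite expr1; apply: ler_wpM2r; [exact: w_ge0|lra].
- move=> s t x h x' h' s0 st tT; apply: le_trans (K4P s t x h x' h' s0 st tT) _.
  rewrite ler_wpM2r ?addr_ge0 ?mulr_ge0//; apply: ler_wpM2r; [exact: w_ge0|lra].
- move=> s r t y s0 sr rt tT; have [h _] := K3P s r t y y s0 sr rt tT.
  rewrite mulr_powR_cube; last by rewrite om0// (le_trans sr).
  apply: le_trans h _; apply: ler_wpM2r; last lra.
  by rewrite exprn_ge0// w_ge0// (le_trans sr).
- move=> s r t x y s0 sr rt tT; have [_ h] := K3P s r t x y s0 sr rt tT.
  rewrite mulr_powR_cube; last by rewrite om0// (le_trans sr).
  apply: le_trans h _; rewrite ler_wpM2r//; apply: ler_wpM2r; last lra.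
  by rewrite exprn_ge0// w_ge0// (le_trans sr).
Qed.

Theorem rough_step_flow C (sigma : R -> V -> 'M[R]_(n, d)) : 0 <= C ->
  regular_coefficient T C sigma ->
  exists2 K, 0 <= K & almost_flow T K al (3 * al - 1) om (rough_step sigma X XX).
Proof.
move=> C0 sreg; have [c c0 cP] := driver_weight_bound.
have wc s t : 0 <= s -> s <= t -> t <= T -> w s t <= c by move=> p q r; exact: (cP s t p q r).1.
have wl s t : 0 <= s -> s <= t -> t <= T -> t - s <= c * w s t ^+ 2.
  by move=> p q r; exact: (cP s t p q r).2.
have [D1 D2 D3] := And3 (driver_first driver) (driver_second driver) (driver_chen driver).
pose Cg := 4 * n%:R * C * C.
have Cg0 : 0 <= Cg by rewrite !mulr_ge0.
apply: (@almost_flow_of_order _ (d%:R * C + d%:R * (d%:R * Cg * c))).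
- by rewrite addr_ge0 ?mulr_ge0.
- exact: (order_step C0 c0 sreg w_ge0 wc w_mono D1 D2).
- exact: (order_defect C0 c0 sreg w_ge0 wc w_mono D1 D2 wl D3).
move=> s t x h x' h' s0 st tT.
have sT : 0 <= s <= T by rewrite s0 (le_trans st).
set u := `|h - h'| + `|x - x'| * `|h|.
have u0 : 0 <= u by rewrite addr_ge0// mulr_ge0.
have w0 : 0 <= w s t by exact: w_ge0.
have F1 : `|sigma s (x + h) - sigma s x - (sigma s (x' + h') - sigma s x')| <= C * u.
  apply: four_points_bound => // *; [exact: (sob_space (regular_sigma sreg))|].
  exact: (sob_space2 (regular_sigma sreg)).
pose g j y := second_coefficient sigma j s y.
have F2 j : `|g j (x + h) - g j x - (g j (x' + h') - g j x')| <= Cg * u.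
  have gS := second_coefficient_bounded C0 sreg j.
  by apply: four_points_bound => // *; [exact: (sob_space gS)|exact: (sob_space2 gS)].
have -> : rough_step sigma X XX s t (x + h) - rough_step sigma X XX s t x -
    (rough_step sigma X XX s t (x' + h') - rough_step sigma X XX s t x') =
   (sigma s (x + h) - sigma s x - (sigma s (x' + h') - sigma s x')) *m increment X s t +
   \sum_j (g j (x + h) - g j x - (g j (x' + h') - g j x')) *m col j (XX s t).
  have -> : \sum_j (g j (x + h) - g j x - (g j (x' + h') - g j x')) *m col j (XX s t) =
    \sum_j g j (x + h) *m col j (XX s t) - \sum_j g j x *m col j (XX s t) -
    (\sum_j g j (x' + h') *m col j (XX s t) - \sum_j g j x' *m col j (XX s t)).
    by rewrite -!sumrB; apply: eq_bigr => j _; rewrite !mulmxBl.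
  by rewrite !mulmxBl /rough_step; zmod.
apply: le_trans (ler_normD _ _) _; rewrite !mulrDl; apply: lerD.
  apply: le_trans (mulmx_norm_le _ _) _.
  rewrite [leRHS](_ : _ = d%:R * (C * u * w s t)); last by ring.
  by rewrite ler_wpM2l// ler_pM// D1.
apply: le_trans (ler_norm_sum _ _ _) _.
rewrite [leRHS](_ : _ = d%:R * (d%:R * (Cg * u * (c * w s t)))); last by ring.
rewrite -[X in X%:R * _](card_ord d) mulr_natl -sumr_const; apply: ler_sum => j _.
apply: le_trans (mulmx_norm_le _ _) _; rewrite ler_wpM2l// ler_pM//.
apply: le_trans (col_norm_le _ _) _; apply: le_trans (D2 _ _ s0 st tT) _.
by rewrite expr2 ler_wpM2r// wc.
Qed.

Definition integral_step (Z : R -> 'M[R]_(n, d)) (Z' : R -> 'I_d -> 'M[R]_(n, d)) s t : V :=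
  Z s *m increment X s t + \sum_j Z' s j *m col j (XX s t).

(** The germ of a rough integral is a one-step flow that ignores the state. *)
Theorem integral_step_flow M L (Z : R -> 'M[R]_(n, d)) (Z' : R -> 'I_d -> 'M[R]_(n, d)) :
  0 <= M -> 0 <= L -> (forall t, 0 <= t <= T -> `|Z t| <= M /\ forall j, `|Z' t j| <= M) ->
  (forall s t j, 0 <= s -> s <= t -> t <= T -> `|Z' t j - Z' s j| <= L * om s t `^ al) ->
  (forall s t j, 0 <= s -> s <= t -> t <= T ->
    `|remainder X (fun t => col j (Z t)) (fun t => Z' t j) s t| <= L * (om s t `^ al) ^+ 2) ->
  exists2 K, 0 <= K & almost_flow T K al (3 * al - 1) om (fun s t (_ : V) => integral_step Z Z' s t).
Proof.
move=> M0 L0 ZM Zw Rw; have [c c0 cP] := driver_weight_bound.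
have wc s t : 0 <= s -> s <= t -> t <= T -> w s t <= c by move=> p q r; exact: (cP s t p q r).1.
have [D1 D2 D3] := And3 (driver_first driver) (driver_second driver) (driver_chen driver).
have ole := @order_lip_le R T c w c0 w_ge0 wc V.
have inT s t : 0 <= s -> s <= t -> t <= T -> 0 <= s <= T.
  by move=> -> p q; rewrite (le_trans p q).
apply: (@almost_flow_of_order _ 0) => //; last first.
- by move=> *; rewrite !subrr normr0 !mul0r.
- apply: (@order_lip_ext _ T w _ _ _ (fun s r t (y : V) =>
    - (\sum_j increment X r t j 0 *: remainder X (fun t => col j (Z t)) (fun t => Z' t j) s r
       + \sum_j (Z' r j - Z' s j) *m col j (XX r t)))).
    move=> s r t y s0 sr rt tT; rewrite /defect /integral_step.
    have -> : increment X s t = increment X s r + increment X r t.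
      by rewrite /increment; zmod.
    have -> : \sum_j Z' s j *m col j (XX s t) = \sum_j Z' s j *m col j (XX s r) +
       \sum_j Z' s j *m col j (XX r t) + \sum_j increment X r t j 0 *: (Z' s j *m increment X s r).
      rewrite -!big_split/=; apply: eq_bigr => j _.
      by rewrite (D3 _ _ _ s0 sr rt tT) /increment !mulmxDr -scalemxAr mulmxDr.
    have -> : \sum_j increment X r t j 0 *: remainder X (fun t => col j (Z t)) (fun t => Z' t j) s r =
      Z r *m increment X r t - Z s *m increment X r t
      - \sum_j increment X r t j 0 *: (Z' s j *m increment X s r).
      rewrite !mulmx_sum_col -!sumrB; apply: eq_bigr => j _.
      by rewrite -!scalerBr.
    have -> : \sum_j (Z' r j - Z' s j) *m col j (XX r t) =
      \sum_j Z' r j *m col j (XX r t) - \sum_j Z' s j *m col j (XX r t).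
      by rewrite -sumrB; apply: eq_bigr => j _; rewrite mulmxBl.
    rewrite (mulmxDr (Z s) (increment X s r) (increment X r t)); zmod.
  apply: order_lip_opp; apply: order_lip_add.
    apply: order_lip_sum => j; apply: (order_lip_scale (k := 2)).
      move=> s r t s0 sr rt tT; apply: le_trans (mx_entry_le _ _ _) _.
      by apply: le_trans (D1 _ _ (le_trans s0 sr) rt tT) _; apply: w_mono.
    apply: (order_lip_const w_ge0 L0) => s r t s0 sr rt tT.
    apply: le_trans (Rw s r j s0 sr (le_trans rt tT)) _; rewrite ler_wpM2l//.
    by rewrite ler_pXn2r ?nnegrE ?powR_ge0//; apply: w_mono.
  apply: order_lip_sum => j; apply: (order_lip_mulmx w_ge0 (k := 1) (l := 2)).
    apply: (order_lip_const w_ge0 L0) => s r t s0 sr rt tT; rewrite expr1.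
    by apply: le_trans (Zw s r j s0 sr (le_trans rt tT)) _; rewrite ler_wpM2l// w_mono.
  exact: (order_lip_col j (order_second_right w_ge0 w_mono D2)).
apply: order_lip_add.
  apply: (order_lip_mulmx w_ge0 (k := 0) (l := 1)).
    apply: (order_lip_const w_ge0 M0) => s r t s0 sr rt tT; rewrite expr0 mulr1.
    exact: (ZM s (inT s t s0 (le_trans sr rt) tT)).1.
  exact: (order_increment_left w_ge0 w_mono D1).
apply: (ole); apply: order_lip_sum => j; apply: (order_lip_mulmx w_ge0 (k := 0) (l := 2)).
  apply: (order_lip_const w_ge0 M0) => s r t s0 sr rt tT; rewrite expr0 mulr1.
  exact: ((ZM s (inT s t s0 (le_trans sr rt) tT)).2 j).
exact: (order_lip_col j (order_second_left w_ge0 w_mono D2)).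
Qed.

End FlowsOfDrivers.

(** * The drift: Lebesgue measurability and integral bounds *)

Section LebesgueIntegral.
Context {R : realType}.
Notation leb := (@lebesgue R).
Notation LT := (lebesgueType R).

Lemma borel_lebesgue_measurable (A : set (measurableTypeR R)) :
  measurable A -> measurable (A : set LT).
Proof. by move=> mA; apply: sub_caratheodory; exact: mA. Qed.

Lemma interval_lebesgue_measurable (i : interval R) : measurable ([set` i] : set LT).
Proof. by apply: borel_lebesgue_measurable; exact: measurable_itv. Qed.

Lemma lebesgue_itv_oc (s t : R) : s <= t -> leb (`]s, t]%classic : set LT) = (t - s)%:E.
Proof.
move=> st; rewrite -[LHS]/(lebesgue_measure (`]s, t]%classic)) lebesgue_measure_itv/=.
rewrite lte_fin; move: st; rewrite le_eqVlt => /predU1P[->|->]; last by rewrite EFinB.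
by rewrite ltxx subrr.
Qed.

Lemma lebesgue_itv_cc (s t : R) : s <= t -> leb (`[s, t]%classic : set LT) = (t - s)%:E.
Proof.
move=> st; rewrite -[LHS]/(lebesgue_measure (`[s, t]%classic)) lebesgue_measure_itv/=.
rewrite lte_fin; move: st; rewrite le_eqVlt => /predU1P[->|->]; last by rewrite EFinB.
by rewrite ltxx subrr.
Qed.

Lemma lebesgue_aeS (P Q : R -> Prop) : (forall t, P t -> Q t) ->
  (\forall t \ae leb, P t) -> \forall t \ae leb, Q t.
Proof. by move=> PQ; apply: negligibleS => t /= nQ /PQ. Qed.

Lemma ae_bounded_integrable (D : set LT) (F : LT -> R) (C : R) : measurable D ->
  (leb D < +oo)%E -> measurable_fun D F ->
  (\forall t \ae leb, D t -> `|F t| <= C) -> leb.-integrable D (EFin \o F).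
Proof.
move=> mD Dfin mF FC; apply/integrableP; split; first exact/measurable_EFinP.
apply: (@le_lt_trans _ _ (\int[leb]_(x in D) cst (`|C|%:E) x)%E).
  have m1 : measurable_fun D (fun t => `|(EFin \o F) t|%E).
    by apply: measurableT_comp => //; exact/measurable_EFinP.
  have m2 : measurable_fun D (cst (`|C|%:E) : LT -> \bar R) by exact: measurable_cst.
  apply: (ae_ge0_le_integral mD _ m1 _ m2).
  - by move=> t _; exact: abse_ge0.
  - by move=> t _; rewrite lee_fin.
  by move: FC; apply: lebesgue_aeS => t FC Dt /=; rewrite lee_fin (le_trans (FC Dt))// ler_norm.
by rewrite integral_cst// lte_mul_pinfty.
Qed.

Lemma Rintegral_diff_le (D : set LT) (F G : LT -> R) (K : R) : measurable D -> (leb D < +oo)%E ->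
  0 <= K -> leb.-integrable D (EFin \o F) -> leb.-integrable D (EFin \o G) ->
  (\forall t \ae leb, D t -> `|F t - G t| <= K) ->
  `|Rintegral leb D F - Rintegral leb D G| <= K * fine (leb D).
Proof.
move=> mD Dfin K0 iF iG FG; rewrite -RintegralB//.
have iFG : leb.-integrable D (EFin \o (fun t => F t - G t)).
  rewrite (_ : EFin \o _ = (fun t => (EFin (F t) - EFin (G t))%E)).
    by have h := integrableB mD iF iG; exact: h.
  by apply/funext => t; rewrite /= EFinB.
apply: le_trans (le_normr_Rintegral mD iFG) _.
have Dnum : leb D \is a fin_num by rewrite ge0_fin_numE// measure_ge0.
have -> : K * fine (leb D) = fine (\int[leb]_(x in D) cst K%:E x)%E.
  by rewrite integral_cst// fineM.
have mFG : measurable_fun D (fun t => F t - G t).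
  by apply/measurable_EFinP; case/integrableP : iFG.
apply: fine_le.
- by have /integrableP[_ h] := iFG; rewrite ge0_fin_numE ?integral_ge0.
- by rewrite integral_cst// fin_numM.
have m1 : measurable_fun D (fun t => (`|F t - G t|)%:E).
  by apply/measurable_EFinP; apply: measurableT_comp.
have m2 : measurable_fun D (cst K%:E : LT -> \bar R) by exact: measurable_cst.
apply: (ae_ge0_le_integral mD _ m1 _ m2).
- by move=> t _; rewrite lee_fin.
- by move=> t _; rewrite lee_fin.
by move: FG; apply: lebesgue_aeS => t FG Dt; rewrite lee_fin; exact: FG.
Qed.

Section Increments.
Variables (T : R).
Notation D := (`[0, T]%classic : set LT).

Lemma Rintegral_increment (F : LT -> R) s t : 0 <= s -> s <= t -> t <= T ->
  leb.-integrable D (EFin \o F) ->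
  Rintegral leb (`[0, t]%classic : set LT) F - Rintegral leb (`[0, s]%classic : set LT) F =
  Rintegral leb (`]s, t]%classic : set LT) F.
Proof.
move=> s0 st tT iF.
have -> : (`[0, t]%classic : set LT) = `[0, s]%classic `|` `]s, t]%classic.
  by rewrite -itv_bndbnd_setU// bnd_simp.
rewrite Rintegral_setU.
- by rewrite addrAC subrr add0r.
- exact: interval_lebesgue_measurable.
- exact: interval_lebesgue_measurable.
- apply: integrableS iF; [exact: interval_lebesgue_measurable| |].
    by apply: measurableU; exact: interval_lebesgue_measurable.
  move=> r [] /=; rewrite !in_itv/= => /andP[r0 rs]; apply/andP; split => //.
  + exact: le_trans rs (le_trans st tT).
  + exact: le_trans s0 (ltW r0).
  + exact: le_trans rs tT.
- apply/disj_set2P/seteqP; split => // r [] /=; rewrite !in_itv/= => /andP[_ rs] /andP[sr _].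
  by move: sr; rewrite ltNge rs.
Qed.

Lemma Rintegral_increment_le (F G : LT -> R) (K s t : R) : 0 <= s -> s <= t -> t <= T ->
  0 <= K -> leb.-integrable D (EFin \o F) -> leb.-integrable D (EFin \o G) ->
  (\forall r \ae leb, s <= r <= t -> `|F r - G r| <= K) ->
  `|(Rintegral leb (`[0, t]%classic : set LT) F - Rintegral leb (`[0, s]%classic : set LT) F)
    - (Rintegral leb (`[0, t]%classic : set LT) G - Rintegral leb (`[0, s]%classic : set LT) G)|
  <= K * (t - s).
Proof.
move=> s0 st tT K0 iF iG FG.
have hF := Rintegral_increment s0 st tT iF; have hG := Rintegral_increment s0 st tT iG.
rewrite hF hG.
have -> : t - s = fine (leb (`]s, t]%classic : set LT)) by rewrite lebesgue_itv_oc.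
have sub : (`]s, t]%classic : set LT) `<=` D.
  move=> r /=; rewrite !in_itv/= => /andP[sr rt].
  by rewrite (le_trans s0 (ltW sr)) (le_trans rt tT).
have mst := interval_lebesgue_measurable `]s, t].
apply: Rintegral_diff_le => //.
- by rewrite lebesgue_itv_oc// ltry.
- by apply: integrableS iF => //; exact: interval_lebesgue_measurable.
- by apply: integrableS iG => //; exact: interval_lebesgue_measurable.
- move: FG; apply: lebesgue_aeS => r FG /=; rewrite in_itv/= => /andP[sr rt].
  by apply: FG; rewrite (ltW sr).
Qed.

End Increments.

Lemma measurable_fun_countable_pieces (D : set LT) (K : countType) (code : R -> K)
    (f : K -> R -> R) : measurable D ->
  (forall k, measurable ((D `&` [set t | code t = k]) : set LT)) ->
  (forall k, (exists2 t, D t & code t = k) -> measurable_fun D (f k : LT -> R)) ->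
  measurable_fun D ((fun t => f (code t) t) : LT -> R).
Proof.
move=> mD mcode mf _ Y mY.
rewrite (_ : D `&` _ = \bigcup_k ((D `&` [set t | code t = k]) `&` (D `&` f k @^-1` Y))); last first.
  apply/seteqP; split => [t [Dt Yt]|t [k _ [[Dt <-] [_ Yt]]]]; last by split.
  by exists (code t).
apply: countable_bigcupT_measurable; first exact: countableP.
move=> k; have [kD|nk] := pselect (exists2 t, D t & code t = k).
  by apply: measurableI => //; exact: mf.
rewrite (_ : _ `&` _ = set0)//; apply/seteqP; split => // t [[Dt tk] _].
by apply: nk; exists t.
Qed.

(** Set to zero where they fail to converge, the functions converge everywhere;
    this changes them on a null set, and the Lebesgue measure is complete. *)
Lemma ae_measurable_limit (D : set LT) (h : nat -> LT -> R) (f : LT -> R) : measurable D ->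
  (forall k, measurable_fun D (h k)) ->
  (\forall t \ae leb, D t -> h ^~ t @ \oo --> f t) -> measurable_fun D f.
Proof.
move=> mD mh hf; pose good t := D t -> h ^~ t @ \oo --> f t.
pose cut (g : LT -> R) t := if `[< good t >] then g t else 0.
have cutE g : ae_eq leb D (EFin \o g) (EFin \o cut g).
  by move: hf; apply: lebesgue_aeS => t gt Dt; rewrite /cut /= asboolT.
have cc := @completed_lebesgue_measure_is_complete R.
have mcut k : measurable_fun D (cut (h k)).
  apply/measurable_EFinP; apply: (ae_measurable_fun cc (cutE (h k))).
  exact/measurable_EFinP.
apply/measurable_EFinP; apply: (ae_measurable_fun cc (ae_eq_sym (cutE f))).
apply/measurable_EFinP; apply: (measurable_fun_cvg (h := fun k => cut (h k))) => // t Dt.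
rewrite /cut; case: asboolP => [gt|_]; first exact: gt.
exact: cvg_cst.
Qed.

Lemma continuous_lebesgue_measurable (a b : R) (f : R -> R) :
  {within `[a, b], continuous f} ->
  measurable_fun (`[a, b]%classic : set LT) (f : LT -> R).
Proof.
move=> fC _ Y mY; apply: borel_lebesgue_measurable.
exact: (subspace_continuous_measurable_fun (measurable_itv _) fC).
Qed.

End LebesgueIntegral.

Section Caratheodory.
Context {R : realType} {n m : nat}.
Notation LT := (lebesgueType R).
Notation leb := (@lebesgue R).
Variables (T : R) (U : set 'cV[R]_m) (u : R -> 'cV[R]_m).
Variable b : R -> 'cV[R]_n -> 'cV[R]_m -> 'cV[R]_n.
Hypothesis uU : forall t, 0 <= t <= T -> U (u t).
Hypothesis mu_ : lebesgue_measurable_mx `[0, T] u.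
Hypothesis b_measurable : forall x v, U v ->
  lebesgue_measurable_mx `[0, T] (fun t => b t x v).
Hypothesis b_continuous : \forall t \ae lebesgue, t \in `[0, T] ->
  {within [set z : 'cV[R]_n * 'cV[R]_m | U z.2], continuous (fun z => b t z.1 z.2)}.
Notation D := (`[0, T]%classic : set LT).

Let coord (Y : R -> 'cV[R]_n) (i : 'I_n + 'I_m) t : R :=
  match i with inl i => Y t i 0 | inr j => u t j 0 end.

Let code Y (k : nat) t : {ffun ('I_n + 'I_m)%type -> int} :=
  [ffun i => Num.floor (k.+1%:R * coord Y i t)].

Lemma same_code_close Y k t t' i : code Y k t = code Y k t' ->
  `|coord Y i t - coord Y i t'| <= k.+1%:R^-1.
Proof.
move=> /ffunP/(_ i); rewrite !ffunE => e.
have k0 : 0 < k.+1%:R :> R by [].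
have /andP[a1 a2] := floor_itv (k.+1%:R * coord Y i t).
have /andP[a3 a4] := floor_itv (k.+1%:R * coord Y i t').
rewrite -e in a3 a4; rewrite intrD in a2 a4.
rewrite -[leRHS]mul1r ler_pdivlMr// -[X in _ * X]gtr0_norm// -normrM mulrBl.
rewrite ![_ * k.+1%:R]mulrC ler_norml.
by apply/andP; split; lra.
Qed.

(** Composition of a Caratheodory map with measurable paths: on the set where
    the floors of all scaled coordinates take given values the paths are frozen
    at their value at one time of that set, so that the second argument stays in
    [U]; the frozen maps are measurable and converge almost everywhere. *)
Lemma caratheodory_measurable (Y : R -> 'cV[R]_n) :
  {within `[0, T], continuous Y} ->
  lebesgue_measurable_mx `[0, T] (fun t => b t (Y t) (u t)).
Proof.
move=> Yc i j.
have mD : measurable D by exact: interval_lebesgue_measurable.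
have mcoord q : measurable_fun D (coord Y q : LT -> R).
  case: q => [q|q] /=; last exact: mu_.
  by apply: continuous_lebesgue_measurable; exact: within_continuous_entry.
have mcode k c : measurable ((D `&` [set t | code Y k t = c]) : set LT).
  rewrite (_ : _ `&` _ = D `&` \bigcap_(q in [set: 'I_n + 'I_m])
     (D `&` coord Y q @^-1` `[(c q)%:~R / k.+1%:R, (c q + 1)%:~R / k.+1%:R[)).
    apply: measurableI => //; apply: fin_bigcap_measurable; first exact: finite_finset.
    by move=> q _; apply: mcoord => //; exact: measurable_itv.
  have k0 : 0 < k.+1%:R :> R by [].
  apply/seteqP; split => t [Dt].
    move=> <-; split=> // q _; split=> //=.
    rewrite in_itv/= ler_pdivrMr// ltr_pdivlMr// mulrC ffunE; exact: floor_itv.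
  move=> H; split=> //=; apply/ffunP => q; rewrite ffunE; apply: floor_def.
  have [_ /=] := H q I.
  by rewrite in_itv/= ler_pdivrMr// ltr_pdivlMr// mulrC.
pose rep k c := xget 0 [set t | D t /\ code Y k t = c].
have repP k t : D t -> D (rep k (code Y k t)) /\ code Y k (rep k (code Y k t)) = code Y k t.
  by move=> Dt; rewrite /rep; case: xgetP => [x -> [] //|/(_ t)[]].
pose f k t := b t (Y (rep k (code Y k t))) (u (rep k (code Y k t))) i j.
apply: (@ae_measurable_limit _ _ (fun k => f k : LT -> R)) => //.
  move=> k; have mp := @measurable_fun_countable_pieces R D _ (code Y k)
    (fun c t => b t (Y (rep k c)) (u (rep k c)) i j) mD (mcode k).
  apply: mp => c [t Dt tc]; apply: b_measurable; apply: uU.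
  by have [] := repP k t Dt; rewrite tc /= in_itv.
move: b_continuous; apply: lebesgue_aeS => t bc Dt.
have Dt' : t \in `[0, T] by [].
have tT : 0 <= t <= T by move: Dt'; rewrite in_itv.
have {}bc := (within_continuous_ballP _ _).1 (bc Dt') (Y t, u t) (uU tT).
apply/cvgrPdist_le => e e0; have [h h0 hP] := bc e e0.
have := near_infty_natSinv_lt (PosNum h0); apply: filterS => k /= kh.
have [Dr cr] := repP k t Dt.
have rT : 0 <= rep k (code Y k t) <= T by move: Dr; rewrite /= in_itv.
set r := rep k (code Y k t) in cr Dr rT *.
have close q : `|coord Y q t - coord Y q r| < h.
  by apply: le_lt_trans kh; exact: same_code_close (esym cr).
have := hP (Y r, u r) (uU rT) _.
have h1 := mx_entryB_le (b t (Y t) (u t)) (b t (Y r) (u r)) i j.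
move=> H; apply: le_trans h1 (H _); split => /=.
  by split=> // q z; rewrite (ord1 z) -ball_normE; exact: (close (inl q)).
by split=> // q z; rewrite (ord1 z) -ball_normE; exact: (close (inr q)).
Qed.

Variable C_b : R.
Hypothesis hC_b : 0 <= C_b.
Hypothesis b_bounded_lipschitz : \forall t \ae lebesgue, t \in `[0, T] ->
  forall (x x' : 'cV[R]_n) (v : 'cV[R]_m), U v ->
  `|b t x v| <= C_b /\ `|b t x v - b t x' v| <= C_b * `|x - x'|.
Hypothesis T0 : 0 <= T.

Definition drift_integral (Y : R -> 'cV[R]_n) t := integral_mx `[0, t] (fun s => b s (Y s) (u s)).

Lemma drift_integrable Y i j : {within `[0, T], continuous Y} ->
  leb.-integrable D (EFin \o (fun t => b t (Y t) (u t) i j)).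
Proof.
move=> Yc; apply: (@ae_bounded_integrable _ _ _ C_b).
- exact: interval_lebesgue_measurable.
- by rewrite lebesgue_itv_cc// ltry.
- exact: caratheodory_measurable.
move: b_bounded_lipschitz; apply: lebesgue_aeS => t H Dt.
have tT : 0 <= t <= T by move: Dt; rewrite /= in_itv.
by apply: le_trans (mx_entry_le _ _ _) _; have [] := H Dt (Y t) (Y t) (u t) (uU tT).
Qed.

Lemma drift_integral_lip Y1 Y2 s t e : {within `[0, T], continuous Y1} ->
  {within `[0, T], continuous Y2} -> 0 <= s -> s <= t -> t <= T -> 0 <= e ->
  (forall r, s <= r <= t -> `|Y1 r - Y2 r| <= e) ->
  `|increment (drift_integral Y1) s t - increment (drift_integral Y2) s t|
    <= C_b * e * (t - s).
Proof.
move=> Y1c Y2c s0 st tT e0 Y12; apply: mx_norm_le => [|i j].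
  by rewrite !mulr_ge0// subr_ge0.
rewrite !mxE; apply: (Rintegral_increment_le (T := T)) => //.
- exact: mulr_ge0.
- exact: drift_integrable.
- exact: drift_integrable.
move: b_bounded_lipschitz; apply: lebesgue_aeS => r H /[dup] srt /andP[sr rt].
have rT : 0 <= r <= T by rewrite (le_trans s0 sr) (le_trans rt tT).
have Dr : r \in `[0, T] by rewrite in_itv.
have [_ h] := H Dr (Y1 r) (Y2 r) (u r) (uU rT).
by have h1 := le_trans (mx_entryB_le _ _ i j) h; apply: (le_trans h1); rewrite ler_wpM2l// Y12.
Qed.

Lemma drift_integral_bound Y s t : {within `[0, T], continuous Y} ->
  0 <= s -> s <= t -> t <= T ->
  `|increment (drift_integral Y) s t| <= C_b * (t - s).
Proof.
move=> Yc s0 st tT; apply: mx_norm_le => [|i j].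
  by rewrite mulr_ge0// subr_ge0.
have z r : Rintegral leb (`[0, r]%classic : set LT) (fun=> 0) = 0.
  by rewrite /Rintegral integral0.
have := @Rintegral_increment_le R T (fun t => b t (Y t) (u t) i j) (fun=> 0) C_b s t s0 st tT hC_b.
rewrite !z !subr0 !mxE; apply; first exact: drift_integrable.
  by apply: integrable0.
move: b_bounded_lipschitz; apply: lebesgue_aeS => r H /andP[sr rt].
have rT : 0 <= r <= T by rewrite (le_trans s0 sr) (le_trans rt tT).
have Dr : r \in `[0, T] by rewrite in_itv.
have [h _] := H Dr (Y r) (Y r) (u r) (uU rT).
by rewrite subr0; apply: le_trans h; exact: mx_entry_le.
Qed.

(** With the state frozen the drift is additive in time and Lipschitz in the
    state. *)
Definition frozen_drift s t x := increment (drift_integral (fun=> x)) s t.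

Lemma frozen_drift_drift om : control T om ->
  (forall s t, 0 <= s -> s <= t -> t <= T -> t - s <= om s t) ->
  drift T C_b om frozen_drift.
Proof.
move=> omC len.
have cc (x : 'cV[R]_n) : {within `[0, T], continuous (fun=> x)}.
  by move=> ?; exact: cvg_cst.
split.
- by move=> s r t y _ _ _ _; rewrite /frozen_drift /increment; zmod.
- move=> s t y s0 st tT; apply: le_trans (drift_integral_bound (cc y) s0 st tT) _.
  by rewrite ler_wpM2l// len.
move=> s t x y s0 st tT.
apply: le_trans (@drift_integral_lip _ _ s t `|x - y| (cc x) (cc y) s0 st tT (normr_ge0 _) _) _.
  by [].
by rewrite mulrAC ler_wpM2r// ler_wpM2l// len.
Qed.

Lemma drift_integral_frozen Y s t e : {within `[0, T], continuous Y} ->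
  0 <= s -> s <= t -> t <= T -> 0 <= e ->
  (forall r, s <= r <= t -> `|Y r - Y s| <= e) ->
  `|increment (drift_integral Y) s t - frozen_drift s t (Y s)| <= C_b * e * (t - s).
Proof.
move=> Yc s0 st tT e0 Ye; apply: drift_integral_lip => //.
by move=> ?; exact: cvg_cst.
Qed.

End Caratheodory.

(** * Controlled paths and rough integrals *)

Section PathControls.
Context {R : realType}.

Lemma finite_variation_small_control_root (T q be : R) a : 0 <= T -> 0 < q -> 0 < be -> q * be < 1 ->
  (forall s t, 0 <= s -> s <= t -> t <= T -> 0 <= a s t) ->
  (forall e, 0 < e -> exists2 h, 0 < h &
    forall s t, 0 <= s -> s <= t -> t <= T -> t - s <= h -> a s t <= e) ->
  finite_variation T q a ->
  exists2 om, control T om &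
    forall s t, 0 <= s -> s <= t -> t <= T -> a s t <= om s t `^ be.
Proof.
move=> T0 q0 be0 qbe a0 asmall fa.
have qq : q < be^-1 by rewrite -[ltRHS]mul1r ltr_pdivlMr.
have [om omC omP] := finite_variation_small_control T0 q0 qq a0 asmall fa.
exists om => // s t s0 st tT; have a0' := a0 s t s0 st tT.
have -> : a s t = (a s t `^ be^-1) `^ be by rewrite -powRrM mulVf ?gt_eqF// powRr1.
by apply: powR_le (ltW be0) (powR_ge0 _ _) (omP s t s0 st tT).
Qed.

Lemma increment_finite_variation (E : normedModType R) (p T : R) (Y : R -> E) : 0 < p -> 0 <= T ->
  (variation_norm p (increment Y) 0 T < +oo)%E <->
  finite_variation T p (fun s t => `|increment Y s t|).
Proof.
by move=> p0 T0; apply: variation_norm_finiteP => // s _ _; rewrite /increment subrr.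
Qed.

Lemma path_uniformly_continuous (E : normedModType R) (T : R) (Y : R -> E) :
  {within `[0, T], continuous Y} -> forall e, 0 < e -> exists2 h, 0 < h &
  forall s t, 0 <= s -> s <= t -> t <= T -> t - s <= h -> `|increment Y s t| <= e.
Proof.
move=> Yc e e0; have cK : compact (`[0, T]%classic : set R) by exact: segment_compact.
have [h h0 hP] := compact_uniformly_continuous cK Yc e0.
exists (h / 2); first by rewrite divr_gt0.
move=> s t s0 st tT ts; rewrite distrC; apply: hP.
- by rewrite /= in_itv/= s0 (le_trans st).
- by rewrite /= in_itv/= tT (le_trans s0).
rewrite -ball_normE/= distrC ger0_norm ?subr_ge0//; apply: le_lt_trans ts _.
by rewrite ltr_pdivrMr// ltr_pMr//; lra.
Qed.

Lemma path_bounded (E : normedModType R) (T : R) (Y : R -> E) :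
  {within `[0, T], continuous Y} -> exists2 M, 0 <= M & forall t, 0 <= t <= T -> `|Y t| <= M.
Proof.
move=> Yc; have cK : compact (`[0, T]%classic : set R) by exact: segment_compact.
have [M [_ MP]] := compact_bounded (continuous_compact Yc cK).
exists (`|M| + 1); first by rewrite addr_ge0.
move=> t tT; apply: (MP (`|M| + 1)); last by exists t => //=; rewrite in_itv.
by rewrite (le_lt_trans (ler_norm M))// ltrDl.
Qed.

(** What is Lipschitz in time and in the values of a path of finite variation
    has finite variation: this covers the coefficients along a solution. *)
Lemma Cvar_of_increments (E F : normedModType R) (p T C : R) (W : R -> E) (Y : R -> F) :
  0 <= T -> 1 <= p -> 0 <= C -> Cvar p T Y ->
  (forall s t, 0 <= s <= T -> 0 <= t <= T -> `|W t - W s| <= C * (`|t - s| + `|Y t - Y s|)) ->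
  Cvar p T W.
Proof.
move=> T0 p1 C0 [Yc Yv] WY; have p0 : 0 < p by exact: lt_le_trans p1.
split.
  apply/within_continuous_ballP => x Dx e e0.
  have xT : 0 <= x <= T by move: Dx; rewrite /= in_itv.
  have e1 : 0 < e / (2 * (C + 1)) by rewrite divr_gt0// mulr_gt0// ltr_wpDl.
  have [h h0 hP] := (within_continuous_ballP _ _).1 Yc x Dx _ e1.
  exists (Num.min h (e / (2 * (C + 1)))); first by rewrite lt_min h0.
  move=> y Dy xy; have yT : 0 <= y <= T by move: Dy; rewrite /= in_itv.
  have xyh : ball x h y by apply: le_ball xy; rewrite ge_min lexx.
  have xye : `|x - y| <= e / (2 * (C + 1)).
    move: xy; rewrite -ball_normE/= => /ltW/le_trans; apply.
    by rewrite ge_min lexx orbT.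
  apply: le_trans (WY y x yT xT) _.
  apply: le_trans (ler_wpM2l C0 (lerD xye (hP y Dy xyh))) _.
  have -> : C * (e / (2 * (C + 1)) + e / (2 * (C + 1))) = e * (C / (C + 1)).
    by field; rewrite gt_eqF// ltr_wpDl.
  by rewrite ler_piMr ?(ltW e0)// ler_pdivrMr ?mul1r ?lerDl// ltr_wpDl.
apply/increment_finite_variation => //.
have fY := (increment_finite_variation Y p0 T0).1 Yv.
have len0 (s t : R) : 0 <= s -> s <= t -> t <= T -> 0 <= t - s by rewrite subr_ge0.
apply: (finite_variation_le (ltW p0)
  (finite_variation_scale (ltW p0) C0 _ (finite_variation_add (ltW p0) len0 _
    (finite_variation_length T p1) fY))) => //.
  by move=> s t s0 st tT; rewrite addr_ge0// subr_ge0.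
move=> s t s0 st tT; rewrite normr_ge0/= -[X in _ * (X + _)]ger0_norm ?subr_ge0//.
by apply: WY; [rewrite s0 (le_trans st)|rewrite tT (le_trans s0)].
Qed.

End PathControls.

Section ControlledPaths.
Context {R : realType} {n d : nat}.
Notation V := 'cV[R]_n.
Variables (p T al : R) (X : R -> 'cV[R]_d) (XX : R -> R -> 'M[R]_d).
Hypotheses (T0 : 0 < T) (p2 : 2 <= p) (al3 : 1 < 3 * al) (al2 : 2 * al <= 1)
  (pal : p * al < 1).
Hypothesis rp : rough_path p T X XX.

Let p0 : 0 < p. Proof. exact: lt_le_trans p2. Qed.
Let p1 : 1 <= p. Proof. by apply: le_trans p2; rewrite ler1n. Qed.
Let ph0 : 0 < p / 2. Proof. by rewrite divr_gt0. Qed.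
Let ph1 : 1 <= p / 2. Proof. by rewrite ler_pdivlMr// mul1r. Qed.
Let al0 : 0 < al. Proof. by move: al3; lra. Qed.
Let T0' : 0 <= T. Proof. exact: ltW. Qed.

Lemma rough_path_chen s r t : 0 <= s -> s <= r -> r <= t -> t <= T -> forall j,
  col j (XX s t) = col j (XX s r) + col j (XX r t) + increment X r t j 0 *: increment X s r.
Proof.
move=> s0 sr rt tT j; case: rp => _ _ _ chen; apply/matrixP => i q.
have sin : s \in `[0, T] by rewrite in_itv/= s0 (le_trans sr (le_trans rt tT)).
have rin : r \in `[0, T] by rewrite in_itv/= (le_trans s0 sr) (le_trans rt tT).
have tin : t \in `[0, T] by rewrite in_itv/= tT (le_trans s0 (le_trans sr rt)).
have := chen i j s r t sin rin tin; rewrite /increment !mxE (ord1 q) => ->.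
by rewrite [X in _ + X]mulrC.
Qed.

Lemma rough_path_diag s : 0 <= s -> s <= T -> XX s s = 0.
Proof.
move=> s0 sT; case: rp => _ _ _ chen; apply/matrixP => i j.
have sin : s \in `[0, T] by rewrite in_itv/= s0.
have := chen i j s s s sin sin sin; rewrite /increment !mxE subrr mul0r addr0.
by move/eqP; rewrite -subr_eq0 opprD addrA subrr add0r oppr_eq0 => /eqP.
Qed.

Lemma second_small e : 0 < e -> exists2 h, 0 < h &
  forall s t, 0 <= s -> s <= t -> t <= T -> t - s <= h -> `|XX s t| <= e.
Proof.
move=> e0; case: rp => _ XXc _ _.
have cT : compact (`[0, T]%classic : set R) by exact: segment_compact.
have [h h0 hP] := compact_uniformly_continuous (compact_setX cT cT) XXc e0.
exists (h / 2); first by rewrite divr_gt0.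
move=> s t s0 st tT ts.
have sin : `[0, T]%classic s by rewrite /= in_itv/= s0 (le_trans st).
have tin : `[0, T]%classic t by rewrite /= in_itv/= tT (le_trans s0).
have sT : s <= T by exact: le_trans tT.
have := hP (s, s) (s, t) (conj sin sin) (conj sin tin).
rewrite /= rough_path_diag// sub0r normrN; apply; split; first exact: ballxx.
rewrite -ball_normE/= distrC ger0_norm ?subr_ge0//; apply: le_lt_trans ts _.
by rewrite ltr_pdivrMr// ltr_pMr//; lra.
Qed.

Lemma second_finite_variation : finite_variation T (p / 2) (fun s t => `|XX s t|).
Proof.
case: rp => _ _ XXv _; apply/(variation_norm_finiteP ph0 T0') => //.
exact: rough_path_diag.
Qed.

Lemma rough_driver_add om om' : rough_driver T al om X XX -> control T om' ->
  rough_driver T al (fun s t => om s t + om' s t) X XX.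
Proof.
move=> [c l f s ch] c'; have w0 := control_ge0 c; have w0' := control_ge0 c'.
have le u v : 0 <= u -> u <= v -> v <= T -> om u v `^ al <= (om u v + om' u v) `^ al.
  by move=> *; apply: powR_le; rewrite ?w0// ?(ltW al0)// lerDl w0'.
split=> //.
- exact: control_add.
- by move=> u v *; apply: le_trans (l u v _ _ _) _ => //; rewrite lerDl w0'.
- by move=> u v *; apply: le_trans (f u v _ _ _) _ => //; exact: le.
move=> u v u0 uv vT; apply: le_trans (s u v u0 uv vT) _.
by rewrite ler_pXn2r ?nnegrE ?powR_ge0// le.
Qed.

(** One control at exponent [1 / al > p] for each level, and the length. *)
Lemma rough_path_driver : exists om, rough_driver T al om X XX.
Proof.
case: (rp) => -[Xc Xv] _ _ _.
have [om1 c1 h1] := finite_variation_small_control_root T0' p0 al0 pal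
  (fun s t _ _ _ => normr_ge0 (increment X s t)) (path_uniformly_continuous Xc)
  ((increment_finite_variation X p0 T0').1 Xv).
have al20 : 0 < 2 * al by rewrite mulr_gt0.
have pal2 : p / 2 * (2 * al) < 1 by rewrite mulrA divfK.
have [om2 c2 h2] := finite_variation_small_control_root T0' ph0 al20 pal2
  (fun s t _ _ _ => normr_ge0 (XX s t)) second_small second_finite_variation.
have cl := control_length T.
exists (fun s t => om1 s t + om2 s t + (t - s)).
have g1 := control_ge0 c1; have g2 := control_ge0 c2.
have st0 (s t : R) : s <= t -> 0 <= t - s by rewrite subr_ge0.
split.
- by apply: control_add => //; exact: control_add.
- by move=> s t *; rewrite lerDr addr_ge0 ?g1 ?g2.
- move=> s t *; apply: le_trans (h1 s t _ _ _) _ => //.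
  by apply: powR_le; rewrite ?(ltW al0) ?g1// -addrA lerDl addr_ge0 ?g2 ?st0.
- move=> s t *; apply: le_trans (h2 s t _ _ _) _ => //.
  rewrite -powR_mulrn ?powR_ge0// -powRrM [al * _]mulrC.
  apply: powR_le; rewrite ?(ltW al20) ?g2// -addrA addrCA lerDl addr_ge0 ?g1 ?st0//.
exact: rough_path_chen.
Qed.

Record path_control (Y : R -> V) (Y' : R -> 'M[R]_(n, d)) om : Prop := PathControl {
  path_driver : rough_driver T al om X XX;
  path_increment : forall s t, 0 <= s -> s <= t -> t <= T ->
    `|increment Y s t| <= om s t `^ al;
  path_remainder : forall s t, 0 <= s -> s <= t -> t <= T ->
    `|remainder X Y Y' s t| <= (om s t `^ al) ^+ 2 }.

Lemma remainder_small (Y : R -> V) (Y' : R -> 'M[R]_(n, d)) : controlled p T X Y Y' ->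
  forall e, 0 < e -> exists2 h, 0 < h &
  forall s t, 0 <= s -> s <= t -> t <= T -> t - s <= h -> `|remainder X Y Y' s t| <= e.
Proof.
move=> [[Yc _] [Yc' _] _] e e0; case: (rp) => -[Xc _] _ _ _.
have [M M0 MP] := path_bounded Yc'.
have e1 : 0 < e / 2 by rewrite divr_gt0.
have dM : 0 < d%:R * M + 1 by rewrite ltr_wpDl// mulr_ge0.
have e2 : 0 < e / 2 / (d%:R * M + 1) by rewrite divr_gt0.
have [h1 h10 h1P] := path_uniformly_continuous Yc e1.
have [h2 h20 h2P] := path_uniformly_continuous Xc e2.
exists (Num.min h1 h2); first by rewrite lt_min h10.
move=> s t s0 st tT; rewrite le_min => /andP[t1 t2].
have sT : 0 <= s <= T by rewrite s0 (le_trans st).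
apply: le_trans (ler_normB _ _) _; rewrite (splitr e); apply: lerD; first exact: h1P.
apply: le_trans (mulmx_norm_le _ _) _.
apply: (@le_trans _ _ (d%:R * (M * (e / 2 / (d%:R * M + 1))))).
  by rewrite ler_wpM2l// ler_pM// ?MP// h2P.
have -> : d%:R * (M * (e / 2 / (d%:R * M + 1))) = e / 2 * (d%:R * M / (d%:R * M + 1)) by ring.
by rewrite ler_piMr ?(ltW e1)// ler_pdivrMr// mul1r lerDl.
Qed.

Lemma remainder_diag (Y : R -> V) (Y' : R -> 'M[R]_(n, d)) s : remainder X Y Y' s s = 0.
Proof. by rewrite /remainder /increment !subrr mulmx0 subr0. Qed.

Lemma controlled_path_control (Y : R -> V) (Y' : R -> 'M[R]_(n, d)) om0 : controlled p T X Y Y' ->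
  rough_driver T al om0 X XX -> exists2 om, path_control Y Y' om &
    forall s t, 0 <= s -> s <= t -> t <= T -> om0 s t <= om s t.
Proof.
move=> cY dr; have [[Yc Yv] _ Rv] := cY.
have [om1 c1 h1] := finite_variation_small_control_root T0' p0 al0 pal
  (fun s t _ _ _ => normr_ge0 (increment Y s t)) (path_uniformly_continuous Yc)
  ((increment_finite_variation Y p0 T0').1 Yv).
have al20 : 0 < 2 * al by rewrite mulr_gt0.
have pal2 : p / 2 * (2 * al) < 1 by rewrite mulrA divfK.
have Rf : finite_variation T (p / 2) (fun s t => `|remainder X Y Y' s t|).
  by apply/(variation_norm_finiteP ph0 T0') => // s _ _; exact: remainder_diag.
have [om2 c2 h2] := finite_variation_small_control_root T0' ph0 al20 pal2
  (fun s t _ _ _ => normr_ge0 (remainder X Y Y' s t)) (remainder_small cY) Rf.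
have g0 := control_ge0 (driver_control dr).
have g1 := control_ge0 c1; have g2 := control_ge0 c2.
exists (fun s t => om0 s t + (om1 s t + om2 s t)); last first.
  by move=> s t *; rewrite lerDl addr_ge0 ?g1 ?g2.
split.
- by apply: rough_driver_add => //; exact: control_add.
- move=> s t *; apply: le_trans (h1 s t _ _ _) _ => //.
  by apply: powR_le; rewrite ?(ltW al0) ?g1// addrCA lerDl addr_ge0 ?g0 ?g2.
move=> s t *; apply: le_trans (h2 s t _ _ _) _ => //.
rewrite -powR_mulrn ?powR_ge0// -powRrM [al * _]mulrC.
by apply: powR_le; rewrite ?(ltW al20) ?g2// addrA lerDr addr_ge0 ?g0 ?g1.
Qed.

Section Composition.
Variables (C : R) (sigma : R -> V -> 'M[R]_(n, d)).
Hypotheses (C0 : 0 <= C) (sreg : regular_coefficient T C sigma).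
Variables (Y : R -> V) (Y' : R -> 'M[R]_(n, d)).
Hypothesis Y'E : forall t, 0 <= t <= T -> Y' t = sigma t (Y t).

Lemma sob_along a b K (f : R -> V -> 'M[R]_(a, b)) : 0 <= K -> second_order_bounded T K f ->
  forall s t, 0 <= s <= T -> 0 <= t <= T ->
  `|f t (Y t) - f s (Y s)| <= K * (`|t - s| + `|Y t - Y s|).
Proof.
move=> K0 fS s t sT tT.
have -> : f t (Y t) - f s (Y s) = (f t (Y t) - f s (Y t)) + (f s (Y t) - f s (Y s)) by zmod.
apply: le_trans (ler_normD _ _) _; rewrite mulrDr; apply: lerD.
  exact: (sob_time fS).
exact: (sob_space fS).
Qed.

Let Cg := 4 * n%:R * C * C.
Let Cg0 : 0 <= Cg. Proof. by rewrite !mulr_ge0. Qed.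

Lemma sigma_along'E t j : 0 <= t <= T ->
  sigma_along' sigma Y Y' t j = second_coefficient sigma j t (Y t).
Proof. by move=> tT; rewrite /sigma_along' Y'E. Qed.

Lemma composition_increment s t j : 0 <= s <= T -> 0 <= t <= T ->
  `|sigma_along' sigma Y Y' t j - sigma_along' sigma Y Y' s j|
   <= Cg * (`|t - s| + `|Y t - Y s|).
Proof.
move=> sT tT; rewrite !sigma_along'E//.
exact: (sob_along Cg0 (second_coefficient_bounded C0 sreg j)).
Qed.

Let CR := C + C + n%:R * C.
Let CR0 : 0 <= CR. Proof. by rewrite !addr_ge0// mulr_ge0. Qed.

(** The chain rule for controlled paths: the remainder of the composition is a
    time increment, a first order Taylor remainder in the increment of [Y], and
    the Jacobian matrix applied to the remainder of [Y]. *)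
Lemma composition_remainder s t j : 0 <= s -> s <= t -> t <= T ->
  `|remainder X (fun t => col j (sigma_along sigma Y t))
      (fun t => sigma_along' sigma Y Y' t j) s t|
   <= CR * ((t - s) + `|increment Y s t| ^+ 2 + `|remainder X Y Y' s t|).
Proof.
move=> s0 st tT.
have sT : 0 <= s <= T by rewrite s0 (le_trans st).
have tT' : 0 <= t <= T by rewrite tT (le_trans s0).
set h := increment Y s t.
have Yt : Y t = Y s + h by rewrite /h /increment; zmod.
have -> : remainder X (fun t => col j (sigma_along sigma Y t))
      (fun t => sigma_along' sigma Y Y' t j) s t =
   col j (sigma t (Y t) - sigma s (Y t)) + taylor_col sigma j s (Y s) h
   + nabla_x sigma s (Y s) j *m remainder X Y Y' s t.
  rewrite colB /taylor_col -Yt /remainder -/h (mulmxBr (nabla_x sigma s (Y s) j) h) mulmxA /sigma_along' /sigma_along {1}/increment.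
  by zmod.
have a1 : `|col j (sigma t (Y t) - sigma s (Y t))| <= C * (t - s).
  apply: le_trans (col_norm_le _ _) _; apply: le_trans (sob_time (regular_sigma sreg) _ sT tT') _.
  by rewrite ger0_norm ?subr_ge0.
have a2 : `|taylor_col sigma j s (Y s) h| <= C * `|h| ^+ 2.
  exact: taylor_col_le sreg sT.
have a3 : `|nabla_x sigma s (Y s) j *m remainder X Y Y' s t| <= n%:R * C * `|remainder X Y Y' s t|.
  apply: le_trans (mulmx_norm_le _ _) _; rewrite -mulrA ler_wpM2l// ler_wpM2r//.
  exact: (sob_bounded (regular_nabla sreg j)).
have st0 : 0 <= t - s by rewrite subr_ge0.
have h20 : 0 <= `|h| ^+ 2 by exact: exprn_ge0.
apply: le_trans (ler_normD _ _) _.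
apply: le_trans (lerD (le_trans (ler_normD _ _) (lerD a1 a2)) a3) _.
rewrite /CR; set r := `|remainder _ _ _ _ _|.
have r0 : 0 <= r by exact: normr_ge0.
have nC : 0 <= n%:R * C by rewrite mulr_ge0.
rewrite -subr_ge0 [leRHS](_ : _ = (C + n%:R * C) * (t - s) + (C + n%:R * C) * `|h| ^+ 2 + (C + C) * r); last by ring.
by rewrite !addr_ge0// mulr_ge0// addr_ge0.
Qed.

Lemma composition_controlled : controlled p T X Y Y' ->
  controlled_mx p T X (sigma_along sigma Y) (sigma_along' sigma Y Y').
Proof.
move=> [cY _ Rv] j; split.
- apply: (Cvar_of_increments T0' p1 C0 cY) => s t sT tT.
  rewrite -colB; apply: le_trans (col_norm_le _ _) _.
  exact: (sob_along C0 (regular_sigma sreg)).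
- by apply: (Cvar_of_increments T0' p1 Cg0 cY) => s t sT tT; exact: composition_increment.
apply/(variation_norm_finiteP ph0 T0').
  by move=> s _ _; rewrite /remainder /increment !subrr mulmx0 subr0.
have fY := (increment_finite_variation Y p0 T0').1 cY.2.
have fR : finite_variation T (p / 2) (fun s t => `|remainder X Y Y' s t|).
  by apply/(variation_norm_finiteP ph0 T0') => // s _ _; exact: remainder_diag.
have len0 (s t : R) : 0 <= s -> s <= t -> t <= T -> 0 <= t - s by rewrite subr_ge0.
have ph := ltW ph0.
have f1 : finite_variation T (p / 2) (fun s t => (t - s) + `|increment Y s t| ^+ 2).
  have Y0 (s t : R) : 0 <= s -> s <= t -> t <= T -> 0 <= `|increment Y s t| by [].
  have Y20 (s t : R) : 0 <= s -> s <= t -> t <= T -> 0 <= `|increment Y s t| ^+ 2.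
    by move=> *; exact: exprn_ge0.
  exact: (finite_variation_add ph len0 Y20 (finite_variation_length T ph1)
    (finite_variation_sqr Y0 fY)).
have pos1 (s t : R) : 0 <= s -> s <= t -> t <= T -> 0 <= (t - s) + `|increment Y s t| ^+ 2.
  by move=> s0 st tT; rewrite addr_ge0 ?exprn_ge0 ?len0.
apply: (finite_variation_le ph (finite_variation_scale ph CR0 _
  (finite_variation_add ph pos1 _ f1 fR))) => //.
  by move=> s t s0 st tT; rewrite addr_ge0// pos1.
by move=> s t s0 st tT; rewrite normr_ge0/=; exact: composition_remainder.
Qed.

Lemma composition_flow om : path_control Y Y' om ->
  exists2 K, 0 <= K & almost_flow T K al (3 * al - 1) om
    (fun s t (_ : V) => integral_step X XX (sigma_along sigma Y) (sigma_along' sigma Y Y') s t).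
Proof.
move=> [dr Yw Rw]; have [c c0 cP] := driver_weight_bound T0' al3 al2 dr.
have L0 : 0 <= Cg * (c * c + 1) + CR * (c + 1 + 1).
  by rewrite addr_ge0// mulr_ge0// ?addr_ge0 ?mulr_ge0.
apply: (integral_step_flow T0' al3 al2 dr (M := C + Cg) (L := Cg * (c * c + 1) + CR * (c + 1 + 1))) => //.
- by rewrite addr_ge0.
- move=> t tT; split.
    apply: (@le_trans _ _ C); last by rewrite lerDl.
    exact: (sob_bounded (regular_sigma sreg)).
  move=> j; apply: (@le_trans _ _ Cg); last by rewrite lerDr.
  by rewrite sigma_along'E//; exact: (sob_bounded (second_coefficient_bounded C0 sreg j)).
- move=> s t j s0 st tT; have [w1 w2] := cP s t s0 st tT.
  have w0 : 0 <= om s t `^ al by exact: powR_ge0.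
  have sT : 0 <= s <= T by rewrite s0 (le_trans st).
  have tT' : 0 <= t <= T by rewrite tT (le_trans s0).
  apply: le_trans (composition_increment j sT tT') _.
  apply: (@le_trans _ _ (Cg * (c * c + 1) * om s t `^ al)); last first.
    by rewrite ler_wpM2r// lerDl mulr_ge0// !addr_ge0.
  rewrite -mulrA ler_wpM2l// mulrDl mul1r; apply: lerD; last exact: Yw.
  rewrite ger0_norm ?subr_ge0//; apply: le_trans w2 _; rewrite -mulrA ler_wpM2l//.
  by rewrite expr2 ler_wpM2r.
move=> s t j s0 st tT; have [w1 w2] := cP s t s0 st tT.
have w0 : 0 <= (om s t `^ al) ^+ 2 by rewrite exprn_ge0// powR_ge0.
apply: le_trans (composition_remainder j s0 st tT) _.
apply: (@le_trans _ _ (CR * (c + 1 + 1) * (om s t `^ al) ^+ 2)); last first.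
  by rewrite ler_wpM2r// lerDr mulr_ge0// addr_ge0// mulr_ge0.
rewrite -mulrA ler_wpM2l// !mulrDl mul1r; apply: lerD; last exact: Rw.
apply: lerD => //; rewrite ler_pXn2r ?nnegrE ?powR_ge0//; exact: Yw.
Qed.

End Composition.
End ControlledPaths.

(** * Solutions of the equation *)

(* Joins the complete and the normed structures of spaces of matrices. *)
HB.instance Definition _ (R : realType) (k l : nat) := NormedModule.on 'M[R]_(k, l).

Section Solutions.
Context {R : realType} {n m d : nat}.
Notation V := 'cV[R]_n.
Notation LT := (lebesgueType R).
Notation leb := (@lebesgue R).

Lemma euler_state_independent (A : R -> R -> V) s t (y : V) pi :
  euler (fun s t (_ : V) => A s t + 0) s y pi = y + partition_sum A s t pi.
Proof.
elim: pi s y => [|v pi IH] s y /=; first by rewrite partition_sum_nil addr0.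
by rewrite IH partition_sum_cons addr0 addrA.
Qed.

Lemma zero_drift (T : R) om : control T om -> drift T 0 om (fun _ _ (_ : V) => 0).
Proof.
move=> omC; split=> [s r t y _ _ _ _|s t y _ _ _|s t x y _ _ _].
- by rewrite addr0.
- by rewrite normr0 mul0r.
- by rewrite subrr normr0 !mul0r.
Qed.

Variables (p T al : R) (U : set 'cV[R]_m) (u : R -> 'cV[R]_m).
Variables (b : R -> V -> 'cV[R]_m -> V) (C_b C : R) (sigma : R -> V -> 'M[R]_(n, d)).
Variables (X : R -> 'cV[R]_d) (XX : R -> R -> 'M[R]_d) (y : V).
Hypotheses (T0 : 0 < T) (p2 : 2 <= p) (al3 : 1 < 3 * al) (al2 : 2 * al <= 1)
  (pal : p * al < 1).
Hypothesis hu : Linfty `[0, T] U u.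
Hypothesis b_measurable : forall x v, U v ->
  lebesgue_measurable_mx `[0, T] (fun t => b t x v).
Hypothesis b_continuous : \forall t \ae lebesgue, t \in `[0, T] ->
  {within [set z : 'cV[R]_n * 'cV[R]_m | U z.2], continuous (fun z => b t z.1 z.2)}.
Hypothesis hC_b : 0 <= C_b.
Hypothesis b_bounded_lipschitz : \forall t \ae lebesgue, t \in `[0, T] ->
  forall (x x' : 'cV[R]_n) (v : 'cV[R]_m), U v ->
  `|b t x v| <= C_b /\ `|b t x v - b t x' v| <= C_b * `|x - x'|.
Hypotheses (C0 : 0 <= C) (sreg : regular_coefficient T C sigma).
Hypothesis rp : rough_path p T X XX.

Let ga := 3 * al - 1.
Let T0' : 0 <= T. Proof. exact: ltW. Qed.
Let p0 : 0 < p. Proof. exact: lt_le_trans p2. Qed.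
Let al0 : 0 < al. Proof. by move: al3; lra. Qed.
Let ga0 : 0 < ga. Proof. by rewrite subr_gt0. Qed.
Let gaal : ga <= al. Proof. by rewrite /ga; move: al2; lra. Qed.
Let al1 : al <= 1. Proof. by move: al2 al0; lra. Qed.

Let uU t : 0 <= t <= T -> U (u t).
Proof. by move=> tT; case: hu => _ _; apply; rewrite /= in_itv. Qed.

Let um : lebesgue_measurable_mx `[0, T] u. Proof. by case: hu. Qed.

Local Notation A Y := (drift_integral u b Y).
Local Notation B := (frozen_drift u b).

(** The compensated Riemann sums are the Euler schemes, started at zero, of a
    flow that ignores the state: their convergence and the local expansion of
    the integral are instances of the convergence of schemes. *)
Lemma rough_integral_step (Y : R -> V) (Y' : R -> 'M[R]_(n, d)) om :
  (forall t, 0 <= t <= T -> Y' t = sigma t (Y t)) -> path_control T al X XX Y Y' om ->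
  let Z := sigma_along sigma Y in let Z' := sigma_along' sigma Y Y' in
  (forall t, 0 <= t <= T -> rough_integrable X XX Z Z' 0 t) /\
  exists2 eps, 0 < eps <= 1 & exists2 K, 0 <= K &
  forall s t, 0 <= s -> s <= t -> t <= T -> om s t <= eps ->
    `|increment (rough_integral X XX Z Z' 0) s t - integral_step X XX Z Z' s t|
      <= K * (om s t * om s t `^ ga).
Proof.
move=> Y'E pc Z Z'; have omC := driver_control (path_driver pc).
have [K K0 flow] := composition_flow T0 al3 al2 C0 sreg Y'E pc.
have zd := zero_drift omC.
have eE t : euler (fun s t (_ : V) => integral_step X XX Z Z' s t + 0) 0 0 =
    compensated_sum X XX Z Z' 0 t.
  by apply/funext => pi; rewrite (euler_state_independent _ 0 t) add0r.
split.
  move=> t /andP[t0 tT].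
  have := @euler_cvg R V T K 0 al ga om _ _ T0' K0 (lexx 0) ga0 gaal al1 omC flow zd 0 t 0
    (lexx 0) t0 tT.
  by rewrite (eE t).
have [eps eps01 [K' K'0 est]] :=
  @euler_limit_step R V T K 0 al ga om _ _ T0' K0 (lexx 0) ga0 gaal al1 omC flow zd.
exists eps => //; exists K' => // s t s0 st tT we.
have iE r : euler_limit (fun s t (_ : V) => integral_step X XX Z Z' s t) (fun _ _ _ => 0) 0 0 r
    = rough_integral X XX Z Z' 0 r by rewrite /euler_limit (eE r).
by have := est 0 s t s0 st tT we; rewrite /step_error !iE addr0.
Qed.

Lemma rough_integral_diag (Z : R -> 'M[R]_(n, d)) (Z' : R -> 'I_d -> 'M[R]_(n, d)) :
  rough_integral X XX Z Z' 0 0 = 0.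
Proof.
have FF := mesh_to_0_proper (lexx (0 : R)).
apply: cvg_lim => //; apply/cvgrPdist_le => e e0; apply/mesh_to_0P; exists 1 => // pi.
move=> /itv_partitionxx -> _.
by rewrite /compensated_sum partition_sum_nil subrr normr0 ltW.
Qed.

Let drift_bound := drift_integral_bound uU um b_measurable b_continuous hC_b b_bounded_lipschitz T0'.
Let drift_frozen := drift_integral_frozen uU um b_measurable b_continuous hC_b b_bounded_lipschitz T0'.
Let frozen_is_drift om := @frozen_drift_drift _ _ _ T U u b uU um b_measurable b_continuous
  C_b hC_b b_bounded_lipschitz T0' om.

Lemma drift_integral0 (Y : R -> V) : A Y 0 = 0.
Proof.
apply/matrixP => i j; rewrite !mxE /Rintegral.
have z : leb (`[0, 0]%classic : set LT) = 0%E by rewrite lebesgue_itv_cc// subrr.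
have mN : measurable (`[0, 0]%classic : set LT) by exact: interval_lebesgue_measurable.
rewrite (_ : integral _ _ _ = 0%E); first exact: erefl.
apply: null_set_integral; [exact: mN| |exact: z].
move=> _ Y' _; apply: completed_lebesgue_measure_is_complete.
apply: (@negligibleS _ _ _ _ (`[0, 0]%classic : set LT)); first by move=> t [].
exact/negligibleP.
Qed.

(** One step of a path solves the equation up to order [1 + ga] whenever the
    rough part does; the state frozen in the drift costs one more increment. *)
Lemma drift_step_error (Y : R -> V) om K eps : control T om ->
  {within `[0, T], continuous Y} -> 0 <= K -> eps <= 1 ->
  (forall s t, 0 <= s -> s <= t -> t <= T -> t - s <= om s t) ->
  (forall s t, 0 <= s -> s <= t -> t <= T -> om s t <= eps -> `|increment Y s t| <= K * om s t `^ al) ->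
  forall s t, 0 <= s -> s <= t -> t <= T -> om s t <= eps ->
  `|increment (A Y) s t - B s t (Y s)| <= C_b * K * (om s t * om s t `^ ga).
Proof.
move=> omC Yc K0 eps1 len Yw s t s0 st tT we; have w1 := le_trans we eps1.
have w0 := control_ge0 omC s0 st tT.
have e0 : 0 <= K * om s t `^ al by rewrite mulr_ge0// powR_ge0.
apply: le_trans (drift_frozen Yc s0 st tT e0 _) _.
  move=> r /andP[sr rt]; have rT := le_trans rt tT.
  have wr : om s r <= om s t by exact: (control_mono omC).
  apply: le_trans (Yw s r s0 sr rT (le_trans wr we)) _; rewrite ler_wpM2l//.
  by apply: powR_le; rewrite ?(ltW al0) ?(control_ge0 omC).
rewrite [leRHS](_ : _ = C_b * (K * om s t `^ ga) * om s t); last by ring.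
apply: ler_pM; rewrite ?subr_ge0//; [by rewrite mulr_ge0| |exact: len].
by rewrite ler_wpM2l// ler_wpM2l// powR_al_ga.
Qed.

(** Uniqueness. The increments of a solution are those of the drift and of the
    rough integral, both of which agree with the step of the scheme up to order
    [1 + ga]; such a path is the limit of the scheme. *)
Theorem solution_is_euler_limit (Z : R -> V) (Z' : R -> 'M[R]_(n, d)) :
  rde_solution p T y b u sigma X XX Z Z' ->
  forall t, 0 <= t <= T -> Z t = euler_limit (rough_step sigma X XX) B 0 y t.
Proof.
move=> [cZ Z'E eqZ] t /andP[t0 tT].
have Z'E' r : 0 <= r <= T -> Z' r = sigma r (Z r) by move=> rT; apply: Z'E; rewrite in_itv.
have [om0 dr0] := rough_path_driver T0 p2 al3 pal rp.
have [om pc _] := controlled_path_control T0 p2 al3 pal rp cZ dr0.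
have dr := path_driver pc; have omC := driver_control dr.
have [_ [eps /andP[eps0 eps1] [K K0 est]]] := rough_integral_step Z'E' pc.
have [Kf Kf0 flow] := rough_step_flow T0' al3 al2 dr C0 sreg.
have Zc : {within `[0, T], continuous Z} by case: cZ => -[].
have Zy : Z 0 = y.
  rewrite eqZ ?in_itv/= ?lexx// -/(A Z 0) drift_integral0 rough_integral_diag.
  by rewrite !addr0.
have FF := mesh_to_0_proper t0.
apply/esym/cvg_lim => //; rewrite -Zy.
apply: (@euler_cvg_to R V T Kf C_b al ga om _ _ T0' Kf0 hC_b ga0 gaal omC flow
  (frozen_is_drift omC (driver_length dr)) Z (K + C_b * 1) eps 0 t) => //.
  by rewrite addr_ge0// mulr1.
move=> s r s0 sr rt we; have rT := le_trans rt tT.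
have sT := le_trans sr rT; have r0 := le_trans s0 sr.
have h1 := est s r s0 sr rT we.
have Zw s' t' : 0 <= s' -> s' <= t' -> t' <= T -> om s' t' <= 1 ->
    `|increment Z s' t'| <= 1 * om s' t' `^ al.
  by move=> *; rewrite mul1r; exact: (path_increment pc).
have h2 := drift_step_error omC Zc ler01 (lexx 1) (driver_length dr) Zw s0 sr rT (le_trans we eps1).
have ZE q : 0 <= q -> q <= T -> Z q = y + A Z q + rough_integral X XX
    (sigma_along sigma Z) (sigma_along' sigma Z Z') 0 q.
  by move=> q0 qT; apply: eqZ; rewrite in_itv/= q0.
have stepE : integral_step X XX (sigma_along sigma Z) (sigma_along' sigma Z Z') s r =
    rough_step sigma X XX s r (Z s).
  rewrite /integral_step /rough_step; congr (_ + _); apply: eq_bigr => j _.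
  by rewrite /sigma_along' Z'E'// s0.
rewrite stepE in h1.
have -> : step_error (rough_step sigma X XX) B Z s r =
   (increment (rough_integral X XX (sigma_along sigma Z) (sigma_along' sigma Z Z') 0) s r
     - rough_step sigma X XX s r (Z s)) + (increment (A Z) s r - B s r (Z s)).
  rewrite /step_error {1}(ZE r r0 rT) {1}(ZE s s0 sT).
  rewrite /increment; zmod.
apply: le_trans (ler_normD _ _) _; rewrite mulrDl; exact: lerD.
Qed.

Let le_powR_al x : 0 <= x -> x <= 1 -> x <= x `^ al.
Proof.
move=> x0 x1; move: x0; rewrite le_eqVlt => /predU1P[<-|x0]; first exact: powR_ge0.
by apply: ger1_powR => //; rewrite x0.
Qed.

Lemma local_increments_continuous (E : normedModType R) (Y : R -> E) om K eps : control T om ->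
  0 <= K -> 0 < eps ->
  (forall s t, 0 <= s -> s <= t -> t <= T -> om s t <= eps -> `|increment Y s t| <= K * om s t `^ al) ->
  {within `[0, T], continuous Y}.
Proof.
move=> omC K0 eps0 Yw; apply/within_continuous_ballP => x Dx e e0.
have [eta /andP[eta0 _] etaP] := exists_small_powR al0 K0 e0.
have ee : 0 < Num.min eps eta by rewrite lt_min eps0.
have [h h0 hP] := control_small omC ee; exists h => // z Dz; rewrite -ball_normE/= => /ltW xz.
have main s t : 0 <= s -> s <= t -> t <= T -> t - s <= h -> `|Y s - Y t| <= e.
  move=> s0 st tT ts; have := hP s t s0 st tT ts; rewrite le_min => /andP[w1 w2].
  rewrite distrC; apply: le_trans (Yw s t s0 st tT w1) _; apply: etaP => //.
  exact: (control_ge0 omC).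
move: Dx Dz; rewrite /= !in_itv/= => /andP[x0 xT] /andP[z0 zT].
have [le|/ltW le] := leP x z; last by rewrite distrC; apply: main => //; exact: le_trans (ler_norm _) xz.
by apply: main => //; apply: le_trans (ler_norm _) _; rewrite distrC.
Qed.

Let Y := euler_limit (rough_step sigma X XX) B 0 y.
Let Y' t := sigma t (Y t).

Let sum_increment s t : increment Y s t =
  step_error (rough_step sigma X XX) B Y s t + rough_step sigma X XX s t (Y s) + B s t (Y s).
Proof. by rewrite /step_error /increment; zmod. Qed.

Lemma euler_limit_estimates om : rough_driver T al om X XX ->
  exists2 eps, 0 < eps <= 1 & exists2 K, 0 <= K &
  forall s t, 0 <= s -> s <= t -> t <= T -> om s t <= eps ->
    `|step_error (rough_step sigma X XX) B Y s t| <= K * (om s t * om s t `^ ga) /\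
    `|increment Y s t| <= K * om s t `^ al.
Proof.
move=> dr; have omC := driver_control dr; have len := driver_length dr.
have w0 := control_ge0 omC.
have [Kf Kf0 flow] := rough_step_flow T0' al3 al2 dr C0 sreg.
have BD := frozen_is_drift omC len.
have [eps /andP[eps0 eps1] [K K0 est]] :=
  euler_limit_step T0' Kf0 hC_b ga0 gaal al1 omC flow BD.
have K1 : K <= K + Kf + C_b by rewrite -addrA lerDl addr_ge0.
exists eps; first by rewrite eps0.
exists (K + Kf + C_b); first by rewrite !addr_ge0.
move=> s t s0 st tT we; have w1 := le_trans we eps1; have w00 := w0 s t s0 st tT.
have := est y s t s0 st tT we; rewrite -/Y => eY.
split; first by apply: le_trans eY _; rewrite ler_wpM2r// mulr_ge0// powR_ge0.
have wal := le_powR_al w00 w1.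
rewrite sum_increment !mulrDl; apply: le_trans (ler_normD _ _) _; apply: lerD; last first.
  by apply: le_trans (drift_bounded BD _ s0 st tT) _; rewrite ler_wpM2l.
apply: le_trans (ler_normD _ _) _; apply: lerD; last exact: (flow_bounded flow).
apply: le_trans eY _; rewrite ler_wpM2l//.
apply: le_trans wal; apply: ler_piMr => //.
by apply: le_trans (powR_le (ltW ga0) w00 w1) _; rewrite powR1.
Qed.

Lemma euler_limit_continuous : {within `[0, T], continuous Y}.
Proof.
have [om dr] := rough_path_driver T0 p2 al3 pal rp.
have [eps /andP[eps0 _] [K K0 est]] := euler_limit_estimates dr.
apply: (local_increments_continuous (driver_control dr) K0 eps0) => s t s0 st tT we.
by have [] := est s t s0 st tT we.
Qed.

(** The second order term of a step and the drift are of finite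
    [p / 2]-variation by themselves; what is left is of order [om `^ (3 * al)],
    for large [om] because everything is bounded. *)
Lemma euler_limit_remainder om : rough_driver T al om X XX ->
  exists2 K, 0 <= K & forall s t, 0 <= s -> s <= t -> t <= T ->
    `|remainder X Y Y' s t| <= K * (`|XX s t| + (t - s) + om s t `^ (3 * al)).
Proof.
move=> dr; have omC := driver_control dr; have w0 := control_ge0 omC.
have [c c0 cP] := driver_weight_bound T0' al3 al2 dr.
have [eps /andP[eps0 _] [K K0 est]] := euler_limit_estimates dr.
have [M M0 MP] := path_bounded euler_limit_continuous.
pose Cg := 4 * n%:R * C * C.
have Cg0 : 0 <= Cg by rewrite !mulr_ge0.
pose M2 := M + M + d%:R * (C * c).
have M20 : 0 <= M2 by rewrite !addr_ge0// !mulr_ge0.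
have e30 : 0 < eps `^ (3 * al) by exact: powR_gt0.
pose K2 := d%:R * (d%:R * Cg) + C_b + (K + M2 / eps `^ (3 * al)).
have d20 : 0 <= d%:R * (d%:R * Cg) by rewrite !mulr_ge0.
have Me0 : 0 <= M2 / eps `^ (3 * al) by rewrite divr_ge0// ltW.
exists K2; first by rewrite !addr_ge0.
move=> s t s0 st tT; have sT := le_trans st tT; have t0 := le_trans s0 st.
have s0T : 0 <= s <= T by rewrite s0.
have t0T : 0 <= t <= T by rewrite t0.
have ts0 : 0 <= t - s by rewrite subr_ge0.
have w30 : 0 <= om s t `^ (3 * al) by exact: powR_ge0.
have S0 : 0 <= `|XX s t| + (t - s) by rewrite addr_ge0.
have [we|we] := leP (om s t) eps.
  have -> : remainder X Y Y' s t = (\sum_j second_coefficient sigma j s (Y s) *m col j (XX s t)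
    + B s t (Y s)) + step_error (rough_step sigma X XX) B Y s t.
    by rewrite /remainder sum_increment /rough_step /second_coefficient /Y'; zmod.
  rewrite mulrDr; apply: le_trans (ler_normD _ _) _; apply: lerD; last first.
    apply: le_trans (est s t s0 st tT we).1 _.
    have g30 : 0 < 3 * al by rewrite mulr_gt0.
    rewrite /ga (mulr_powRB1 (w0 s t s0 st tT) g30) ler_wpM2r//.
    by rewrite /K2 addrA addrAC lerDr !addr_ge0.
  rewrite mulrDr; apply: le_trans (ler_normD _ _) _; apply: lerD; last first.
    have cc : {within `[0, T], continuous (fun=> Y s)} by move=> ?; exact: cvg_cst.
    apply: le_trans (drift_bound cc s0 st tT) _; rewrite ler_wpM2r//.
    by rewrite /K2 addrAC lerDr !addr_ge0.
  apply: (@le_trans _ _ (d%:R * (d%:R * Cg) * `|XX s t|)); last first.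
    by rewrite ler_wpM2r// /K2 -addrA lerDl !addr_ge0.
  apply: le_trans (ler_norm_sum _ _ _) _.
  rewrite -mulrA -[X in X%:R * _](card_ord d) mulr_natl -sumr_const; apply: ler_sum => j _.
  apply: le_trans (mulmx_norm_le _ _) _; rewrite -mulrA ler_wpM2l// ler_pM//.
    exact: (sob_bounded (second_coefficient_bounded C0 sreg j)).
  exact: col_norm_le.
apply: (@le_trans _ _ M2).
  apply: le_trans (ler_normB _ _) _; apply: lerD.
    by apply: le_trans (ler_normB _ _) _; rewrite lerD ?MP.
  apply: le_trans (mulmx_norm_le _ _) _; rewrite ler_wpM2l// ler_pM//.
    exact: (sob_bounded (regular_sigma sreg)).
  exact: le_trans (driver_first dr s0 st tT) (cP s t s0 st tT).1.
apply: (@le_trans _ _ (M2 / eps `^ (3 * al) * om s t `^ (3 * al))).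
  rewrite mulrAC ler_pdivlMr// ler_wpM2l//; apply: powR_le; [|exact: ltW|exact: ltW].
  by rewrite mulr_ge0// ltW.
apply: ler_pM => //; last by rewrite lerDr.
by rewrite /K2 addrA lerDr !addr_ge0.
Qed.

Lemma euler_limit_controlled : controlled p T X Y Y'.
Proof.
have [om dr] := rough_path_driver T0 p2 al3 pal rp; have omC := driver_control dr.
have [K K0 Rbound] := euler_limit_remainder dr.
have ph0 : 0 < p / 2 by rewrite divr_gt0.
have ph1 : 1 <= p / 2 by rewrite ler_pdivlMr// mul1r.
have p1 : 1 <= p by apply: le_trans p2; rewrite ler1n.
have len0 (s t : R) : 0 <= s -> s <= t -> t <= T -> 0 <= t - s by rewrite subr_ge0.
have Rfv : finite_variation T (p / 2) (fun s t => `|remainder X Y Y' s t|).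
  have pos1 (s t : R) : 0 <= s -> s <= t -> t <= T -> 0 <= `|XX s t| + (t - s).
    by move=> *; rewrite addr_ge0 ?len0.
  have q1 : 1 <= 3 * al * (p / 2) by move: (ler_pM ler01 ler01 (ltW al3) ph1); rewrite mulr1.
  have q0 : 0 <= 3 * al by rewrite mulr_ge0// ltW.
  have XX0 (s t : R) : 0 <= s -> s <= t -> t <= T -> 0 <= `|XX s t| by [].
  have om30 (s t : R) : 0 <= s -> s <= t -> t <= T -> 0 <= om s t `^ (3 * al).
    by move=> *; exact: powR_ge0.
  have f1 := finite_variation_add (ltW ph0) XX0 len0
    (second_finite_variation T0 p2 rp) (finite_variation_length T ph1).
  have f2 := finite_variation_control q0 q1 (control_weak omC).
  have f3 := finite_variation_add (ltW ph0) pos1 om30 f1 f2.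
  apply: (finite_variation_le (ltW ph0) (finite_variation_scale (ltW ph0) K0 _ f3)).
    by move=> s t s0 st tT; rewrite addr_ge0 ?pos1 ?om30.
  by move=> s t s0 st tT; rewrite normr_ge0/= Rbound.
have cY : Cvar p T Y.
  split; first exact: euler_limit_continuous.
  apply: (increment_finite_variation Y p0 T0').2.
  case: (rp) => -[_ Xv] _ _ _; have Xf := (increment_finite_variation X p0 T0').1 Xv.
  have X0 (s t : R) : 0 <= s -> s <= t -> t <= T -> 0 <= `|increment X s t| by [].
  have R0 (s t : R) : 0 <= s -> s <= t -> t <= T -> 0 <= `|remainder X Y Y' s t| by [].
  have dC0 : 0 <= d%:R * C by rewrite mulr_ge0.
  have dX0 (s t : R) : 0 <= s -> s <= t -> t <= T -> 0 <= d%:R * C * `|increment X s t|.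
    by move=> *; rewrite mulr_ge0.
  have pp : p / 2 <= p by rewrite ler_pdivrMr// ler_pMr// ler1n.
  have f1 := finite_variation_scale (ltW p0) dC0 X0 Xf.
  have f2 := finite_variation_up ph0 pp R0 Rfv.
  apply: (finite_variation_le (ltW p0) (finite_variation_add (ltW p0) dX0 R0 f1 f2)).
  move=> s t s0 st tT; rewrite normr_ge0/=.
  have sT : 0 <= s <= T by rewrite s0 (le_trans st).
  have -> : increment Y s t = Y' s *m increment X s t + remainder X Y Y' s t.
    by rewrite /remainder; zmod.
  apply: le_trans (ler_normD _ _) _; rewrite lerD2r.
  apply: le_trans (mulmx_norm_le _ _) _; rewrite -mulrA ler_wpM2l// ler_wpM2r//.
  exact: (sob_bounded (regular_sigma sreg)).
split; first exact: cY.
  apply: (Cvar_of_increments T0' p1 C0 cY) => s t sT tT.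
  exact: (sob_along Y C0 (regular_sigma sreg)).
by apply/(variation_norm_finiteP ph0 T0') => // s _ _; exact: remainder_diag.
Qed.

(** Existence. The path [W = Y - y - drift] starts at zero and has, by the local
    estimates of [Y], small one-step errors for the scheme of compensated sums;
    hence it is the limit of that scheme, which is the rough integral. *)
Theorem euler_limit_is_solution : rde_solution p T y b u sigma X XX Y Y'.
Proof.
split; [exact: euler_limit_controlled|by []|] => t; rewrite in_itv/= => /andP[t0 tT].
have [om dr] := rough_path_driver T0 p2 al3 pal rp; have omC := driver_control dr.
have [eps /andP[eps0 eps1] [K K0 est]] := euler_limit_estimates dr.
have Y'E r : 0 <= r <= T -> Y' r = sigma r (Y r) by [].
have [om' pc omle] := controlled_path_control T0 p2 al3 pal rp euler_limit_controlled dr.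
have omC' := driver_control (path_driver pc).
have [K' K'0 iflow] := composition_flow T0 al3 al2 C0 sreg Y'E pc.
pose W t := Y t - y - A Y t.
have W0 : W 0 = 0.
  have Y0 : Y 0 = y by apply: (@euler_limit0 _ _ T).
  by rewrite /W drift_integral0 subr0 Y0 subrr.
have KC : 0 <= K + C_b * K by rewrite addr_ge0 ?mulr_ge0.
have FF := mesh_to_0_proper t0.
have Wstep s r : 0 <= s -> s <= r -> r <= t -> om' s r <= eps ->
  `|step_error (fun s t (_ : V) => integral_step X XX (sigma_along sigma Y)
      (sigma_along' sigma Y Y') s t) (fun _ _ _ => 0) W s r|
    <= (K + C_b * K) * (om' s r * om' s r `^ ga).
  move=> s0 sr rt we'; have rT := le_trans rt tT.
  have oo := omle s r s0 sr rT; have we := le_trans oo we'.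
  have w00 := control_ge0 omC s0 sr rT.
  have h1 := (est s r s0 sr rT we).1.
  have h2 := drift_step_error omC euler_limit_continuous K0 eps1 (driver_length dr)
    (fun s t s0 st tT we => (est s t s0 st tT we).2) s0 sr rT we.
  have -> : step_error (fun s t (_ : V) => integral_step X XX (sigma_along sigma Y)
        (sigma_along' sigma Y Y') s t) (fun _ _ _ => 0) W s r =
      step_error (rough_step sigma X XX) B Y s r - (increment (A Y) s r - B s r (Y s)).
    rewrite /step_error /W /integral_step /sigma_along' /rough_step /sigma_along /increment.
    zmod.
  apply: le_trans (ler_normB _ _) _.
  apply: (@le_trans _ _ ((K + C_b * K) * (om s r * om s r `^ ga))).
    by rewrite mulrDl; exact: lerD.
  rewrite ler_wpM2l// ler_pM ?powR_ge0//; apply: powR_le => //; exact: ltW.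
have Wlim : euler (fun s t (_ : V) => integral_step X XX (sigma_along sigma Y)
      (sigma_along' sigma Y Y') s t + 0) 0 0 @ mesh_to_0 0 t --> W t.
  have := @euler_cvg_to R V T K' 0 al ga om' _ _ T0' K'0 (lexx 0) ga0 gaal omC' iflow
    (zero_drift omC') W (K + C_b * K) eps 0 t eps0 KC (lexx 0) t0 tT Wstep.
  by rewrite W0.
have eE : euler (fun s t (_ : V) => integral_step X XX (sigma_along sigma Y)
      (sigma_along' sigma Y Y') s t + 0) 0 0 =
    compensated_sum X XX (sigma_along sigma Y) (sigma_along' sigma Y Y') 0 t.
  by apply/funext => pi; rewrite (euler_state_independent _ 0 t) add0r.
rewrite eE in Wlim.
have -> : rough_integral X XX (sigma_along sigma Y) (sigma_along' sigma Y Y') 0 t = W t.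
  exact: cvg_lim Wlim.
by rewrite -/(A Y t) /W; zmod.
Qed.

End Solutions.
Theorem theorem3p9 (R : realType) (n m d : nat) (p T : R)
    (hp : 2 <= p < 3) (hT : 0 < T)
    (y : 'cV[R]_n) (U : set 'cV[R]_m) (u : R -> 'cV[R]_m)
    (hu : Linfty `[0, T] U u)
    (b : R -> 'cV[R]_n -> 'cV[R]_m -> 'cV[R]_n)
    (b_measurable : forall x v, U v ->
       lebesgue_measurable_mx `[0, T] (fun t => b t x v))
    (b_continuous : \forall t \ae lebesgue, t \in `[0, T] ->
       {within [set z : 'cV[R]_n * 'cV[R]_m | U z.2],
         continuous (fun z => b t z.1 z.2)})
    (C_b : R) (hC_b : 0 <= C_b)
    (b_bounded_lipschitz : \forall t \ae lebesgue, t \in `[0, T] ->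
       forall (x x' : 'cV[R]_n) (v : 'cV[R]_m), U v ->
         `|b t x v| <= C_b /\ `|b t x v - b t x' v| <= C_b * `|x - x'|)
    (sigma : R -> 'cV[R]_n -> 'M[R]_(n, d))
    (hsigma : Ckb [set z : R^o * 'cV[R]_n | z.1 \in `[0, T]] 3
       (fun z => sigma z.1 z.2))
    (X : R -> 'cV[R]_d) (XX : R -> R -> 'M[R]_d)
    (hX : rough_path p T X XX) :
  (forall (Y : R -> 'cV[R]_n) (Y' : R -> 'M[R]_(n, d)),
     controlled p T X Y Y' ->
     (forall t, t \in `[0, T] -> Y' t = sigma t (Y t)) ->
     controlled_mx p T X (sigma_along sigma Y) (sigma_along' sigma Y Y') /\
     forall t, t \in `[0, T] ->
       rough_integrable X XX (sigma_along sigma Y)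
         (sigma_along' sigma Y Y') 0 t) /\
  exists (Y : R -> 'cV[R]_n) (Y' : R -> 'M[R]_(n, d)),
    rde_solution p T y b u sigma X XX Y Y' /\
    forall (Z : R -> 'cV[R]_n) (Z' : R -> 'M[R]_(n, d)),
      rde_solution p T y b u sigma X XX Z Z' ->
      forall t, t \in `[0, T] -> Z t = Y t /\ Z' t = Y' t.
Proof.
case/andP: hp => p2 p3; have T0' := ltW hT.
(* [al^-1 = (p + 3) / 2] lies strictly between [p] and [3]: controls exist for
   exponents above [p], and sewing needs [1 < 3 * al]. *)
pose al : R := 2 / (p + 3).
have p30 : 0 < p + 3 by rewrite addr_gt0// (lt_le_trans _ p2).
have al3 : 1 < 3 * al by rewrite /al mulrA ltr_pdivlMr// mul1r; move: p3; lra.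
have al2 : 2 * al <= 1 by rewrite /al mulrA ler_pdivrMr// mul1r; move: p2; lra.
have pal : p * al < 1 by rewrite /al mulrA ltr_pdivrMr// mul1r; move: p3; lra.
have [C C0 sreg] := Ckb_regular_coefficient hT hsigma.
split.
  move=> Y Y' cY Y'E.
  have Y'E' t : 0 <= t <= T -> Y' t = sigma t (Y t) by move=> tT; apply: Y'E; rewrite in_itv.
  have [om dr] := rough_path_driver hT p2 al3 pal hX.
  have [om' pc _] := controlled_path_control hT p2 al3 pal hX cY dr.
  split; first exact: (composition_controlled hT p2 C0 sreg Y'E' cY).
  move=> t; rewrite in_itv/= => tT.
  exact: (rough_integral_step hT al3 al2 C0 sreg Y'E' pc).1.
pose Y := euler_limit (rough_step sigma X XX) (frozen_drift u b) 0 y.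
exists Y, (fun t => sigma t (Y t)); split.
  exact: (euler_limit_is_solution y hT p2 al3 al2 pal hu b_measurable b_continuous hC_b
    b_bounded_lipschitz C0 sreg hX).
move=> Z Z' sZ t tT; have [_ Z'E _] := sZ.
have ZY : Z t = Y t.
  by apply: (solution_is_euler_limit hT p2 al3 al2 pal hu b_measurable b_continuous hC_b
    b_bounded_lipschitz C0 sreg hX sZ); move: tT; rewrite in_itv.
by rewrite ZY (Z'E t tT) ZY.
Qed.
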